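(* Let $A=\bigoplus_{i=0}^{\ell}A_i$ be a finite dimensional non-negatively graded $1$-Iwanaga-Gorenstein algebra over $K$, and let $V:=\bigoplus_{i\ge 1}A(i)_{\ge 0}$. Then the following hold. (1) $V$ is a presilting object in $\underline{\mathsf{CM}}^{\mathbb{Z}}A$. (2) If $A_0$ has finite global dimension, then $V$ is a silting object in $\underline{\mathsf{CM}}^{\mathbb{Z}}A$.
   Context: $K$ is a fixed base field; algebras are finite dimensional $K$-algebras, and modules are finitely generated right modules. For a non-negatively graded algebra $A=\bigoplus_{i=0}^{\ell}A_i$ with $A_\ell\neq 0$, $\operatorname{mod}^{\mathbb{Z}}A$ is the category of finitely generated $\mathbb{Z}$-graded right $A$-modules with degree-preserving morphisms, and $\operatorname{proj}^{\mathbb{Z}}A$ is its full subcategory of graded projective modules. $A$ is a graded $d$-Iwanaga-Gorenstein algebra if the graded injective dimensions of $A_A$ and ${}_AA$ are at most $d$. For a graded module $X$, $X(n)$ is the degree shift with $X(n)_i=X_{i+n}$; $X_{\ge n}=\bigoplus_{i\ge n}X_i$ is a graded submodule, and $X_{<n}=X/X_{\ge n}$. The module $V=\bigoplus_{i\ge1}A(i)_{\ge 0}$ has only finitely many nonzero summands (those with $1\le i\le\ell$); it is the first graded syzygy of $U=\bigoplus_{i=1}^{\ell}A(i)_{<0}$, and it is Cohen-Macaulay when $A$ is a graded $1$-Iwanaga-Gorenstein algebra. A finitely generated graded module $M$ is Cohen-Macaulay (CM) if $\operatorname{Ext}^i_A(M,A)=0$ for all $i>0$. $\mathsf{CM}^{\mathbb{Z}}A\subset\operatorname{mod}^{\mathbb{Z}}A$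 is the full subcategory of graded CM modules; it is a Frobenius category, and its stable category $\underline{\mathsf{CM}}^{\mathbb{Z}}A:=\mathsf{CM}^{\mathbb{Z}}A/[\operatorname{proj}^{\mathbb{Z}}A]$ has its natural triangulated structure, with shift $[1]$. An object $T$ of a triangulated category $\mathscr{T}$ is presilting if $\operatorname{Hom}_{\mathscr{T}}(T,T[i])=0$ for all $i>0$; it is silting if moreover $\mathscr{T}=\operatorname{thick}T$, the smallest thick subcategory containing $T$. *)

(* Defs.v *)
From HB Require Import structures.
From mathcomp Require Import all_boot all_order all_algebra all_field.

Set Implicit Arguments.
Unset Strict Implicit.
Unset Printing Implicit Defensive.

Import Order.TTheory GRing.Theory Num.Theory.
Local Open Scope ring_scope.

(* Finite dimensional right modules over a finite dimensional algebra B.      *)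

Section Modules.
Variables (K : fieldType) (B : falgType K).

Record rmod := RMod {
  rmod_sort :> vectType K;
  ract : rmod_sort -> B -> rmod_sort;
  ract_linearl : forall b, linear (ract^~ b);
  ract_linearr : forall m, linear (ract m);
  ractM : forall m b c, ract m (b * c) = ract (ract m b) c;
  ract1 : forall m, ract m 1 = m }.

Definition rhom (M N : rmod) (f : 'Hom(M, N)) : Prop :=
  forall m b, f (ract m b) = ract (f m) b.

Definition rprojective (P : rmod) : Prop :=
  forall (M N : rmod) (g : 'Hom(M, N)) (f : 'Hom(P, N)),
    rhom g -> limg g = fullv -> rhom f ->
    exists h : 'Hom(P, M), rhom h /\ (g \o h)%VF = f.

Record proj_resolution (M : rmod) := ProjResolution {
  res_obj :> nat -> rmod;
  res_d : forall n, 'Hom(res_obj n.+1, res_obj n);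
  res_aug : 'Hom(res_obj 0, M);
  res_proj : forall n, rprojective (res_obj n);
  res_dhom : forall n, rhom (res_d n);
  res_aughom : rhom res_aug;
  res_surj : limg res_aug = fullv;
  res_exact0 : limg (res_d 0) = lker res_aug;
  res_exactS : forall n, limg (res_d n.+1) = lker (res_d n) }.

Definition is_cocycle M (P : proj_resolution M) (N : rmod) n
    (f : 'Hom(P n, N)) : Prop :=
  rhom f /\ (f \o res_d P n)%VF = 0.

Definition is_coboundary M (P : proj_resolution M) (N : rmod) n :
    'Hom(P n, N) -> Prop :=
  match n with
  | 0%N => fun f => f = 0
  | n'.+1 => fun f => exists g : 'Hom(P n', N), rhom g /\ f = (g \o res_d P n')%VF
  end.

(* Ext^n(M, N) = 0, where Ext is the cohomology of Hom(P, N); it does not     *)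
(* depend on the projective resolution P of M, and one always exists.         *)
Definition Ext_vanishes n (M N : rmod) : Prop :=
  exists P : proj_resolution M,
    forall f : 'Hom(P n, N), is_cocycle f -> is_coboundary f.

Definition projdim_le n (M : rmod) : Prop :=
  exists P : proj_resolution M, forall i, (n < i)%N -> \dim {:P i} = 0%N.

Definition finite_gldim : Prop := exists n, forall M : rmod, projdim_le n M.

Lemma regular_linearl (b : B) : linear (fun m : B => m * b).
Proof. by move=> k x y; rewrite mulrDl scalerAl. Qed.

Lemma regular_linearr (m : B) : linear (fun b : B => m * b).
Proof. by move=> k x y; rewrite mulrDr scalerAr. Qed.

Definition regular_rmod : rmod :=
  @RMod B *%R regular_linearl regular_linearr (@mulrA B) (@mulr1 B).

End Modules.

Arguments regular_rmod {K} B.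
Arguments Ext_vanishes {K B} n M N.

(* The opposite algebra; left modules over A are right modules over it.       *)

Definition opp_alg (K : fieldType) (A : falgType K) : Type := A^c.

Section OppositeAlgebra.
Variables (K : fieldType) (A : falgType K).

HB.instance Definition _ := Vector.copy (opp_alg A) A.
HB.instance Definition _ := GRing.NzRing.copy (opp_alg A) A^c.

HB.instance Definition _ := GRing.Lmodule_isLalgebra.Build K (opp_alg A)
  (fun k x y => @scalerAr K A k y x).
HB.instance Definition _ := GRing.Lalgebra_isAlgebra.Build K (opp_alg A)
  (fun k x y => @scalerAl K A k y x).
HB.instance Definition _ := Algebra_isFalgebra.Build K (opp_alg A).

End OppositeAlgebra.

Record graded_alg (K : fieldType) := GradedAlg {
  galg_sort :> falgType K;
  galg_deg : nat -> {vspace galg_sort};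
  galg_top : nat;
  galg_sum : (\sum_(i < galg_top.+1) galg_deg i)%VS = fullv;
  galg_direct : directv (\sum_(i < galg_top.+1) galg_deg i);
  galg_out : forall i, (galg_top < i)%N -> galg_deg i = 0%VS;
  galg_top_neq0 : galg_deg galg_top != 0%VS;
  galg_1 : 1 \in galg_deg 0;
  galg_M : forall i j a b,
    a \in galg_deg i -> b \in galg_deg j -> a * b \in galg_deg (i + j) }.

Section GradedAlgebra.
Variables (K : fieldType) (A : graded_alg K).

Fact galg_deg0_aspace : is_aspace (galg_deg A 0).
Proof.
rewrite /is_aspace has_algid1 ?galg_1 //=.
by apply/prodvP => a b a0 b0; apply: (galg_M a0 b0).
Qed.

(* A_0, as the falgType of elements of the subalgebra A_0 of A.               *)
Definition galg0 : falgType K := subvs_of (ASpace galg_deg0_aspace).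

Fact opp_galg_M i j (a b : opp_alg A) :
  a \in galg_deg A i -> b \in galg_deg A j ->
  (a * b : opp_alg A) \in galg_deg A (i + j).
Proof. by move=> ai bj; rewrite addnC; apply: (galg_M bj ai). Qed.

Definition opp_galg : graded_alg K :=
  @GradedAlg K (opp_alg A) (galg_deg A) (galg_top A) (galg_sum A)
    (galg_direct A) (@galg_out K A) (galg_top_neq0 A) (galg_1 A) opp_galg_M.

End GradedAlgebra.

Lemma subv_sum_seq (K : fieldType) (vT : vectType K) (I : eqType) (r : seq I)
    (P : pred I) (U : I -> {vspace vT}) (V : {vspace vT}) :
  (forall i, i \in r -> P i -> (U i <= V)%VS) ->
  (\sum_(i <- r | P i) U i <= V)%VS.
Proof.
move=> UV; rewrite big_seq_cond; elim/big_rec: _ => [|i W /andP[ir Pi] WV].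
  exact: sub0v.
by rewrite subv_add UV.
Qed.

Lemma subv_sup_seq (K : fieldType) (vT : vectType K) (I : eqType) (r : seq I)
    (P : pred I) (U : I -> {vspace vT}) i :
  i \in r -> P i -> (U i <= \sum_(i <- r | P i) U i)%VS.
Proof. by move=> ir Pi; rewrite (big_rem _ ir) Pi addvSl. Qed.

(* Finitely generated (= finite dimensional) Z-graded right modules.          *)

Section GradedModules.
Variables (K : fieldType) (A : graded_alg K).

(* gm_supp lists finitely many degrees outside of which the module vanishes;  *)
(* it may contain degrees in which the module is zero.                        *)
Record gmod := GMod {
  gm_rmod :> rmod A;
  gm_deg : int -> {vspace gm_rmod};
  gm_supp : seq int;
  gm_uniq : uniq gm_supp;
  gm_out : forall i, i \notin gm_supp -> gm_deg i = 0%VS;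
  gm_sum : (\sum_(i <- gm_supp) gm_deg i)%VS = fullv;
  gm_direct : forall x : int -> gm_rmod, (forall i, x i \in gm_deg i) ->
    \sum_(i <- gm_supp) x i = 0 -> forall i, x i = 0;
  gm_act : forall i j m a,
    m \in gm_deg i -> a \in galg_deg A j -> ract m a \in gm_deg (i + j%:Z) }.

Definition ghom (M N : gmod) (f : 'Hom(M, N)) : Prop :=
  rhom f /\ forall i m, m \in gm_deg M i -> f m \in gm_deg N i.

Definition gprojective (P : gmod) : Prop :=
  forall (M N : gmod) (g : 'Hom(M, N)) (f : 'Hom(P, N)),
    ghom g -> limg g = fullv -> ghom f ->
    exists h : 'Hom(P, M), ghom h /\ (g \o h)%VF = f.

Definition ginjective (I : gmod) : Prop :=
  forall (M N : gmod) (g : 'Hom(M, N)) (f : 'Hom(M, I)),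
    ghom g -> lker g = 0%VS -> ghom f ->
    exists h : 'Hom(N, I), ghom h /\ (h \o g)%VF = f.

Record ginj_resolution (M : gmod) := GInjResolution {
  ires_obj :> nat -> gmod;
  ires_d : forall n, 'Hom(ires_obj n, ires_obj n.+1);
  ires_aug : 'Hom(M, ires_obj 0);
  ires_inj : forall n, ginjective (ires_obj n);
  ires_dhom : forall n, ghom (ires_d n);
  ires_aughom : ghom ires_aug;
  ires_ker0 : lker ires_aug = 0%VS;
  ires_exact0 : limg ires_aug = lker (ires_d 0);
  ires_exactS : forall n, limg (ires_d n) = lker (ires_d n.+1) }.

Definition ginjdim_le d (M : gmod) : Prop :=
  exists I : ginj_resolution M, forall i, (d < i)%N -> \dim {:I i} = 0%N.

Definition regular_deg (i : int) : {vspace regular_rmod A} :=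
  match i with Posz n => galg_deg A n | Negz _ => 0%VS end.

Definition regular_supp : seq int := [seq Posz i | i <- iota 0 (galg_top A).+1].

Fact regular_uniq : uniq regular_supp.
Proof. by rewrite map_inj_uniq ?iota_uniq // => x y []. Qed.

Fact regular_out i : i \notin regular_supp -> regular_deg i = 0%VS.
Proof.
case: i => [n|//] nin; apply: galg_out; rewrite ltnNge; apply: contra nin => le_n.
by apply/mapP; exists n => //; rewrite mem_iota add0n ltnS le_n.
Qed.

Fact regular_sum : (\sum_(i <- regular_supp) regular_deg i)%VS = fullv.
Proof.
rewrite big_map -[iota _ _]/(index_iota 0 (galg_top A).+1) big_mkord.
exact: galg_sum.
Qed.

Fact regular_direct (x : int -> regular_rmod A) :
  (forall i, x i \in regular_deg i) ->
  \sum_(i <- regular_supp) x i = 0 -> forall i, x i = 0.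
Proof.
move=> xin; rewrite big_map -[iota _ _]/(index_iota 0 (galg_top A).+1) big_mkord.
move=> x0 i; case: (boolP (i \in regular_supp)) => [|iout]; last first.
  by apply/eqP; rewrite -memv0 -(regular_out iout).
case/mapP=> n; rewrite mem_iota add0n => /andP[_ lt_n] ->.
have /directv_sum_independent dA := galg_direct A.
exact: (dA (fun j => x (Posz j)) (fun j _ => xin (Posz j)) x0 (Ordinal lt_n)).
Qed.

Fact regular_act i j (m : regular_rmod A) a :
  m \in regular_deg i -> a \in galg_deg A j ->
  ract m a \in regular_deg (i + j%:Z).
Proof.
case: i => [n|n] /=; first exact: galg_M.
by rewrite memv0 => /eqP-> _; rewrite mul0r mem0v.
Qed.

Definition regular_gmod : gmod :=
  @GMod (regular_rmod A) regular_deg regular_supp regular_uniq regular_out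
    regular_sum regular_direct regular_act.

(* The degree shift X(n), with X(n)_i = X_{i + n}.                            *)

Section Shift.
Variables (X : gmod) (n : int).

Definition gshift_deg (i : int) : {vspace X} := gm_deg X (i + n).
Definition gshift_supp : seq int := [seq i - n | i <- gm_supp X].

Fact gshift_uniq : uniq gshift_supp.
Proof. by rewrite map_inj_uniq ?gm_uniq //; apply: addIr. Qed.

Fact gshift_out i : i \notin gshift_supp -> gshift_deg i = 0%VS.
Proof.
move=> iout; apply: gm_out; apply: contra iout => iin.
by apply/mapP; exists (i + n) => //; rewrite addrK.
Qed.

Fact gshift_sum : (\sum_(i <- gshift_supp) gshift_deg i)%VS = fullv.
Proof.
rewrite big_map -[RHS](gm_sum X).
by apply: eq_bigr => i _; rewrite /gshift_deg subrK.
Qed.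

Fact gshift_direct (x : int -> X) :
  (forall i, x i \in gshift_deg i) ->
  \sum_(i <- gshift_supp) x i = 0 -> forall i, x i = 0.
Proof.
move=> xin; rewrite big_map => x0 i.
have xin' j : x (j - n) \in gm_deg X j.
  by have := xin (j - n); rewrite /gshift_deg subrK.
by rewrite -[i](addrK n) (gm_direct xin' x0).
Qed.

Fact gshift_act i j (m : X) a :
  m \in gshift_deg i -> a \in galg_deg A j -> ract m a \in gshift_deg (i + j%:Z).
Proof. by move=> mi aj; rewrite /gshift_deg addrAC; apply: gm_act. Qed.

Definition gshift : gmod :=
  @GMod X gshift_deg gshift_supp gshift_uniq gshift_out gshift_sum gshift_direct
    gshift_act.

End Shift.

(* The graded submodule X_{>= n}.                                             *)

Section Truncation.
Variables (X : gmod) (n : int).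

Definition trunc_vs : {vspace X} :=
  (\sum_(i <- gm_supp X | (n <= i)%R) gm_deg X i)%VS.

Lemma deg_sub_trunc i : n <= i -> (gm_deg X i <= trunc_vs)%VS.
Proof.
move=> ni; case: (boolP (i \in gm_supp X)) => [ir | /gm_out->]; last exact: sub0v.
exact: subv_sup_seq.
Qed.

Lemma trunc_act (m : X) a : m \in trunc_vs -> ract m a \in trunc_vs.
Proof.
pose f : {linear X -> X} :=
  HB.pack (fun m : X => ract m a) (GRing.isLinear.Build K X X _ _ (ract_linearl a)).
suff: (trunc_vs <= linfun f @^-1: trunc_vs)%VS.
  by move=> /subvP sub /sub; rewrite -memv_preim lfunE.
apply: subv_sum_seq => i _ ni; apply/subvP => {}m mi.
rewrite -memv_preim lfunE /=.
pose g : {linear A -> X} :=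
  HB.pack (ract m) (GRing.isLinear.Build K A X _ _ (ract_linearr m)).
suff: (fullv <= linfun g @^-1: trunc_vs)%VS.
  by move=> /subvP/(_ a (memvf a)); rewrite -memv_preim lfunE.
rewrite -(galg_sum A); apply/subv_sumP => j _; apply/subvP => b bj.
rewrite -memv_preim lfunE /=.
by apply: (subvP (deg_sub_trunc _)) (gm_act mi bj); rewrite ler_wpDr.
Qed.

Definition trunc_ract (m : subvs_of trunc_vs) (a : A) : subvs_of trunc_vs :=
  Subvs (trunc_act a (subvsP m)).

Fact trunc_linearl a : linear (trunc_ract^~ a).
Proof. by move=> k x y; apply: val_inj; apply: ract_linearl. Qed.

Fact trunc_linearr m : linear (trunc_ract m).
Proof. by move=> k x y; apply: val_inj; apply: ract_linearr. Qed.

Fact trunc_ractM m a b : trunc_ract m (a * b) = trunc_ract (trunc_ract m a) b.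
Proof. by apply: val_inj; apply: ractM. Qed.

Fact trunc_ract1 m : trunc_ract m 1 = m.
Proof. by apply: val_inj; apply: ract1. Qed.

Definition trunc_rmod : rmod A :=
  @RMod K A (subvs_of trunc_vs) trunc_ract trunc_linearl trunc_linearr
    trunc_ractM trunc_ract1.

Definition trunc_deg (i : int) : {vspace trunc_rmod} :=
  (linfun (vsval : subvs_of trunc_vs -> X) @^-1: gm_deg X i)%VS.

Lemma mem_trunc_deg i (m : subvs_of trunc_vs) :
  (m \in trunc_deg i) = (vsval m \in gm_deg X i).
Proof. by rewrite -memv_preim lfunE. Qed.

Fact trunc_out i : i \notin gm_supp X -> trunc_deg i = 0%VS.
Proof.
move=> iout; apply/vspaceP => m; rewrite mem_trunc_deg gm_out // !memv0.
by rewrite -(inj_eq val_inj).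
Qed.

Fact trunc_sum : (\sum_(i <- gm_supp X) trunc_deg i)%VS = fullv.
Proof.
apply/eqP; rewrite eqEsubv subvf; apply/subvP => m _.
suff: (trunc_vs <= linfun (vsval : subvs_of trunc_vs -> X)
                   @: \sum_(i <- gm_supp X) trunc_deg i)%VS.
  move/subvP/(_ _ (subvsP m))/memv_imgP => [m' m'in].
  by rewrite lfunE => /val_inj->.
apply: subv_sum_seq => i ir ni; apply/subvP => x xi.
have xt : x \in trunc_vs by apply: subvP xi; apply: deg_sub_trunc.
apply/memv_imgP; exists (Subvs xt); last by rewrite lfunE.
by apply: (subvP (subv_sup_seq (P := predT) _ ir isT)); rewrite mem_trunc_deg.
Qed.

Fact trunc_direct (x : int -> trunc_rmod) :
  (forall i, x i \in trunc_deg i) ->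
  \sum_(i <- gm_supp X) x i = 0 -> forall i, x i = 0.
Proof.
move=> xin x0 i; apply: val_inj; apply: (gm_direct (x := vsval \o x)) => [j|].
  by rewrite -mem_trunc_deg.
by have /(congr1 vsval) := x0; rewrite linear_sum.
Qed.

Fact trunc_gact i j (m : trunc_rmod) a :
  m \in trunc_deg i -> a \in galg_deg A j -> ract m a \in trunc_deg (i + j%:Z).
Proof. by rewrite !mem_trunc_deg => mi aj; apply: gm_act. Qed.

Definition gtrunc : gmod :=
  @GMod trunc_rmod trunc_deg (gm_supp X) (gm_uniq X) trunc_out trunc_sum
    trunc_direct trunc_gact.

End Truncation.

Section DirectSum.
Variables X Y : gmod.

Definition dsum_ract (m : X * Y) (a : A) : X * Y := (ract m.1 a, ract m.2 a).

Fact dsum_linearl a : linear (dsum_ract^~ a).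
Proof. by move=> k x y; congr (_, _); apply: ract_linearl. Qed.

Fact dsum_linearr m : linear (dsum_ract m).
Proof. by move=> k x y; congr (_, _); apply: ract_linearr. Qed.

Fact dsum_ractM m a b : dsum_ract m (a * b) = dsum_ract (dsum_ract m a) b.
Proof. by congr (_, _); apply: ractM. Qed.

Fact dsum_ract1 m : dsum_ract m 1 = m.
Proof. by case: m => x y; congr (_, _); apply: ract1. Qed.

Definition dsum_rmod : rmod A :=
  @RMod K A (X * Y)%type dsum_ract dsum_linearl dsum_linearr dsum_ractM dsum_ract1.

Definition dsum_deg (i : int) : {vspace dsum_rmod} :=
  ((linfun (fst : X * Y -> X) @^-1: gm_deg X i)
   :&: (linfun (snd : X * Y -> Y) @^-1: gm_deg Y i))%VS.

Lemma mem_dsum_deg i (m : X * Y) :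
  (m \in dsum_deg i) = (m.1 \in gm_deg X i) && (m.2 \in gm_deg Y i).
Proof. by rewrite memv_cap -!memv_preim !lfunE. Qed.

Definition dsum_supp : seq int := undup (gm_supp X ++ gm_supp Y).

Fact dsum_uniq : uniq dsum_supp. Proof. exact: undup_uniq. Qed.

Fact dsum_out i : i \notin dsum_supp -> dsum_deg i = 0%VS.
Proof.
rewrite mem_undup mem_cat negb_or => /andP[iX iY]; apply/vspaceP => -[x y].
by rewrite mem_dsum_deg !gm_out // !memv0.
Qed.

Fact dsum_sum : (\sum_(i <- dsum_supp) dsum_deg i)%VS = fullv.
Proof.
apply/eqP; rewrite eqEsubv subvf; apply/subvP => -[x y] _.
have -> : ((x, y) : dsum_rmod) = (x, 0) + (0, y).
  by congr (_, _); rewrite /= ?addr0 ?add0r.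
pose f (x : X) : dsum_rmod := (x, 0); pose g (y : Y) : dsum_rmod := (0, y).
have lf : linear f by move=> k a b; congr (_, _); rewrite /= scaler0 addr0.
have lg : linear g by move=> k a b; congr (_, _); rewrite /= scaler0 addr0.
pose F : {linear X -> dsum_rmod} := HB.pack f (GRing.isLinear.Build K _ _ _ _ lf).
pose G : {linear Y -> dsum_rmod} := HB.pack g (GRing.isLinear.Build K _ _ _ _ lg).
have sX : (fullv <= linfun F @^-1: \sum_(i <- dsum_supp) dsum_deg i)%VS.
  rewrite -(gm_sum X); apply: subv_sum_seq => i ir _; apply/subvP => z zi.
  rewrite -memv_preim lfunE.
  apply: (subvP (subv_sup_seq (P := predT) _ (i := i) _ isT)).
    by rewrite mem_undup mem_cat ir.
  by rewrite mem_dsum_deg zi mem0v.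
have sY : (fullv <= linfun G @^-1: \sum_(i <- dsum_supp) dsum_deg i)%VS.
  rewrite -(gm_sum Y); apply: subv_sum_seq => i ir _; apply/subvP => z zi.
  rewrite -memv_preim lfunE.
  apply: (subvP (subv_sup_seq (P := predT) _ (i := i) _ isT)).
    by rewrite mem_undup mem_cat ir orbT.
  by rewrite mem_dsum_deg zi mem0v.
apply: memvD.
  by have := subvP sX x (memvf x); rewrite -memv_preim lfunE.
by have := subvP sY y (memvf y); rewrite -memv_preim lfunE.
Qed.

Lemma gm_direct_sup (Z : gmod) (s : seq int) (x : int -> Z) :
  uniq s -> {subset gm_supp Z <= s} -> (forall i, x i \in gm_deg Z i) ->
  \sum_(i <- s) x i = 0 -> forall i, x i = 0.
Proof.
move=> us sub xin x0; apply: gm_direct => //; rewrite -[RHS]x0.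
rewrite [RHS](bigID (mem (gm_supp Z))) /= [X in _ + X]big1 ?addr0 => [|i iout].
  rewrite -[RHS]big_filter; apply: perm_big; apply: uniq_perm.
  - exact: gm_uniq.
  - exact: filter_uniq.
  by move=> i; rewrite mem_filter; case: (boolP (_ \in _)) => // /sub->.
by apply/eqP; rewrite -memv0 -(gm_out iout).
Qed.

Fact dsum_direct (x : int -> dsum_rmod) :
  (forall i, x i \in dsum_deg i) ->
  \sum_(i <- dsum_supp) x i = 0 -> forall i, x i = 0.
Proof.
move=> xin x0 i; rewrite [x i]surjective_pairing; congr (_, _).
  apply: (gm_direct_sup (x := fst \o x) dsum_uniq) => [j jX|j|].
  - by rewrite mem_undup mem_cat jX.
  - by have := xin j; rewrite mem_dsum_deg => /andP[].
  by have /(congr1 fst) := x0; rewrite linear_sum.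
apply: (gm_direct_sup (x := snd \o x) dsum_uniq) => [j jX|j|].
- by rewrite mem_undup mem_cat jX orbT.
- by have := xin j; rewrite mem_dsum_deg => /andP[].
by have /(congr1 snd) := x0; rewrite linear_sum.
Qed.

Fact dsum_gact i j (m : dsum_rmod) a :
  m \in dsum_deg i -> a \in galg_deg A j -> ract m a \in dsum_deg (i + j%:Z).
Proof. by rewrite !mem_dsum_deg => /andP[? ?] ?; rewrite !gm_act. Qed.

Definition gdsum : gmod :=
  @GMod dsum_rmod dsum_deg dsum_supp dsum_uniq dsum_out dsum_sum dsum_direct
    dsum_gact.

End DirectSum.

Section Zero.

Fact zero_linearl (a : A) : linear (fun m : 'rV[K]_0 => m).
Proof. by []. Qed.

Fact zero_linearr (m : 'rV[K]_0) : linear (fun _ : A => m).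
Proof. by move=> k x y; rewrite [LHS]thinmx0 [RHS]thinmx0. Qed.

Definition zero_rmod : rmod A :=
  @RMod K A 'rV[K]_0 (fun m _ => m) zero_linearl zero_linearr
    (fun _ _ _ => erefl) (fun _ => erefl).

Fact zero_sum : (\sum_(i <- [::] : seq int) 0)%VS = fullv :> {vspace zero_rmod}.
Proof.
rewrite big_nil; apply/vspaceP => m; rewrite memvf memv0.
by apply/eqP; apply: thinmx0.
Qed.

Definition gzero : gmod :=
  @GMod zero_rmod (fun _ => 0%VS) [::] isT (fun _ _ => erefl) zero_sum
    (fun x _ _ i => thinmx0 (x i)) (fun _ _ _ _ m0 _ => m0).

End Zero.

(* V = \bigoplus_{i >= 1} A(i)_{>= 0}: the summands with i > galg_top A are   *)
(* zero, so i ranges over 1, .., galg_top A.                                  *)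
Definition Vmod : gmod :=
  foldr gdsum gzero
    [seq gtrunc (gshift regular_gmod i%:Z) 0 | i <- iota 1 (galg_top A)].

(* The Frobenius category of graded Cohen-Macaulay modules.                   *)

(* Cohen-Macaulayness forgets the grading: Ext is over the ungraded A.        *)
Definition CM (M : gmod) : Prop :=
  forall i, (0 < i)%N -> Ext_vanishes i M (regular_rmod A).

Definition short_exact (X Y Z : gmod) (f : 'Hom(X, Y)) (g : 'Hom(Y, Z)) : Prop :=
  [/\ ghom f, ghom g, lker f = 0%VS, limg f = lker g & limg g = fullv].

(* A conflation 0 -> X -> P -> X[1] -> 0 in CM^Z A with P in proj^Z A. For X  *)
(* in CM^Z A, its third term is the value at X of the shift functor [1] of    *)
(* the stable category, which is only defined up to stable isomorphism.       *)
Record suspension (X : gmod) := Suspension {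
  susp_proj : gmod;
  susp_obj : gmod;
  susp_in : 'Hom(X, susp_proj);
  susp_out : 'Hom(susp_proj, susp_obj);
  susp_projP : gprojective susp_proj;
  susp_CM : CM susp_obj;
  susp_exact : short_exact susp_in susp_out }.

(* A pair (a, a1) such that a1 : X[1] -> X'[1] represents a[1].               *)
Definition susp_map (X X' : gmod) (s : suspension X) (s' : suspension X')
    (a : 'Hom(X, X')) (a1 : 'Hom(susp_obj s, susp_obj s')) : Prop :=
  ghom a1 /\ exists p : 'Hom(susp_proj s, susp_proj s'),
    [/\ ghom p, (p \o susp_in s)%VF = (susp_in s' \o a)%VF
      & (a1 \o susp_out s)%VF = (susp_out s' \o p)%VF].

(* The stable category: morphisms modulo those factoring through proj^Z A.    *)

Definition stably_zero (M N : gmod) (f : 'Hom(M, N)) : Prop :=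
  exists (P : gmod) (a : 'Hom(M, P)) (b : 'Hom(P, N)),
    [/\ gprojective P, ghom a, ghom b & f = (b \o a)%VF].

Definition stably_eq (M N : gmod) (f g : 'Hom(M, N)) : Prop := stably_zero (f - g).

Definition stable_iso (M N : gmod) (f : 'Hom(M, N)) : Prop :=
  ghom f /\ exists g : 'Hom(N, M),
    [/\ ghom g, stably_eq (g \o f)%VF \1%VF & stably_eq (f \o g)%VF \1%VF].

Definition stably_isomorphic (M N : gmod) : Prop :=
  exists f : 'Hom(M, N), stable_iso f.

(* Standard triangles X -u-> Y -v-> Z -w-> X[1]: Z is the pushout of u and of *)
(* X -> P, and w is induced by 0 : Y -> X[1] and P -> X[1].                   *)
Definition standard_triangle (X Y Z : gmod) (s : suspension X)
    (u : 'Hom(X, Y)) (v : 'Hom(Y, Z)) (w : 'Hom(Z, susp_obj s)) : Prop :=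
  [/\ ghom u, ghom v, ghom w & exists t : 'Hom(susp_proj s, Z),
    [/\ ghom t,
        (v \o u)%VF = (t \o susp_in s)%VF,
        forall z, exists y p, z = v y + t p,
        forall y p, v y = t p -> exists x, y = u x /\ p = susp_in s x
      & (w \o v)%VF = 0 /\ (w \o t)%VF = susp_out s]].

Definition distinguished (X Y Z : gmod) (s : suspension X)
    (u : 'Hom(X, Y)) (v : 'Hom(Y, Z)) (w : 'Hom(Z, susp_obj s)) : Prop :=
  [/\ ghom u, ghom v & ghom w] /\
  exists (X' Y' Z' : gmod) (s' : suspension X')
    (u' : 'Hom(X', Y')) (v' : 'Hom(Y', Z')) (w' : 'Hom(Z', susp_obj s'))
    (a : 'Hom(X, X')) (b : 'Hom(Y, Y')) (c : 'Hom(Z, Z'))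
    (a1 : 'Hom(susp_obj s, susp_obj s')),
    [/\ [/\ CM X', CM Y', CM Z' & standard_triangle u' v' w'],
        [/\ stable_iso a, stable_iso b, stable_iso c & susp_map a a1],
        stably_eq (u' \o a)%VF (b \o u)%VF,
        stably_eq (v' \o b)%VF (c \o v)%VF
      & stably_eq (w' \o c)%VF (a1 \o w)%VF].

(* C is (the class of objects of) a thick subcategory of the stable category. *)
Record thick (C : gmod -> Prop) : Prop := Thick {
  thick_CM : forall X, C X -> CM X;
  thick_iso : forall X Y, CM Y -> stably_isomorphic X Y -> C X -> C Y;
  thick_shift : forall X (s : suspension X), CM X -> (C X <-> C (susp_obj s));
  thick_triangle : forall (X Y Z : gmod) (s : suspension X)
      (u : 'Hom(X, Y)) (v : 'Hom(Y, Z)) (w : 'Hom(Z, susp_obj s)),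
    CM X -> CM Y -> CM Z -> distinguished u v w ->
    [/\ C X -> C Y -> C Z, C Y -> C Z -> C X & C X -> C Z -> C Y];
  thick_summand : forall X X' Y, CM X -> CM X' ->
    stably_isomorphic (gdsum X X') Y -> C Y -> C X }.

(* iterated_shift T n Y: the module Y represents T[n].                        *)
Inductive iterated_shift (T : gmod) : nat -> gmod -> Prop :=
  | Shift0 : iterated_shift T 0 T
  | ShiftS n Y (s : suspension Y) :
      iterated_shift T n Y -> iterated_shift T n.+1 (susp_obj s).

(* T is an object of the stable category and Hom(T, T[n]) = 0 for n > 0, for  *)
(* all (and at least one of) the modules representing T[n].                   *)
Definition presilting (T : gmod) : Prop :=
  CM T /\ forall n, (0 < n)%N ->
    (exists Y, iterated_shift T n Y) /\
    (forall Y, iterated_shift T n Y ->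
       forall f : 'Hom(T, Y), ghom f -> stably_zero f).

Definition silting (T : gmod) : Prop :=
  presilting T /\
  forall C, thick C -> C T -> forall X, CM X -> C X.

End GradedModules.

Arguments regular_gmod {K} A.
Arguments Vmod {K} A.

(* Left modules over A are right modules over the opposite algebra.           *)
Definition iwanaga_gorenstein (K : fieldType) (d : nat) (A : graded_alg K) : Prop :=
  ginjdim_le d (regular_gmod A) /\ ginjdim_le d (regular_gmod (opp_galg A)).

(* Main.v *)
Require Import Defs.
From HB Require Import structures.
From mathcomp Require Import all_boot all_order all_algebra all_field.
From mathcomp Require Import zify.

Set Implicit Arguments.
Unset Strict Implicit.
Unset Printing Implicit Defensive.

Import Order.TTheory GRing.Theory Num.Theory.
Local Open Scope ring_scope.

(** Cohen-Macaulay modules over a graded 1-Iwanaga-Gorenstein algebra [A] are the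
    submodules of projectives. A submodule [M] of a projective [P] has
    Ext^i(M, A) = Ext^(i + 1)(P / M, A) = 0 for [i > 0], since [A] has right
    injective dimension at most one ([torsionless_ext1_zero]). Conversely, by
    duality the left injective dimension bounds the projective dimension of
    right injectives, so every [M] embeds in an injective [I] with a presentation
    0 -> P1 -> P0 -> I -> 0 by projectives, and for Cohen-Macaulay [M] the
    embedding lifts to [P0] ([CM_torsionless]). A map from [M] to a projective
    through which all maps from [M] to [A] factor then has a Cohen-Macaulay
    cokernel, which is the suspension of [M] ([CM_suspension]).

    V is presilting because it is concentrated in nonnegative degrees and is a
    submodule of a projective F whose quotient U = F / V is concentrated in
    negative degrees. Stable maps from X to V[1] are therefore maps from X to U
    modulo projectives, and these vanish if X is concentrated in nonnegative
    degrees ([stably_zero_V1]). Replacing X with its syzygy, which stays in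
    nonnegative degrees, gives the vanishing for V[n] ([stably_zero_Vn]).

    For the generation statement, let [C] be a thick subcategory containing V,
    and call a graded module good if its first syzygy, which is
    Cohen-Macaulay, belongs to [C] ([syz_in]). Good modules have the
    two-out-of-three property on short exact sequences ([syz_in_ses]), are
    closed under summands, and include the projectives, the injectives and the
    modules A(n)_{>= 0} for [n >= 1]; a Cohen-Macaulay module is good exactly when
    it belongs to [C]. It remains to see that every module is good, and
    dissecting by degree reduces this to modules concentrated in one degree,
    which are modules over [A_0]. In a negative degree [- n], finite projective
    dimension over [A_0] reduces further to [A_0] in that degree, which is what
    remains of A(n)_{< 0} after its parts in the degrees between [- n] and [0],
    good by induction, are removed ([D_within_neg]). In a degree [b >= 0], one
    uses injectives instead: the part in degree [b] of an injective vanishing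
    above [b] is good because the parts in lower degrees are, and finite global
    dimension of [A_0] makes coresolutions by such injectives end after finitely
    many steps ([D_conc]). *)

(** * Linear maps *)

Section LinearMaps.
Variables (K : fieldType).
Implicit Types U V W : vectType K.

Fact lmap_subproof U V (f : U -> V) : linear f -> {h : 'Hom(U, V) | h =1 f}.
Proof.
move=> lf; exists (linfun (HB.pack_for {linear U -> V} f (GRing.isLinear.Build K U V _ f lf))).
exact: lfunE.
Qed.

Definition lmap U V (f : U -> V) (lf : linear f) : 'Hom(U, V) :=
  sval (lmap_subproof lf).

Lemma lmapE U V (f : U -> V) (lf : linear f) x : lmap lf x = f x.
Proof. exact: (svalP (lmap_subproof lf)). Qed.

Lemma lker0_injP U V (f : 'Hom(U, V)) : lker f = 0%VS <-> injective f.
Proof. by split=> [/eqP/lker0P|/lker0P/eqP]. Qed.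

Lemma limg_surjP U V (f : 'Hom(U, V)) :
  limg f = fullv <-> forall y, exists x, f x = y.
Proof.
split=> [fT y|fT].
  have /memv_imgP[x _ ->] : y \in limg f by rewrite fT memvf.
  by exists x.
apply/vspaceP => y; rewrite memvf; have [x <-] := fT y.
by rewrite memv_img ?memvf.
Qed.

Lemma mem_limgP U V (f : 'Hom(U, V)) y : y \in limg f <-> exists x, y = f x.
Proof.
split=> [/memv_imgP[x _ ->]|[x ->]]; first by exists x.
by rewrite memv_img ?memvf.
Qed.

Lemma limg_lkerP U V W (f : 'Hom(U, V)) (g : 'Hom(V, W)) :
  limg f = lker g <-> forall y, g y = 0 <-> exists x, y = f x.
Proof.
split=> [fg y|fg].
  by rewrite -mem_limgP fg memv_ker; split=> /eqP.
by apply/vspaceP => y; apply/idP/idP => [/mem_limgP/fg/eqP|];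
  rewrite memv_ker // => /eqP/fg/mem_limgP.
Qed.

Lemma inj_comp_inv U V W (i : 'Hom(U, V)) (f : 'Hom(W, V)) :
  (forall x, exists y, f x = i y) -> (i \o (i^-1 \o f))%VF = f.
Proof.
move=> fi; apply/lfunP => x; rewrite !comp_lfunE limg_lfunVK //.
exact/mem_limgP.
Qed.

Lemma surj_inv_comp U V W (p : 'Hom(U, V)) (f : 'Hom(U, W)) :
  (forall x, p x = 0 -> f x = 0) -> ((f \o p^-1) \o p)%VF = f.
Proof.
move=> pf; apply/lfunP => x; apply/eqP; rewrite !comp_lfunE -subr_eq0 -linearB.
by rewrite /= pf // linearB /= limg_lfunVK ?subrr // memv_img ?memvf.
Qed.

End LinearMaps.

Definition lfE := (comp_lfunE, add_lfunE, opp_lfunE, id_lfunE, zero_lfunE,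
  scale_lfunE).

(** * Module maps *)

Section RHom.
Variables (K : fieldType) (B : falgType K).
Implicit Types M N P : rmod B.

Definition ractr M (b : B) : 'End(M) := lmap (ract_linearl b : linear (fun m : M => ract m b)).
Definition ractl M (m : M) : 'Hom(regular_rmod B, M) :=
  lmap (ract_linearr m : linear (fun b : regular_rmod B => ract m b)).

Lemma ractrE M (b : B) (m : M) : ractr M b m = ract m b. Proof. exact: lmapE. Qed.

Lemma ractlE M (m : M) (b : B) : ractl m b = ract m b. Proof. exact: lmapE. Qed.

Lemma ractDl M (m n : M) (b : B) : ract (m + n) b = ract m b + ract n b.
Proof. by rewrite -!ractrE linearD. Qed.

Lemma ractNl M (m : M) (b : B) : ract (- m) b = - ract m b.
Proof. by rewrite -!ractrE linearN. Qed.

Lemma ractBl M (m n : M) (b : B) : ract (m - n) b = ract m b - ract n b.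
Proof. by rewrite -!ractrE linearB. Qed.

Lemma ract0l M (b : B) : ract (0 : M) b = 0.
Proof. by rewrite -!ractrE linear0. Qed.

Lemma ractZl M k (m : M) (b : B) : ract (k *: m) b = k *: ract m b.
Proof. by rewrite -!ractrE linearZ. Qed.

Lemma ractDr M (m : M) (b c : B) : ract m (b + c) = ract m b + ract m c.
Proof. by rewrite -!ractlE linearD. Qed.

Lemma ract0r M (m : M) : ract m (0 : B) = 0.
Proof. by rewrite -!ractlE linear0. Qed.

Lemma ract_suml M I (r : seq I) (P : pred I) (F : I -> M) (b : B) :
  ract (\sum_(i <- r | P i) F i) b = \sum_(i <- r | P i) ract (F i) b.
Proof. by rewrite -ractrE linear_sum; apply: eq_bigr => i _; apply: ractrE. Qed.

Lemma rhom_comp M N P (f : 'Hom(N, P)) (g : 'Hom(M, N)) :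
  rhom f -> rhom g -> rhom (f \o g)%VF.
Proof. by move=> hf hg m b; rewrite !lfE hg hf. Qed.

Lemma rhomD M N (f g : 'Hom(M, N)) : rhom f -> rhom g -> rhom (f + g).
Proof. by move=> hf hg m b; rewrite !lfE hf hg ractDl. Qed.

Lemma rhomN M N (f : 'Hom(M, N)) : rhom f -> rhom (- f).
Proof. by move=> hf m b; rewrite !lfE hf ractNl. Qed.

Lemma rhom0 M N : rhom (0 : 'Hom(M, N)).
Proof. by move=> m b; rewrite !lfE ract0l. Qed.

Lemma rhom1 M : rhom (\1%VF : 'End(M)).
Proof. by move=> m b; rewrite !lfE. Qed.

Lemma rhom_factor_inj M N P (i : 'Hom(N, P)) (f : 'Hom(M, P)) :
  rhom i -> injective i -> rhom f -> (forall x, exists y, f x = i y) ->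
  rhom (i^-1 \o f)%VF.
Proof.
move=> hi ii hf fi m b; apply: ii.
have /lfunP E := inj_comp_inv fi.
by rewrite hi; do 2 rewrite -[i _]comp_lfunE E; rewrite hf.
Qed.

Lemma rhom_factor_surj M N P (p : 'Hom(M, N)) (f : 'Hom(M, P)) :
  rhom p -> (forall y, exists x, p x = y) -> rhom f ->
  (forall x, p x = 0 -> f x = 0) -> rhom (f \o p^-1)%VF.
Proof.
move=> hp sp hf pf y b; have [x <-] := sp y.
have /lfunP E := surj_inv_comp pf.
by rewrite -hp; do 2 rewrite -[_ (p _)]comp_lfunE E; rewrite hf.
Qed.

End RHom.

(** * Homogeneous components *)

Section Components.
Variables (K : fieldType) (A : graded_alg K).
Implicit Types M N P X Y Z : gmod A.

(** The projection of [X] onto its component of degree [i]. *)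
Definition gpr X (i : int) : 'End(X) :=
  sumv_pi_for (esym (gm_sum X)) i.

Lemma gpr_in X i (x : X) : gpr X i x \in gm_deg X i.
Proof. exact: (memv_sum_pi (esym (gm_sum X))). Qed.

Lemma gpr_out X i (x : X) : i \notin gm_supp X -> gpr X i x = 0.
Proof. by move=> iX; apply/eqP; rewrite -memv0 -(gm_out iX) gpr_in. Qed.

Lemma gpr_sum X (x : X) : \sum_(i <- gm_supp X) gpr X i x = x.
Proof.
apply: (sumv_pi_uniq_sum (esym (gm_sum X))); last exact: memvf.
by rewrite filter_predT gm_uniq.
Qed.

Lemma gpr_deg X i j (x : X) : x \in gm_deg X j -> gpr X i x = if i == j then x else 0.
Proof.
move=> xj; apply/eqP; rewrite -subr_eq0.
apply/eqP.
apply: (@gm_direct K A X (fun i => gpr X i x - if i == j then x else 0)) => [k|].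
  by rewrite memvB ?gpr_in //; case: eqP => [->|]; rewrite ?mem0v.
rewrite sumrB gpr_sum; case: (boolP (j \in gm_supp X)) => jX; last first.
  rewrite big1_seq ?subr0; last first.
    by move=> k /andP[_ kX]; case: eqP => // kj; rewrite -kj kX in jX.
  by apply/eqP; rewrite -memv0 -(gm_out jX).
rewrite (bigD1_seq j) ?gm_uniq //= eqxx big1 ?addr0 ?subrr // => k.
by move=> /negPf->.
Qed.

Lemma gpr_id X i (x : X) : x \in gm_deg X i -> gpr X i x = x.
Proof. by move/gpr_deg->; rewrite eqxx. Qed.

Lemma mem_gpr X i (x : X) : (x \in gm_deg X i) = (gpr X i x == x).
Proof. by apply/idP/eqP => [/gpr_id //|<-]; apply: gpr_in. Qed.

Lemma gprK X i j (x : X) : gpr X i (gpr X j x) = if i == j then gpr X j x else 0.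
Proof. by rewrite (gpr_deg _ (gpr_in j x)). Qed.

Lemma gpr_eq X (x y : X) : (forall i, gpr X i x = gpr X i y) -> x = y.
Proof. by move=> xy; rewrite -[x]gpr_sum -[y]gpr_sum; apply: eq_bigr. Qed.

Lemma gpr_sum_sup X s (x : X) : uniq s -> {subset gm_supp X <= s} ->
  \sum_(i <- s) gpr X i x = x.
Proof.
move=> us sub; apply: gpr_eq => j; rewrite linear_sum /=.
case: (boolP (j \in s)) => js.
  rewrite (bigD1_seq j) //= gprK eqxx big1 ?addr0 // => i ij.
  by rewrite gprK eq_sym (negPf ij).
rewrite big1_seq => [|i /andP[_ iS]].
  by rewrite gpr_out //; apply: contra js => /sub.
by rewrite gprK; case: eqP => // ji; rewrite ji iS in js.
Qed.

Lemma eq_lfun_deg X (V : vectType K) (f g : 'Hom(X, V)) :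
  (forall i x, x \in gm_deg X i -> f x = g x) -> f = g.
Proof.
move=> fg; apply/lfunP => x; rewrite -[x]gpr_sum !linear_sum.
by apply: eq_bigr => i _; apply: fg; apply: gpr_in.
Qed.

Lemma galg_ind (Q : A -> Prop) :
  Q 0 -> (forall a b, Q a -> Q b -> Q (a + b)) ->
  (forall i a, a \in galg_deg A i -> Q a) -> forall a, Q a.
Proof.
move=> Q0 QD Qd a; have : a \in fullv by rewrite memvf.
rewrite -(galg_sum A) => /memv_sumP[f fi ->].
by elim/big_ind: _ => // i _; apply: (Qd i); apply: fi.
Qed.

Lemma gpr_act X i j (x : X) a : a \in galg_deg A j ->
  gpr X (i + j%:Z) (ract x a) = ract (gpr X i x) a.
Proof.
move=> aj; rewrite -{1}[x]gpr_sum ract_suml linear_sum /=.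
have E k : gpr X (i + j%:Z) (ract (gpr X k x) a) =
    if k == i then ract (gpr X i x) a else 0.
  rewrite (gpr_deg _ (gm_act (gpr_in k x) aj)) (inj_eq (addIr _)) eq_sym.
  by case: eqP => [->|].
rewrite (eq_bigr _ (fun k _ => E k)).
case: (boolP (i \in gm_supp X)) => iX.
  by rewrite (bigD1_seq i) ?gm_uniq //= eqxx big1 ?addr0 // => k /negPf->.
rewrite big1 => [|k _]; first by rewrite gpr_out // ract0l.
by case: eqP => // _; rewrite gpr_out // ract0l.
Qed.

Lemma ghom_rhom M N (f : 'Hom(M, N)) : ghom f -> rhom f.
Proof. by case. Qed.

Lemma ghom_gpr M N (f : 'Hom(M, N)) i x : ghom f -> f (gpr M i x) = gpr N i (f x).
Proof.
move=> [_ fd]; rewrite -{2}[x]gpr_sum !linear_sum /=.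
have E k : gpr N i (f (gpr M k x)) = if k == i then f (gpr M i x) else 0.
  by rewrite (gpr_deg _ (fd _ _ (gpr_in k x))) eq_sym; case: eqP => [->|].
rewrite (eq_bigr _ (fun k _ => E k)).
case: (boolP (i \in gm_supp M)) => iX.
  by rewrite (bigD1_seq i) ?gm_uniq //= eqxx big1 ?addr0 // => k /negPf->.
rewrite big1 => [|k _]; first by rewrite gpr_out // linear0.
by case: eqP => // _; rewrite gpr_out // linear0.
Qed.

Lemma ghomP M N (f : 'Hom(M, N)) :
  rhom f -> (forall i x, f (gpr M i x) = gpr N i (f x)) -> ghom f.
Proof.
move=> hf fd; split=> // i x xi.
by rewrite -(gpr_id xi) fd gpr_in.
Qed.

Lemma ghom_comp M N P (f : 'Hom(N, P)) (g : 'Hom(M, N)) :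
  ghom f -> ghom g -> ghom (f \o g)%VF.
Proof.
move=> [hf df] [hg dg]; split=> [|i m mi]; first exact: rhom_comp.
by rewrite lfE; apply/df/dg.
Qed.

Lemma ghomD M N (f g : 'Hom(M, N)) : ghom f -> ghom g -> ghom (f + g).
Proof.
move=> [hf df] [hg dg]; split=> [|i m mi]; first exact: rhomD.
by rewrite lfE memvD ?df ?dg.
Qed.

Lemma ghomN M N (f : 'Hom(M, N)) : ghom f -> ghom (- f).
Proof.
move=> [hf df]; split=> [|i m mi]; first exact: rhomN.
by rewrite lfE memvN ?df.
Qed.

Lemma ghomB M N (f g : 'Hom(M, N)) : ghom f -> ghom g -> ghom (f - g).
Proof. by move=> hf hg; apply/ghomD/ghomN. Qed.

Lemma ghom0 M N : ghom (0 : 'Hom(M, N)).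
Proof. by split=> [|i m _]; [apply: rhom0 | rewrite lfE mem0v]. Qed.

Lemma ghom1 M : ghom (\1%VF : 'End(M)).
Proof. by split=> [|i m mi]; [apply: rhom1 | rewrite lfE]. Qed.

(** Maps of graded modules factor through monomorphisms and epimorphisms as soon
    as the underlying linear maps do; the inverse of a linear map supplies the
    factor, and being graded is tested after composing with the given map. *)
Lemma factor_inj M N P (i : 'Hom(N, P)) (f : 'Hom(M, P)) :
  ghom i -> injective i -> ghom f -> (forall x, exists y, f x = i y) ->
  exists h : 'Hom(M, N), ghom h /\ (i \o h)%VF = f.
Proof.
move=> gi ii gf fi; have E := inj_comp_inv fi.
exists (i^-1 \o f)%VF; split=> //; apply: ghomP.
  by apply: rhom_factor_inj (ghom_rhom _) _ (ghom_rhom _) _.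
have E' x : i ((i^-1 \o f)%VF x) = f x by rewrite -[i _]comp_lfunE E.
by move=> j x; apply: ii; rewrite (ghom_gpr _ _ gi) !E' ghom_gpr.
Qed.

Lemma factor_surj M N P (p : 'Hom(M, N)) (f : 'Hom(M, P)) :
  ghom p -> (forall y, exists x, p x = y) -> ghom f ->
  (forall x, p x = 0 -> f x = 0) ->
  exists h : 'Hom(N, P), ghom h /\ (h \o p)%VF = f.
Proof.
move=> gp sp gf pf; have E := surj_inv_comp pf.
exists (f \o p^-1)%VF; split=> //; apply: ghomP.
  by apply: rhom_factor_surj (ghom_rhom _) _ (ghom_rhom _) _.
have E' x : (f \o p^-1)%VF (p x) = f x by rewrite -[(_ \o _)%VF (p x)]comp_lfunE E.
move=> j y; have [x <-] := sp y.
by rewrite -(ghom_gpr _ _ gp) !E' ghom_gpr.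
Qed.

Lemma ghom_inv M N (f : 'Hom(M, N)) :
  ghom f -> injective f -> (forall y, exists x, f x = y) ->
  exists g : 'Hom(N, M), [/\ ghom g, (g \o f)%VF = \1%VF & (f \o g)%VF = \1%VF].
Proof.
move=> gf fi fs; have [x|g [gg E]] := factor_inj gf fi (ghom1 N).
  by rewrite lfE; have [y <-] := fs x; exists y.
exists g; split=> //; apply/lfunP => x; apply: fi.
by have /lfunP/(_ (f x)) := E; rewrite !lfE.
Qed.

(** The part of degree [k] of a linear map. Splitting a map into these parts
    passes between maps of modules and maps of graded modules: a module map
    is a finite sum of graded maps into shifts ([homog_part_sum]), and the part of
    degree [0] of an extension of a graded map still extends it
    ([homog_part0_comp_ghom], [homog_part0_id]). *)
Definition homog_part M N (f : 'Hom(M, N)) (k : int) : 'Hom(M, N) :=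
  (\sum_(i <- gm_supp M) (gpr N (i + k) \o f \o gpr M i)%VF).

Lemma homog_part_deg M N (f : 'Hom(M, N)) k i x : x \in gm_deg M i ->
  homog_part f k x = gpr N (i + k) (f x).
Proof.
move=> xi; rewrite /homog_part sum_lfunE.
have E j : (gpr N (j + k) \o f \o gpr M j)%VF x =
    if j == i then gpr N (i + k) (f x) else 0.
  rewrite !lfE (gpr_deg _ xi); case: eqP => [-> //|_].
  by rewrite !linear0.
rewrite (eq_bigr _ (fun k _ => E k)).
case: (boolP (i \in gm_supp M)) => iX.
  by rewrite (bigD1_seq i) ?gm_uniq //= eqxx big1 ?addr0 // => l /negPf->.
have -> : x = 0 by rewrite -(gpr_id xi) gpr_out.
by rewrite !linear0 big1 // => l; case: ifP.
Qed.

Lemma homog_part_ghom M N (f : 'Hom(M, N)) k : rhom f ->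
  rhom (homog_part f k) /\
  forall i m, m \in gm_deg M i -> homog_part f k m \in gm_deg N (i + k).
Proof.
move=> hf; split; last by move=> i m mi; rewrite (homog_part_deg _ _ mi) gpr_in.
move=> m b; elim/galg_ind: b => [|a b|j a aj].
- by rewrite !ract0r linear0.
- by rewrite !ractDr linearD /= => -> ->.
suff -> : homog_part f k (ract m a) = (homog_part f k \o ractr M a)%VF m.
  rewrite -[RHS]ractrE -comp_lfunE; congr (fun_of_lfun _ _).
  apply: eq_lfun_deg => i x xi; rewrite !lfE !ractrE.
  rewrite (homog_part_deg _ _ (gm_act xi aj)) (homog_part_deg _ _ xi) hf -(gpr_act _ _ aj).
  by congr (gpr _ _ _); lia.
by rewrite lfE ractrE.
Qed.

Lemma homog_part_gshift M N (f : 'Hom(M, N)) k : rhom f ->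
  @ghom K A M (gshift N k) (homog_part f k).
Proof. by move=> /homog_part_ghom-/(_ k)[h1 h2]; split. Qed.

Lemma homog_part0_ghom M N (f : 'Hom(M, N)) : rhom f -> ghom (homog_part f 0).
Proof.
by move=> /homog_part_ghom-/(_ 0)[h1 h2]; split=> // i m /h2; rewrite addr0.
Qed.

Lemma homog_part_sum M N (f : 'Hom(M, N)) :
  exists s : seq int, f = \sum_(k <- s) homog_part f k.
Proof.
exists (undup [seq j - i | i <- gm_supp M, j <- gm_supp N]).
apply: eq_lfun_deg => i x xi; rewrite sum_lfunE.
rewrite (eq_bigr (fun k => gpr N (i + k) (f x))) => [|k _]; last exact: homog_part_deg.
case: (boolP (i \in gm_supp M)) => iX; last first.
  have -> : x = 0 by rewrite -(gpr_id xi) gpr_out.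
  by rewrite linear0 big1 // => k _; rewrite linear0.
set s := undup _.
rewrite -[LHS](gpr_sum_sup (s := [seq i + k | k <- s])).
- by rewrite big_map.
- by rewrite map_inj_uniq ?undup_uniq //; apply: addrI.
move=> j jN; apply/mapP; exists (j - i); last by lia.
by rewrite mem_undup; apply/allpairsP; exists (i, j).
Qed.

Lemma homog_part0_comp_ghom M N P (f : 'Hom(N, P)) (g : 'Hom(M, N)) :
  ghom g -> (homog_part f 0 \o g)%VF = homog_part (f \o g)%VF 0.
Proof.
move=> [_ dg]; apply: eq_lfun_deg => i x xi.
by rewrite (homog_part_deg _ _ xi) !lfE (homog_part_deg _ _ (dg _ _ xi)).
Qed.

Lemma homog_part0_id M N (f : 'Hom(M, N)) : ghom f -> homog_part f 0 = f.
Proof.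
move=> [_ df]; apply: eq_lfun_deg => i x xi.
by rewrite (homog_part_deg _ _ xi) addr0 gpr_id ?df.
Qed.

End Components.

(** * Kernels, cokernels and sums of graded modules *)

(** A grading given by its component projections. Subquotients, duals and
    modules placed in one degree come with such projections, and the axioms
    are identities between linear maps in this form. *)
Section BuildGraded.
Variables (K : fieldType) (A : graded_alg K) (X : rmod A).
Variables (pr : int -> 'End(X)) (s : seq int).
Hypothesis us : uniq s.
Hypothesis pr_out : forall i x, i \notin s -> pr i x = 0.
Hypothesis pr_sum : forall x, \sum_(i <- s) pr i x = x.
Hypothesis prK : forall i j x, pr i (pr j x) = if i == j then pr j x else 0.
Hypothesis pr_act : forall i j x a,
  a \in galg_deg A j -> pr (i + j%:Z) (ract x a) = ract (pr i x) a.

Let deg i : {vspace X} := limg (pr i).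

Let mem_deg i x : (x \in deg i) = (pr i x == x).
Proof.
apply/idP/eqP => [/mem_limgP[y ->]|<-]; last by apply/mem_limgP; exists x.
by rewrite prK eqxx.
Qed.

Let deg_out i : i \notin s -> deg i = 0%VS.
Proof.
by move=> iS; apply/vspaceP => x; rewrite mem_deg memv0 pr_out.
Qed.

Let deg_sum : (\sum_(i <- s) deg i)%VS = fullv.
Proof.
apply/vspaceP => x; rewrite memvf -[x]pr_sum big_seq; apply: memv_suml => i iS.
apply: (subvP (subv_sup_seq (P := predT) deg iS isT)).
by rewrite mem_deg prK eqxx.
Qed.

Let deg_direct (x : int -> X) : (forall i, x i \in deg i) ->
  \sum_(i <- s) x i = 0 -> forall i, x i = 0.
Proof.
move=> xin x0 i; have E j : pr j (x j) = x j by apply/eqP; rewrite -mem_deg.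
case: (boolP (i \in s)) => iS; last by rewrite -E pr_out.
have /(congr1 (pr i)) := x0; rewrite linear_sum linear0 /= (bigD1_seq i) //= E.
rewrite big1 ?addr0 // => j ji.
by rewrite -[x j]E prK eq_sym (negPf ji).
Qed.

Let deg_act i j m a :
  m \in deg i -> a \in galg_deg A j -> ract m a \in deg (i + j%:Z).
Proof. by rewrite !mem_deg => /eqP mi aj; rewrite pr_act // mi. Qed.

Definition gmod_of_pr : gmod A :=
  @GMod K A X deg s us deg_out deg_sum deg_direct deg_act.

Lemma gmod_of_prE i (x : X) : gpr gmod_of_pr i x = pr i x.
Proof.
rewrite -{1}[x]pr_sum linear_sum /=.
have E j : gpr gmod_of_pr i (pr j x) = if i == j then pr j x else 0.
  by apply: gpr_deg; rewrite /= mem_deg prK eqxx.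
rewrite (eq_bigr _ (fun j _ => E j)); case: (boolP (i \in s)) => iS.
  by rewrite (bigD1_seq i) //= eqxx big1 ?addr0 // => j; rewrite eq_sym => /negPf->.
rewrite pr_out // big1 // => j _; case: eqP => // <-; exact: pr_out.
Qed.

End BuildGraded.

Section SubQuotient.
Variables (K : fieldType) (A : graded_alg K) (X : gmod A) (W : {vspace X}).
Hypothesis W_act : forall w a, w \in W -> ract w a \in W.
Hypothesis W_gpr : forall w i, w \in W -> gpr X i w \in W.

Let T := subvs_of W.
Let S_ract (w : T) (a : A) : T := vsproj W (ract (vsval w) a).
Let S_ractE w a : vsval (S_ract w a) = ract (vsval w) a.
Proof. by rewrite vsprojK // W_act // subvsP. Qed.

Let S_linearl a : linear (S_ract^~ a).
Proof. by move=> k x y; rewrite /S_ract linearP /= ract_linearl linearP. Qed.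
Let S_linearr w : linear (S_ract w).
Proof. by move=> k x y; rewrite /S_ract ract_linearr linearP. Qed.
Let S_ractM w a b : S_ract w (a * b) = S_ract (S_ract w a) b.
Proof. by apply: val_inj; rewrite /= !S_ractE ractM. Qed.
Let S_ract1 w : S_ract w 1 = w.
Proof. by apply: val_inj; rewrite /= !S_ractE ract1. Qed.

Let S_rmod : rmod A := @RMod K A T S_ract S_linearl S_linearr S_ractM S_ract1.

Let S_pr i : 'End(S_rmod) :=
  (linfun (vsproj W : X -> S_rmod) \o gpr X i \o linfun (vsval : S_rmod -> X))%VF.

Let S_prE i (w : S_rmod) : vsval (S_pr i w : T) = gpr X i (vsval w).
Proof. by rewrite !lfE !lfunE vsprojK // W_gpr // subvsP. Qed.

Let S_pr_out i x : i \notin gm_supp X -> S_pr i x = 0.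
Proof. by move=> iX; apply: (@subvs_inj _ _ W); rewrite S_prE gpr_out. Qed.

Let S_pr_sum x : \sum_(i <- gm_supp X) S_pr i x = x.
Proof.
apply: (@subvs_inj _ _ W); rewrite -[RHS](gpr_sum (vsval (x : T))).
rewrite -[LHS](lfunE (vsval : S_rmod -> X)) linear_sum; apply: eq_bigr => i _.
by rewrite -[RHS]S_prE; apply: lfunE.
Qed.

Let S_prK i j x : S_pr i (S_pr j x) = if i == j then S_pr j x else 0.
Proof.
by apply: (@subvs_inj _ _ W); rewrite !S_prE gprK; case: eqP => // _; rewrite S_prE.
Qed.

Let S_pr_act i j (x : S_rmod) a : a \in galg_deg A j ->
  S_pr (i + j%:Z) (ract x a) = ract (S_pr i x) a.
Proof.
by move=> aj; apply: (@subvs_inj _ _ W); rewrite !S_prE S_ractE gpr_act // S_ractE S_prE.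
Qed.

Definition gsub : gmod A :=
  gmod_of_pr (gm_uniq X) S_pr_out S_pr_sum S_prK S_pr_act.

Definition gsub_in : 'Hom(gsub, X) := linfun (vsval : subvs_of W -> X).

Lemma gsub_in_ghom : ghom gsub_in.
Proof.
apply: ghomP => [w a|i w]; first by rewrite !lfunE; apply: S_ractE.
by rewrite [gpr gsub i w]gmod_of_prE lfunE [in RHS]lfunE; apply: S_prE.
Qed.

Lemma gsub_in_inj : injective gsub_in.
Proof. by move=> x y; rewrite !lfunE => /val_inj. Qed.

Lemma gsub_in_img x : x \in W <-> exists y, x = gsub_in y.
Proof.
split=> [xW|[y ->]]; last by rewrite lfunE; apply: subvsP.
by exists (Subvs xW); rewrite lfunE.
Qed.

(* The quotient by W lives on a complement C of W. *)
Let C := (W^C)%VS.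
Let Q := subvs_of C.
Let pi : 'Hom(X, Q) := (linfun (vsproj C) \o daddv_pi C W)%VF.

Let CW : (C :&: W = 0)%VS. Proof. by rewrite capvC capv_compl. Qed.

Let pi_val x : x - vsval (pi x) \in W.
Proof.
have xCW : x \in (C + W)%VS by rewrite addvC addv_complf memvf.
rewrite -{1}(daddv_pi_add CW xCW) lfE lfunE vsprojK ?memv_pi //.
by rewrite addrAC subrr add0r memv_pi.
Qed.

Let pi_ker x : (pi x == 0) = (x \in W).
Proof.
apply/eqP/idP => [px|xW]; first by have := pi_val x; rewrite px subr0.
apply: val_inj => /=.
apply/eqP; rewrite -memv0 -CW memv_cap subvsP /=.
by have := memvB xW (pi_val x); rewrite subKr.
Qed.

Let pi_eq x y : x - y \in W -> pi x = pi y.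
Proof. by rewrite -pi_ker linearB subr_eq0 => /eqP. Qed.

Let valK w : pi (vsval w) = w.
Proof.
apply/val_inj; rewrite lfE lfunE /= vsprojK ?memv_pi //.
by rewrite daddv_pi_id ?subvsP.
Qed.

Let pi_valact x a : pi (ract (vsval (pi x)) a) = pi (ract x a).
Proof. by apply: pi_eq; rewrite -ractBl W_act // -memvN opprB. Qed.

Let pi_valgpr x i : pi (gpr X i (vsval (pi x))) = pi (gpr X i x).
Proof. by apply: pi_eq; rewrite -linearB W_gpr // -memvN opprB. Qed.

Let Q_ract (w : Q) (a : A) : Q := pi (ract (vsval w) a).
Let Q_linearl a : linear (Q_ract^~ a).
Proof. by move=> k x y; rewrite /Q_ract linearP /= ract_linearl linearP. Qed.
Let Q_linearr w : linear (Q_ract w).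
Proof. by move=> k x y; rewrite /Q_ract ract_linearr linearP. Qed.
Let Q_ractM w a b : Q_ract w (a * b) = Q_ract (Q_ract w a) b.
Proof. by rewrite /Q_ract pi_valact ractM. Qed.
Let Q_ract1 w : Q_ract w 1 = w.
Proof. by rewrite /Q_ract ract1 valK. Qed.

Let Q_rmod : rmod A := @RMod K A Q Q_ract Q_linearl Q_linearr Q_ractM Q_ract1.

Let Q_pr i : 'End(Q_rmod) :=
  (pi \o gpr X i \o linfun (vsval : Q_rmod -> X))%VF.

Let Q_prE i (w : Q_rmod) : Q_pr i w = pi (gpr X i (vsval w)).
Proof. by rewrite comp_lfunE comp_lfunE; congr (pi (gpr X i _)); apply: lfunE. Qed.

Let Q_pr_out i x : i \notin gm_supp X -> Q_pr i x = 0.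
Proof. by move=> iX; rewrite Q_prE gpr_out // linear0. Qed.

Let Q_pr_sum x : \sum_(i <- gm_supp X) Q_pr i x = x.
Proof.
rewrite -[RHS]valK -[X in pi X]gpr_sum linear_sum.
by apply: eq_bigr => i _; rewrite Q_prE.
Qed.

Let Q_prK i j x : Q_pr i (Q_pr j x) = if i == j then Q_pr j x else 0.
Proof. by rewrite !Q_prE pi_valgpr gprK; case: eqP => // _; rewrite linear0. Qed.

Let Q_pr_act i j (x : Q_rmod) a : a \in galg_deg A j ->
  Q_pr (i + j%:Z) (ract x a) = ract (Q_pr i x) a.
Proof.
move=> aj; rewrite !Q_prE; rewrite [ract x a]/(Q_ract x a) pi_valgpr.
by rewrite gpr_act // -[RHS]/(Q_ract _ a) /Q_ract pi_valact.
Qed.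

Definition gquo : gmod A :=
  gmod_of_pr (gm_uniq X) Q_pr_out Q_pr_sum Q_prK Q_pr_act.

Definition gquo_pi : 'Hom(X, gquo) := pi.

Lemma gquo_pi_ghom : ghom gquo_pi.
Proof.
apply: ghomP => [w a|i w]; first by rewrite -[LHS]pi_valact.
by rewrite [RHS]gmod_of_prE [RHS]Q_prE [RHS]pi_valgpr.
Qed.

Lemma gquo_pi_surj y : exists x, gquo_pi x = y.
Proof. by exists (vsval (y : Q)); apply: valK. Qed.

Lemma gquo_pi_ker x : gquo_pi x = 0 <-> x \in W.
Proof. by rewrite -pi_ker; split=> /eqP. Qed.

End SubQuotient.

Section Exactness.
Variables (K : fieldType) (A : graded_alg K).
Implicit Types M N P Q X Y Z : gmod A.

Record ses X Y Z (f : 'Hom(X, Y)) (g : 'Hom(Y, Z)) : Prop := Ses {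
  ses_in : ghom f;
  ses_out : ghom g;
  ses_inj : injective f;
  ses_ex : forall y, g y = 0 <-> exists x, y = f x;
  ses_surj : forall z, exists y, g y = z }.

Lemma sesP X Y Z (f : 'Hom(X, Y)) (g : 'Hom(Y, Z)) :
  short_exact f g <-> ses f g.
Proof.
split=> [[gf gg /lker0_injP fi /limg_lkerP fg /limg_surjP gs]|]; first by split.
by case=> gf gg fi fg gs; split=> //; [apply/lker0_injP|apply/limg_lkerP|apply/limg_surjP].
Qed.

Lemma ses_comp0 X Y Z (f : 'Hom(X, Y)) (g : 'Hom(Y, Z)) x :
  ses f g -> g (f x) = 0.
Proof. by move=> s; apply/(ses_ex s); exists x. Qed.

Lemma gkernel M N (f : 'Hom(M, N)) : ghom f ->
  {X : gmod A & {k : 'Hom(X, M) |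
     [/\ ghom k, injective k & forall y, f y = 0 <-> exists x, y = k x]}}.
Proof.
move=> gf.
have Wa w a : w \in lker f -> ract w a \in lker f.
  by rewrite !memv_ker (ghom_rhom gf) => /eqP->; rewrite ract0l.
have Wg w i : w \in lker f -> gpr M i w \in lker f.
  by rewrite !memv_ker (ghom_gpr _ _ gf) => /eqP->; rewrite linear0.
exists (gsub Wa Wg); exists (gsub_in Wa Wg); split.
- exact: gsub_in_ghom.
- exact: gsub_in_inj.
by move=> y; rewrite -gsub_in_img memv_ker; split=> /eqP.
Qed.

Lemma gcokernel M N (f : 'Hom(M, N)) : ghom f ->
  {C : gmod A & {c : 'Hom(N, C) |
     [/\ ghom c, (forall z, exists y, c y = z)
       & forall y, c y = 0 <-> exists x, y = f x]}}.
Proof.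
move=> gf.
have Wa w a : w \in limg f -> ract w a \in limg f.
  by move=> /mem_limgP[x ->]; apply/mem_limgP; exists (ract x a); rewrite (ghom_rhom gf).
have Wg w i : w \in limg f -> gpr N i w \in limg f.
  by move=> /mem_limgP[x ->]; apply/mem_limgP; exists (gpr M i x); rewrite (ghom_gpr _ _ gf).
exists (gquo Wa Wg); exists (gquo_pi Wa Wg); split.
- exact: gquo_pi_ghom.
- exact: gquo_pi_surj.
by move=> y; rewrite gquo_pi_ker mem_limgP.
Qed.

Lemma ses_of_inj X Y (f : 'Hom(X, Y)) : ghom f -> injective f ->
  exists Z (g : 'Hom(Y, Z)), ses f g.
Proof.
by move=> gf fi; have [Z [g [gg gs gk]]] := gcokernel gf; exists Z, g; split.
Qed.

Lemma ses_of_surj Y Z (g : 'Hom(Y, Z)) : ghom g -> (forall z, exists y, g y = z) ->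
  exists X (f : 'Hom(X, Y)), ses f g.
Proof.
by move=> gg gs; have [X [f [gf fi fk]]] := gkernel gg; exists X, f; split.
Qed.

Section SumMaps.
Variables X Y : gmod A.

Fact din1_linear : linear (fun x : X => (x, 0) : gdsum X Y).
Proof. by move=> k x y; congr (_, _); rewrite /= scaler0 addr0. Qed.
Fact din2_linear : linear (fun y : Y => (0, y) : gdsum X Y).
Proof. by move=> k x y; congr (_, _); rewrite /= scaler0 addr0. Qed.
Fact dpr1_linear : linear (fun z : gdsum X Y => z.1). Proof. by []. Qed.
Fact dpr2_linear : linear (fun z : gdsum X Y => z.2). Proof. by []. Qed.

Definition din1 : 'Hom(X, gdsum X Y) := lmap din1_linear.
Definition din2 : 'Hom(Y, gdsum X Y) := lmap din2_linear.
Definition dpr1 : 'Hom(gdsum X Y, X) := lmap dpr1_linear.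
Definition dpr2 : 'Hom(gdsum X Y, Y) := lmap dpr2_linear.

Lemma din1E x : din1 x = (x, 0). Proof. exact: lmapE. Qed.
Lemma din2E y : din2 y = (0, y). Proof. exact: lmapE. Qed.
Lemma dpr1E z : dpr1 z = z.1. Proof. exact: lmapE. Qed.
Lemma dpr2E z : dpr2 z = z.2. Proof. exact: lmapE. Qed.

Lemma din1_ghom : ghom din1.
Proof.
split=> [m a|i m mi]; rewrite !din1E; first by congr (_, _); rewrite ract0l.
by rewrite mem_dsum_deg mi mem0v.
Qed.

Lemma din2_ghom : ghom din2.
Proof.
split=> [m a|i m mi]; rewrite !din2E; first by congr (_, _); rewrite ract0l.
by rewrite mem_dsum_deg mi mem0v.
Qed.

Lemma dpr1_ghom : ghom dpr1.
Proof.
split=> [m a|i m]; first by rewrite !dpr1E.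
by rewrite mem_dsum_deg dpr1E => /andP[].
Qed.

Lemma dpr2_ghom : ghom dpr2.
Proof.
split=> [m a|i m]; first by rewrite !dpr2E.
by rewrite mem_dsum_deg dpr2E => /andP[].
Qed.

Lemma dsumE (z : gdsum X Y) : z = din1 z.1 + din2 z.2.
Proof. by rewrite din1E din2E; case: z => x y; congr (_, _); rewrite /= ?addr0 ?add0r. Qed.

End SumMaps.

Fact dcopair_linear X Y (Z : vectType K) (f : 'Hom(X, Z)) (g : 'Hom(Y, Z)) :
  linear (fun z : gdsum X Y => f z.1 + g z.2).
Proof. by move=> k x y; rewrite /= !linearP scalerDr addrACA. Qed.

Definition dcopair X Y (Z : vectType K) (f : 'Hom(X, Z)) (g : 'Hom(Y, Z)) :
  'Hom(gdsum X Y, Z) := lmap (dcopair_linear f g).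

Fact dpair_linear X Y (Z : vectType K) (f : 'Hom(Z, X)) (g : 'Hom(Z, Y)) :
  linear (fun z => (f z, g z) : gdsum X Y).
Proof. by move=> k x y; rewrite !linearP. Qed.

Definition dpair X Y (Z : vectType K) (f : 'Hom(Z, X)) (g : 'Hom(Z, Y)) :
  'Hom(Z, gdsum X Y) := lmap (dpair_linear f g).

Lemma dcopairE X Y (Z : vectType K) (f : 'Hom(X, Z)) (g : 'Hom(Y, Z)) z :
  dcopair f g z = f z.1 + g z.2.
Proof. exact: lmapE. Qed.

Lemma dpairE X Y (Z : vectType K) (f : 'Hom(Z, X)) (g : 'Hom(Z, Y)) z :
  dpair f g z = (f z, g z).
Proof. exact: lmapE. Qed.

Lemma dcopair_rhom X Y (Z : rmod A) (f : 'Hom(X, Z)) (g : 'Hom(Y, Z)) :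
  rhom f -> rhom g -> rhom (dcopair f g).
Proof. by move=> hf hg z a; rewrite !dcopairE /= hf hg ractDl. Qed.

Lemma dpair_rhom X Y (Z : rmod A) (f : 'Hom(Z, X)) (g : 'Hom(Z, Y)) :
  rhom f -> rhom g -> rhom (dpair f g).
Proof. by move=> hf hg z a; rewrite !dpairE /= hf hg. Qed.

Lemma dcopair_ghom X Y Z (f : 'Hom(X, Z)) (g : 'Hom(Y, Z)) :
  ghom f -> ghom g -> ghom (dcopair f g).
Proof.
move=> [hf df] [hg dg]; split=> [|i z]; first exact: dcopair_rhom.
by rewrite mem_dsum_deg dcopairE => /andP[z1 z2]; rewrite memvD ?df ?dg.
Qed.

Lemma dpair_ghom X Y Z (f : 'Hom(Z, X)) (g : 'Hom(Z, Y)) :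
  ghom f -> ghom g -> ghom (dpair f g).
Proof.
move=> [hf df] [hg dg]; split=> [|i z zi]; first exact: dpair_rhom.
by rewrite dpairE mem_dsum_deg df ?dg.
Qed.

Definition dmap X Y X' Y' (f : 'Hom(X, Y)) (f' : 'Hom(X', Y')) :
    'Hom(gdsum X X', gdsum Y Y') :=
  dpair (f \o dpr1 X X')%VF (f' \o dpr2 X X')%VF.

Lemma dmapE X Y X' Y' (f : 'Hom(X, Y)) (f' : 'Hom(X', Y')) (z : gdsum X X') :
  dmap f f' z = (f z.1, f' z.2).
Proof. by rewrite /dmap dpairE !lfE dpr1E dpr2E. Qed.

Lemma dmap_ghom X Y X' Y' (f : 'Hom(X, Y)) (f' : 'Hom(X', Y')) :
  ghom f -> ghom f' -> ghom (dmap f f').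
Proof.
move=> gf gf'; apply: dpair_ghom; apply: ghom_comp => //.
  exact: dpr1_ghom.
exact: dpr2_ghom.
Qed.

Lemma ses_dsum X Y Z X' Y' Z' (f : 'Hom(X, Y)) (g : 'Hom(Y, Z))
    (f' : 'Hom(X', Y')) (g' : 'Hom(Y', Z')) :
  ses f g -> ses f' g' -> ses (dmap f f') (dmap g g').
Proof.
move=> [f1 g1 i1 e1 s1] [f2 g2 i2 e2 s2].
split; first exact: dmap_ghom; first exact: dmap_ghom.
- by move=> [x x'] [y y']; rewrite !dmapE => -[/i1-> /i2->].
- move=> [y y']; rewrite dmapE; split.
    by move=> [/e1[x ->] /e2[x' ->]]; exists (x, x'); rewrite dmapE.
  case=> -[x x']; rewrite dmapE => -[-> ->].
  by congr (_, _); [apply/e1; exists x | apply/e2; exists x'].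
move=> [z z']; have [y <-] := s1 z; have [y' <-] := s2 z'.
by exists (y, y'); rewrite dmapE.
Qed.

Lemma gzero_eq0 (x : gzero A) : x = 0.
Proof. exact: thinmx0. Qed.

End Exactness.

(** * Free and projective graded modules *)

Section Free.
Variables (K : fieldType) (A : graded_alg K).
Implicit Types M N P Q X Y Z : gmod A.

(** The shifted regular module A(n), generated by the unit in degree [- n]. *)
Definition Ash (n : int) : gmod A := gshift (regular_gmod A) n.

Lemma gshift_ghom M N n (f : 'Hom(M, N)) :
  ghom f -> @ghom K A (gshift M n) (gshift N n) f.
Proof. by move=> [hf df]; split=> // i m; apply: df. Qed.

Lemma gshift_ghom_to M N n (f : 'Hom(M, N)) :
  @ghom K A M (gshift N n) f -> @ghom K A (gshift M (- n)) N f.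
Proof.
move=> [hf df]; split=> // i m mi.
by have := df _ _ mi; rewrite /= /gshift_deg subrK.
Qed.

Lemma gshift_ghom_from M N n (f : 'Hom(M, N)) :
  @ghom K A (gshift M n) N f -> @ghom K A M (gshift N (- n)) f.
Proof.
move=> [hf df]; split=> // i m mi; apply: df.
by rewrite /= /gshift_deg subrK.
Qed.

Lemma ractl_rhom (M : rmod A) (x : M) : rhom (ractl x).
Proof. by move=> a b; rewrite !ractlE ractM. Qed.

Lemma ractl_ghom M i (x : M) :
  x \in gm_deg M i -> @ghom K A (Ash (- i)) M (ractl x).
Proof.
move=> xi; split=> [|j]; first exact: ractl_rhom.
move=> m; rewrite /= /gshift_deg /regular_deg.
case E: (j - i) => [n|n] mn.
  have -> : j = i + n%:Z by rewrite -E; lia.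
  by rewrite ractlE; apply: gm_act.
by move: mn; rewrite memv0 => /eqP->; rewrite linear0 mem0v.
Qed.

Lemma rhom_regular (M : rmod A) (f : 'Hom(regular_rmod A, M)) :
  rhom f -> f = ractl (f (1 : A)).
Proof.
move=> hf; apply/lfunP => a; rewrite ractlE -hf.
by congr (f _); rewrite /= mul1r.
Qed.

Lemma one_deg n : (1 : A) \in gm_deg (Ash n) (- n).
Proof. by rewrite /= /gshift_deg addNr; apply: galg_1. Qed.

Lemma surj_homog M N (g : 'Hom(M, N)) i y : ghom g ->
  (forall y, exists x, g x = y) -> y \in gm_deg N i ->
  exists2 x, x \in gm_deg M i & g x = y.
Proof.
move=> gg sg yi; have [x gx] := sg y.
by exists (gpr M i x); [apply: gpr_in | rewrite (ghom_gpr _ _ gg) gx gpr_id].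
Qed.

Lemma Ash_gproj n : gprojective (Ash n).
Proof.
move=> M N g f gg /limg_surjP sg gf.
have [x xi gx] := surj_homog gg sg (proj2 gf _ _ (one_deg n)).
exists (ractl x); split; first by have := ractl_ghom xi; rewrite opprK.
have hf : rhom (f : 'Hom(regular_rmod A, N)) := ghom_rhom gf.
rewrite [RHS](rhom_regular hf); apply/lfunP => a.
rewrite lfE !ractlE (ghom_rhom gg) gx //.
Qed.

Lemma Ash_rproj n : rprojective (Ash n).
Proof.
move=> M N g f hg /limg_surjP sg hf.
have [x gx] := sg (f (1 : A)).
exists (ractl x); split; first exact: ractl_rhom.
rewrite [RHS](rhom_regular hf); apply/lfunP => a.
by rewrite lfE !ractlE hg gx.
Qed.

Lemma gzero_gproj : gprojective (gzero A).
Proof.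
move=> M N g f gg sg gf; exists 0; split; first exact: ghom0.
by apply/lfunP => x; rewrite [x]gzero_eq0 !linear0.
Qed.

Lemma gzero_rproj : rprojective (gzero A).
Proof.
move=> M N g f gg sg gf; exists 0; split; first exact: rhom0.
by apply/lfunP => x; rewrite [x]gzero_eq0 !linear0.
Qed.

Lemma gdsum_gproj X Y : gprojective X -> gprojective Y -> gprojective (gdsum X Y).
Proof.
move=> pX pY M N g f gg sg gf.
have [h1 [gh1 e1]] := pX _ _ _ _ gg sg (ghom_comp gf (din1_ghom X Y)).
have [h2 [gh2 e2]] := pY _ _ _ _ gg sg (ghom_comp gf (din2_ghom X Y)).
exists (dcopair h1 h2); split; first exact: dcopair_ghom.
apply/lfunP => z; rewrite lfE dcopairE linearD /= [in RHS](dsumE z) linearD /=.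
by rewrite -!comp_lfunE e1 e2.
Qed.

Lemma gdsum_rproj X Y : rprojective X -> rprojective Y -> rprojective (gdsum X Y).
Proof.
move=> pX pY M N g f gg sg gf.
have [h1 [gh1 e1]] := pX _ _ _ _ gg sg (rhom_comp gf (ghom_rhom (din1_ghom X Y))).
have [h2 [gh2 e2]] := pY _ _ _ _ gg sg (rhom_comp gf (ghom_rhom (din2_ghom X Y))).
exists (dcopair h1 h2); split; first exact: dcopair_rhom.
apply/lfunP => z; rewrite lfE dcopairE linearD /= [in RHS](dsumE z) linearD /=.
by rewrite -!comp_lfunE e1 e2.
Qed.

Definition retract X Y : Prop :=
  exists (i : 'Hom(X, Y)) (r : 'Hom(Y, X)),
    [/\ ghom i, ghom r & forall x, r (i x) = x].

Lemma retract_rproj P Q : retract P Q -> rprojective Q -> rprojective P.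
Proof.
move=> [i [r [/ghom_rhom gi /ghom_rhom gr ri]]] pQ M N g f gg sg gf.
have [h [gh e]] := pQ _ _ _ _ gg sg (rhom_comp gf gr).
exists (h \o i)%VF; split; first exact: rhom_comp.
by apply/lfunP => x; rewrite lfE lfE -comp_lfunE e lfE ri.
Qed.

(** Free graded modules; the generator of [Ash (- i)] has degree [i], so [D]
    is where the degrees of the generators lie. *)
Inductive gfree (D : pred int) : gmod A -> Prop :=
  | gfree0 : gfree D (gzero A)
  | gfreeA i : D i -> gfree D (Ash (- i))
  | gfreeD X Y : gfree D X -> gfree D Y -> gfree D (gdsum X Y).

Lemma gfree_gproj D F : gfree D F -> gprojective F.
Proof.
elim=> [|i _|X Y _ pX _ pY]; [exact: gzero_gproj|exact: Ash_gproj|exact: gdsum_gproj].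
Qed.

Lemma gfree_rproj D F : gfree D F -> rprojective F.
Proof.
elim=> [|i _|X Y _ pX _ pY]; [exact: gzero_rproj|exact: Ash_rproj|exact: gdsum_rproj].
Qed.

Lemma gdsum_deg0 X Y i : gm_deg X i = 0%VS -> gm_deg Y i = 0%VS ->
  gm_deg (gdsum X Y) i = 0%VS.
Proof.
move=> X0 Y0; apply/vspaceP => -[x y].
by rewrite mem_dsum_deg X0 Y0 !memv0.
Qed.

Lemma gfree_deg D F (a i : int) : gfree D F -> (forall j, D j -> a <= j) ->
  i < a -> gm_deg F i = 0%VS.
Proof.
move=> fF Da ia; elim: fF => [//|j Dj|X Y _ X0 _ Y0]; last exact: gdsum_deg0.
rewrite /= /gshift_deg; have := Da _ Dj.
by case E: (i - j) => [n|n] //; lia.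
Qed.

(** Homogeneous elements can be hit one at a time, and finitely many of them
    span. The class [Q] records what is to be kept about the covering module:
    it will be free with controlled degrees, or generated by V. *)
Lemma cover_by (Q : gmod A -> Prop) M :
  Q (gzero A) -> (forall X Y, Q X -> Q Y -> Q (gdsum X Y)) ->
  (forall i x, x \in gm_deg M i ->
     {P : gmod A & {f : 'Hom(P, M) | [/\ Q P, ghom f & exists y, f y = x]}}) ->
  {P : gmod A & {f : 'Hom(P, M) |
     [/\ Q P, ghom f & forall x, exists y, f y = x]}}.
Proof.
move=> Q0 QD Qx.
have hit_seq i (t : seq M) : {subset t <= gm_deg M i} ->
    {P : gmod A & {f : 'Hom(P, M) |
       [/\ Q P, ghom f & forall x, x \in t -> exists y, f y = x]}}.
  elim: t => [_|x t IH sub]; first by exists (gzero A), 0; split=> //; apply: ghom0.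
  have [|P [f [QP gf ft]]] := IH; first by move=> y yt; apply: sub; rewrite inE yt orbT.
  have [|P' [f' [QP' gf' hx]]] := Qx i x; first by apply: sub; rewrite inE eqxx.
  exists (gdsum P P'), (dcopair f f'); split; [exact: QD|exact: dcopair_ghom|].
  case: hx => y fy z; rewrite inE => /orP[/eqP->|/ft[w fw]].
    by exists (0, y); rewrite dcopairE linear0 add0r.
  by exists (w, 0); rewrite dcopairE linear0 addr0.
have hit_deg (s : seq int) : {P : gmod A & {f : 'Hom(P, M) | [/\ Q P, ghom f &
       forall i, i \in s -> forall x, x \in gm_deg M i -> exists y, f y = x]}}.
  elim: s => [|i s [P [f [QP gf fs]]]].
    by exists (gzero A), 0; split=> //; apply: ghom0.
  have [x xb|P' [f' [QP' gf' ft]]] := hit_seq i (vbasis (gm_deg M i)).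
    exact: vbasis_mem.
  exists (gdsum P P'), (dcopair f f'); split; [exact: QD|exact: dcopair_ghom|].
  move=> j; rewrite inE => /orP[/eqP-> x xi|js x xj]; last first.
    by have [y <-] := fs _ js _ xj; exists (y, 0); rewrite dcopairE linear0 addr0.
  suff /mem_limgP[y ->] : x \in limg f'.
    by exists (0, y); rewrite dcopairE linear0 add0r.
  move: x xi; apply/subvP; rewrite -[gm_deg M i](span_basis (vbasisP _)).
  apply/span_subvP => x xb.
  by have [y <-] := ft _ xb; apply/mem_limgP; exists y.
have [P [f [QP gf fs]]] := hit_deg (gm_supp M).
exists P, f; split=> // x; suff /mem_limgP[y ->] : x \in limg f by exists y.
rewrite -[x]gpr_sum big_seq; apply: memv_suml => i iM.
by have [y <-] := fs i iM _ (gpr_in i x); apply/mem_limgP; exists y.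
Qed.

Lemma free_cover (D : pred int) M : (forall i, ~~ D i -> gm_deg M i = 0%VS) ->
  {P : gmod A & {f : 'Hom(P, M) |
     [/\ gfree D P, ghom f & forall x, exists y, f y = x]}}.
Proof.
move=> MD; apply: cover_by => [|X Y|i x xi]; [exact: gfree0|exact: gfreeD|].
case: (boolP (D i)) => Di.
  exists (Ash (- i)), (ractl x); split; [exact: gfreeA|exact: ractl_ghom|].
  by exists (1 : A); rewrite ractlE ract1.
exists (gzero A), 0; split; [exact: gfree0|exact: ghom0|].
by exists 0; rewrite linear0; apply/esym/eqP; rewrite -memv0 -(MD _ Di).
Qed.

Lemma proj_split M P (f : 'Hom(M, P)) : gprojective P -> ghom f ->
  (forall x, exists y, f y = x) -> exists h : 'Hom(P, M), ghom h /\ forall x, f (h x) = x.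
Proof.
move=> pP gf /limg_surjP sf; have [h [gh e]] := pP _ _ _ _ gf sf (ghom1 P).
by exists h; split=> // x; rewrite -comp_lfunE e lfE.
Qed.

Lemma gproj_retract_free P : gprojective P -> exists2 F, gfree predT F & retract P F.
Proof.
move=> pP; have [i //|F [f [fF gf sf]]] := @free_cover predT P.
have [h [gh fh]] := proj_split pP gf sf.
by exists F => //; exists h, f.
Qed.

(** Both notions of projectivity mean being a summand of a free module, graded
    projectives being covered by graded free modules. *)
Lemma gproj_rproj P : gprojective P -> rprojective P.
Proof.
by move=> /gproj_retract_free[F fF PF]; apply: retract_rproj PF (gfree_rproj fF).
Qed.

End Free.

(** * First extension groups and Cohen-Macaulay modules *)

Section CohenMacaulay.
Variables (K : fieldType) (A : graded_alg K).
Implicit Types M N P Q X Y Z I J L : gmod A.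

Definition extends_regular X Y (j : 'Hom(X, Y)) : Prop :=
  forall f : 'Hom(X, regular_gmod A), rhom f ->
    exists g : 'Hom(Y, regular_gmod A), rhom g /\ (g \o j)%VF = f.

(** The condition Ext^1(M, A) = 0 in Yoneda form: pushing out along a map into
    [A] splits. The sequences are graded while the maps into [A] need not be,
    which is how Cohen-Macaulay modules are defined here. Working with this form
    avoids comparing projective resolutions. *)
Definition ext1_zero M : Prop :=
  forall X Y (j : 'Hom(X, Y)) (p : 'Hom(Y, M)), ses j p -> extends_regular j.

(** Over a 1-Iwanaga-Gorenstein algebra these are the Cohen-Macaulay modules;
    this description makes closure under submodules and sums evident. *)
Definition torsionless M : Prop :=
  exists P (f : 'Hom(M, P)), [/\ gprojective P, ghom f & injective f].

(** Extending maps into [A] suffices for extending graded maps into any graded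
    projective: it is a summand of a sum of shifts of [A], and the extension can
    be replaced with its part of degree [0]. *)
Lemma extends_gproj X Y (j : 'Hom(X, Y)) Q (f : 'Hom(X, Q)) :
  ghom j -> extends_regular j -> gprojective Q -> ghom f ->
  exists g : 'Hom(Y, Q), ghom g /\ (g \o j)%VF = f.
Proof.
move=> gj ej /gproj_retract_free[F fF [i [r [gi gr ri]]]] gf.
suff [g [gg e]] : exists g : 'Hom(Y, F), ghom g /\ (g \o j)%VF = (i \o f)%VF.
  exists (r \o g)%VF; split; first exact: ghom_comp.
  by rewrite -comp_lfunA e; apply/lfunP => x; rewrite !lfE ri.
have : ghom (i \o f)%VF by apply: ghom_comp.
move: (i \o f)%VF => {}f {}gf; elim: fF f gf {i r gi gr ri} => [|i _|F1 F2 _ h1 _ h2] f gf.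
- exists 0; split; first exact: ghom0.
  by apply/lfunP => x; rewrite !lfE [RHS]gzero_eq0.
- have [g [hg e]] := ej f (ghom_rhom gf).
  exists (homog_part (g : 'Hom(Y, Ash A (- i))) 0); split; first exact: homog_part0_ghom.
  by rewrite homog_part0_comp_ghom // -[RHS](homog_part0_id gf) -e.
have [g1 [gg1 e1]] := h1 _ (ghom_comp (dpr1_ghom F1 F2) gf).
have [g2 [gg2 e2]] := h2 _ (ghom_comp (dpr2_ghom F1 F2) gf).
exists (dpair g1 g2); split; first exact: dpair_ghom.
apply/lfunP => x; rewrite lfE dpairE -!comp_lfunE e1 e2 !lfE dpr1E dpr2E.
by rewrite -surjective_pairing.
Qed.

(** Lifting the cover [P] of [M] through [p] writes every element of [Y] as
    [j x + t z] with [z] in [P]. A map on [X] and a map on [P] glue to a map on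
    [Y] when they agree on the overlap, which is the image of [R]; the
    assumption on [d] provides the map on [P]. Hence Ext^1 can be read off from
    any one presentation of [M]. *)
Lemma ext1_zero_presentation M (P R : rmod A) (e : 'Hom(P, M)) (d : 'Hom(R, P)) :
  rprojective P -> rhom e -> (forall m, exists x, e x = m) -> rhom d ->
  (forall x, e x = 0 <-> exists r, x = d r) ->
  (forall f : 'Hom(R, regular_rmod A), rhom f -> (forall r, d r = 0 -> f r = 0) ->
     exists g : 'Hom(P, regular_rmod A), rhom g /\ f = (g \o d)%VF) ->
  ext1_zero M.
Proof.
move=> pP he se hd ed ext X Y j p s f hf.
have [hj hp] := (ghom_rhom (ses_in s), ghom_rhom (ses_out s)).
have /limg_surjP sp := ses_surj s.
have [t [ht pt]] := pP _ _ _ _ hp sp he.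
have ptE x : p (t x) = e x by rewrite -comp_lfunE pt.
have tdj r : exists x, (t \o d)%VF r = j x.
  by rewrite lfE; apply/(ses_ex s); rewrite ptE; apply/ed; exists r.
pose u := (j^-1 \o (t \o d))%VF.
have hu : rhom u by apply: rhom_factor_inj (rhom_comp ht hd) tdj; last exact: ses_inj s.
have juE r : j (u r) = t (d r) by rewrite -[j _]comp_lfunE inj_comp_inv // lfE.
have [||g [hg fg]] := ext (f \o u)%VF; first exact: rhom_comp.
  move=> r dr; rewrite lfE (_ : u r = 0) ?linear0 //.
  by apply: (ses_inj s); rewrite juE dr !linear0.
have gdE r : g (d r) = f (u r).
  by move/lfunP/(_ r): fg; rewrite !lfE.
have [q eq] : exists q : 'Hom(Y, P), forall y, e (q y) = p y.
  exists (e^-1 \o p)%VF => y; have [x ex] := se (p y).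
  by rewrite lfE limg_lfunVK // -ex memv_img ?memvf.
pose h := (g \o q)%VF + (f \o j^-1 \o (\1 - (t \o q)))%VF.
(* The value of h does not depend on how y is written. *)
have hE y x z : y = j x + t z -> h y = f x + g z.
  move=> yE; have [r qr] : exists r, q y - z = d r.
    by apply/ed; rewrite linearB /= eq yE linearD /= (ses_comp0 _ s) ptE add0r subrr.
  have yq : y - t (q y) = j (x - u r).
    by rewrite linearB /= juE -qr linearB /= opprB addrA -yE.
  rewrite !lfE yq lker0_lfunK ?linearB /=; last first.
    by apply/lker0P; exact: ses_inj s.
  have -> : q y = z + d r by rewrite -qr addrC subrK.
  by rewrite linearD /= gdE addrACA subrr addr0 addrC.
have ex y : exists x z, y = j x + t z.
  have [x yx] : exists x, y - t (q y) = j x.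
    by apply/(ses_ex s); rewrite linearB /= ptE eq subrr.
  by exists x, (q y); rewrite -yx subrK.
exists h; split.
  move=> y a; have [x [z yE]] := ex y.
  rewrite (hE _ _ _ yE) (hE _ (ract x a) (ract z a)); last first.
    by rewrite yE ractDl hj ht.
  by rewrite hf hg ractDl.
apply/lfunP => x; rewrite lfE (hE _ x 0) ?linear0 ?addr0 //.
Qed.

Lemma CM_ext1_zero M : CM M -> ext1_zero M.
Proof.
move=> /(_ 1%N isT)[P cP].
apply: (@ext1_zero_presentation M (P 0%N) (P 1%N) (res_aug P) (res_d P 0)).
- exact: res_proj.
- exact: res_aughom.
- exact/limg_surjP/res_surj.
- exact: res_dhom.
- exact/limg_lkerP/res_exact0.
move=> f hf f0; have [|g [hg fg]] := cP f; last by exists g.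
split=> //; apply/lfunP => x; rewrite !lfE f0 //.
by have /limg_lkerP e := res_exactS P 0; apply/e; exists x.
Qed.

Record free_presentation M := FreePresentation {
  fp_obj : gmod A;
  fp_syz : gmod A;
  fp_in : 'Hom(fp_syz, fp_obj);
  fp_out : 'Hom(fp_obj, M);
  fp_free : gfree predT fp_obj;
  fp_ses : ses fp_in fp_out }.

Lemma free_presentation_exists M : free_presentation M.
Proof.
have [i //|F [f [fF gf sf]]] := @free_cover K A predT M.
have [X [k [gk ik ek]]] := gkernel gf.
by exists F X k f.
Qed.

Fixpoint syzygy M n : gmod A :=
  if n is n'.+1 then fp_syz (free_presentation_exists (syzygy M n')) else M.

Let fp M n := free_presentation_exists (syzygy M n).

(** In degrees above [1], Ext of [M] is Ext^1 of a syzygy, and syzygies of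
    positive order are torsionless. *)
Lemma CM_of_ext1_zero M :
  (forall X, torsionless X -> ext1_zero X) -> ext1_zero M -> CM M.
Proof.
move=> tl eM [//|n] _.
have s k := fp_ses (fp M k).
pose d k : 'Hom(fp_obj (fp M k.+1), fp_obj (fp M k)) :=
  (fp_in (fp M k) \o fp_out (fp M k.+1))%VF.
have dE k x : d k x = fp_in (fp M k) (fp_out (fp M k.+1) x) by rewrite lfE.
have exd k x : fp_out (fp M k) x = 0 <-> exists y, x = d k y.
  split=> [/(ses_ex (s k))[z ->]|[y ->]]; last by rewrite dE (ses_comp0 _ (s k)).
  by have [y <-] := ses_surj (s k.+1) z; exists y; rewrite dE.
unshelve eexists.
  unshelve refine (@ProjResolution K A M (fun k => fp_obj (fp M k)) d
    (fp_out (fp M 0%N)) _ _ _ _ _ _).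
  - by move=> k; apply: gfree_rproj (fp_free (fp M k)).
  - by move=> k; apply: rhom_comp; apply: ghom_rhom; [exact: ses_in|exact: ses_out].
  - exact: ghom_rhom (ses_out (s 0%N)).
  - exact/limg_surjP/(ses_surj (s 0%N)).
  - by apply/limg_lkerP; apply: exd.
  move=> k; apply/limg_lkerP => y; rewrite -exd dE; split=> [e|->]; last exact: linear0.
  by apply: (ses_inj (s k)); rewrite e linear0.
move=> f [hf fd].
have ek : ext1_zero (syzygy M n).
  case: n f hf fd => [//|m] f hf fd.
  apply: tl; exists (fp_obj (fp M m)), (fp_in (fp M m)); split.
  - exact: gfree_gproj (fp_free _).
  - exact: ses_in (s m).
  - exact: ses_inj (s m).
have f0 x : fp_out (fp M n.+1) x = 0 -> f x = 0.
  by move=> /exd[y ->]; move/lfunP/(_ y): fd; rewrite !lfE.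
pose g : 'Hom(syzygy M n.+1, regular_gmod A) := (f \o (fp_out (fp M n.+1))^-1)%VF.
have hg : rhom g.
  by apply: rhom_factor_surj f0; [exact: ghom_rhom (ses_out (s _))|exact: ses_surj|].
have [h [hh e]] := ek _ _ _ _ (s n) g hg.
exists h; split=> //; apply/lfunP => x.
by rewrite lfE dE -comp_lfunE e -comp_lfunE surj_inv_comp.
Qed.

(** Here Ext^1(M, J) is Ext^2(P / M, J), which vanishes because [J] has
    injective dimension at most one. Concretely: [a f] extends to [Y], the
    defect is a map from [M] to [I1], it extends to [P] and lifts to [I0], and
    subtracting this lift corrects the extension so that it lands in [J]. *)
Lemma torsionless_extends M X Y (j : 'Hom(X, Y)) (p : 'Hom(Y, M))
    J I0 I1 (a : 'Hom(J, I0)) (b : 'Hom(I0, I1)) (f : 'Hom(X, J)) :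
  torsionless M -> ses j p -> ginjective I0 -> ginjective I1 -> ses a b ->
  ghom f -> exists g : 'Hom(Y, J), ghom g /\ (g \o j)%VF = f.
Proof.
move=> [P [i [pP gi ii]]] sj inj0 inj1 sa gf.
have [gj gp] := (ses_in sj, ses_out sj); have [ga gb] := (ses_in sa, ses_out sa).
have /lker0_injP kj := ses_inj sj.
have [u [gu uE]] := inj0 _ _ _ _ gj kj (ghom_comp ga gf).
have [|v [gv vE]] := factor_surj gp (ses_surj sj) (ghom_comp gb gu).
  move=> y /(ses_ex sj)[x ->].
  by rewrite lfE -(comp_lfunE u) uE lfE (ses_comp0 _ sa).
have /lker0_injP ki := ii.
have [w [gw wE]] := inj1 _ _ _ _ gi ki gv.
have /limg_surjP sb := ses_surj sa.
have [z [gz zE]] := pP _ _ _ _ gb sb gw.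
pose u' := u - (z \o i \o p)%VF.
have gu' : ghom u' by apply: ghomB => //; do 2 apply: ghom_comp => //.
have [|g [gg gE]] := factor_inj ga (ses_inj sa) gu'.
  move=> y; apply/(ses_ex sa); rewrite !lfE linearB /= -(comp_lfunE b z) zE.
  by rewrite -(comp_lfunE w) wE -(comp_lfunE v) vE lfE subrr.
exists g; split=> //; apply/lfunP => x; apply: (ses_inj sa).
rewrite lfE -(comp_lfunE a) gE /u' !lfE (ses_comp0 _ sj) !linear0 addr0.
by rewrite -comp_lfunE uE lfE.
Qed.

Lemma ginj_shift I n : ginjective I -> ginjective (gshift I n).
Proof.
move=> iI M N g f gg kg gf.
have [h [gh e]] := iI _ _ _ _ (gshift_ghom (- n) gg) kg (gshift_ghom_to gf).
by exists h; split=> //; have := gshift_ghom_from gh; rewrite opprK.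
Qed.

Lemma ses_shift X Y Z n (f : 'Hom(X, Y)) (g : 'Hom(Y, Z)) :
  ses f g -> @ses K A (gshift X n) (gshift Y n) (gshift Z n) f g.
Proof. by case=> gf gg fi fe fs; split=> //; apply: gshift_ghom. Qed.

Lemma ginjdim1_ses M : ginjdim_le 1 M ->
  exists I0 I1 (a : 'Hom(M, I0)) (b : 'Hom(I0, I1)),
    [/\ ginjective I0, ginjective I1 & ses a b].
Proof.
case=> I I0; exists (I 0%N), (I 1%N), (ires_aug I), (ires_d I 0%N).
split; [exact: ires_inj|exact: ires_inj|split].
- exact: ires_aughom.
- exact: ires_dhom.
- exact/lker0_injP/ires_ker0.
- exact/limg_lkerP/ires_exact0.
apply/limg_surjP; rewrite ires_exactS; apply/vspaceP => x; rewrite memvf memv_ker.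
have := memvf (ires_d I 1%N x); rewrite -memv0.
by have /eqP := I0 2%N isT; rewrite dimv_eq0 => /eqP->.
Qed.

(** A map into [A] is a finite sum of graded maps into the shifts of [A], each
    of which has injective dimension at most one in the graded category. *)
Lemma torsionless_ext1_zero M :
  ginjdim_le 1 (regular_gmod A) -> torsionless M -> ext1_zero M.
Proof.
move=> /ginjdim1_ses[I0 [I1 [a [b [inj0 inj1 sa]]]]] tM X Y j p sj f hf.
have [s fE] := homog_part_sum f.
have H k : exists g : 'Hom(Y, regular_gmod A), rhom g /\ (g \o j)%VF = homog_part f k.
  have [g [gg gE]] := torsionless_extends tM sj (ginj_shift (n:=k) inj0)
    (ginj_shift (n:=k) inj1) (ses_shift k sa) (homog_part_gshift k hf).
  by exists g; split=> //; exact: ghom_rhom gg.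
rewrite fE; elim: s {fE} => [|k s [g [hg gE]]].
  exists 0; split; first exact: rhom0.
  by rewrite big_nil; apply/lfunP => x; rewrite !lfE.
have [g' [hg' gE']] := H k; exists (g' + g); split; first exact: rhomD.
by rewrite big_cons -gE -gE' comp_lfunDl.
Qed.

(** Dimension shifting: the obstruction to lifting [f] along [b] is an element
    of Ext^1(X, L), represented by a map from the syzygy [X'] to [L]; it
    vanishes when such maps extend to [P]. *)
Lemma lift_step X' P X L I L' (i : 'Hom(X', P)) (p : 'Hom(P, X))
    (a : 'Hom(L, I)) (b : 'Hom(I, L')) (f : 'Hom(X, L')) (F : 'Hom(P, I)) :
  ses i p -> ses a b -> ghom f -> ghom F -> (b \o F)%VF = (f \o p)%VF ->
  (forall r : 'Hom(X', L), ghom r -> exists e : 'Hom(P, L), ghom e /\ (e \o i)%VF = r) ->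
  exists h : 'Hom(X, I), ghom h /\ (b \o h)%VF = f.
Proof.
move=> si sa gf gF bF ext.
have [gi gp] := (ses_in si, ses_out si); have [ga gb] := (ses_in sa, ses_out sa).
have [|r [gr rE]] := factor_inj ga (ses_inj sa) (ghom_comp gF gi).
  move=> x; apply/(ses_ex sa).
  by rewrite lfE -(comp_lfunE b) bF lfE (ses_comp0 _ si) linear0.
have [e [ge eE]] := ext r gr.
have [|h [gh hE]] := factor_surj gp (ses_surj si) (ghomB gF (ghom_comp ga ge)).
  move=> y /(ses_ex si)[x ->]; rewrite !lfE -(comp_lfunE e) eE -(comp_lfunE a) rE.
  by rewrite lfE subrr.
exists h; split=> //; apply/lfunP => x; have [y <-] := ses_surj si x.
rewrite lfE -(comp_lfunE h) hE !lfE linearB /= (ses_comp0 _ sa) subr0.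
by rewrite -(comp_lfunE b) bF lfE.
Qed.

(** A lift along an epimorphism with projective kernel [P1] is obstructed by
    Ext^1(M, P1). *)
Lemma ext1_zero_lift M P1 P0 I (a : 'Hom(P1, P0)) (b : 'Hom(P0, I)) (f : 'Hom(M, I)) :
  ext1_zero M -> gprojective P1 -> ses a b -> ghom f ->
  exists h : 'Hom(M, P0), ghom h /\ (b \o h)%VF = f.
Proof.
move=> eM pP sa gf; have [F Z k e fF sk] := free_presentation_exists M.
have /limg_surjP sb := ses_surj sa.
have [u [gu uE]] := gfree_gproj fF (ses_out sa) sb (ghom_comp gf (ses_out sk)).
apply: (lift_step sk sa gf gu uE) => r gr.
exact: (extends_gproj (ses_in sk) (eM _ _ _ _ sk) pP gr).
Qed.

Section RegularMaps.
Variable M : gmod A.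

Let H := 'Hom(M, regular_gmod A).

Let comm (f : H) (b : A) : H :=
  (f \o ractr M b)%VF - (ractr (regular_gmod A) b \o f)%VF.

Let comm_linr f : linear (comm f).
Proof.
move=> k b c; apply/lfunP => x; rewrite /comm !lfE !ractrE !ract_linearr.
rewrite (linearP f) /= scalerBr opprD. 
by rewrite addrACA.
Qed.

Let comm_linl : linear (fun f => lmap (comm_linr f)).
Proof.
move=> k f g; apply/lfunP => b; rewrite !lfE !lmapE /comm; apply/lfunP => x.
by rewrite !lfE linearP /= scalerBr opprD addrACA.
Qed.

(** Being a module map is the vanishing of all commutators with the action,
    hence a linear condition; so the module maps into [A] have a finite basis. *)
Definition rhom_space : {vspace H} := lker (lmap comm_linl).

Lemma mem_rhom_space f : f \in rhom_space <-> rhom f.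
Proof.
rewrite memv_ker lmapE; split=> [/eqP/lfunP f0 m b|hf].
  have := f0 b; rewrite lmapE lfE /comm => /lfunP/(_ m).
  by rewrite !lfE !ractrE => /eqP; rewrite subr_eq0 => /eqP.
apply/eqP/lfunP => b; rewrite lmapE lfE; apply/lfunP => x.
by rewrite !lfE !ractrE hf subrr.
Qed.

End RegularMaps.

(** Collect in one map the homogeneous parts of a basis of the module maps from
    [M] to [A]. *)
Lemma left_approximation M :
  exists P (h : 'Hom(M, P)), [/\ gprojective P, ghom h & extends_regular h].
Proof.
pose ok (f : 'Hom(M, regular_gmod A)) P (h : 'Hom(M, P)) :=
  exists g : 'Hom(P, regular_gmod A), rhom g /\ (g \o h)%VF = f.
have ok1 f P P' (h : 'Hom(M, P)) (h' : 'Hom(M, P')) :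
    ok f P h -> ok f (gdsum P P') (dpair h h').
  move=> [g [hg gE]]; exists (g \o dpr1 P P')%VF; split.
    exact: rhom_comp hg (ghom_rhom (dpr1_ghom _ _)).
  by rewrite -gE; apply/lfunP => x; rewrite !comp_lfunE dpairE dpr1E.
have ok2 f P P' (h : 'Hom(M, P)) (h' : 'Hom(M, P')) :
    ok f P' h' -> ok f (gdsum P P') (dpair h h').
  move=> [g [hg gE]]; exists (g \o dpr2 P P')%VF; split.
    exact: rhom_comp hg (ghom_rhom (dpr2_ghom _ _)).
  by rewrite -gE; apply/lfunP => x; rewrite !comp_lfunE dpairE dpr2E.
have okD f f' P h : ok f P h -> ok f' P h -> ok (f + f') P h.
  move=> [g [hg <-]] [g' [hg' <-]]; exists (g + g'); split; first exact: rhomD.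
  by rewrite comp_lfunDl.
have ok0 P h : ok 0 P h.
  by exists 0; split; [exact: rhom0 | rewrite comp_lfun0l].
have hit1 f : rhom f -> exists P (h : 'Hom(M, P)), [/\ gprojective P, ghom h & ok f P h].
  move=> hf; have [s ->] := homog_part_sum f.
  elim: s => [|k s [P [h [pP gh okh]]]].
    exists (gzero A), 0; split; [exact: gzero_gproj|exact: ghom0|].
    by rewrite big_nil; apply: ok0.
  exists (gdsum (Ash A k) P), (dpair (homog_part f k : 'Hom(M, Ash A k)) h); split.
  - exact: gdsum_gproj (@Ash_gproj K A k) pP.
  - exact: dpair_ghom (homog_part_gshift k hf) gh.
  rewrite big_cons; apply: okD; last exact: ok2.
  apply: (@ok1 _ (Ash A k)); exists \1%VF; split; first exact: rhom1.
  by apply/lfunP => x; rewrite !lfE.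
have hits (t : seq 'Hom(M, regular_gmod A)) : (forall f, f \in t -> rhom f) ->
    exists P (h : 'Hom(M, P)), [/\ gprojective P, ghom h & forall f, f \in t -> ok f P h].
  elim: t => [_|f t IH ht].
    by exists (gzero A), 0; split=> //; [exact: gzero_gproj|exact: ghom0].
  have [|P [h [pP gh okh]]] := IH; first by move=> g gt; apply: ht; rewrite inE gt orbT.
  have [|P' [h' [pP' gh' okh']]] := hit1 f; first by apply: ht; rewrite inE eqxx.
  exists (gdsum P P'), (dpair h h'); split; [exact: gdsum_gproj|exact: dpair_ghom|].
  by move=> g; rewrite inE => /orP[/eqP->|/okh]; [exact: ok2|exact: ok1].
have [f /vbasis_mem/mem_rhom_space //|P [h [pP gh okh]]] := hits (vbasis (rhom_space M)).
exists P, h; split=> // f /mem_rhom_space fW.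
rewrite -/(ok f P h) (coord_vbasis fW).
apply: (big_ind (fun f => ok f P h)) => [||i _]; [exact: ok0|by move=> *; apply: okD|].
have [|g [hg gE]] := okh (vbasis (rhom_space M))`_i; first exact: memt_nth.
exists (coord (vbasis (rhom_space M)) i f *: g); split.
  by move=> m b; rewrite !lfE hg ractZl.
by rewrite -gE; apply/lfunP => x; rewrite !lfE.
Qed.

End CohenMacaulay.

(** * Vector space duality between left and right graded modules *)

(** Dualizing exchanges the sides. An anti-morphism of graded algebras carries
    the passage between right modules over [A] and over its opposite [B] in
    both directions at once. *)
Record anti_morphism (K : fieldType) (A B : graded_alg K) := AntiMorphism {
  anti_fun :> A -> B;
  anti_linear : linear anti_fun;
  antiM : forall a b, anti_fun (a * b) = anti_fun b * anti_fun a;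
  anti1 : anti_fun 1 = 1;
  anti_deg : forall i a, a \in galg_deg A i -> anti_fun a \in galg_deg B i }.

Section Dual.
Variables (K : fieldType) (A B : graded_alg K) (s : anti_morphism A B).

Section DualModule.
Variable N : gmod B.

Let D := 'Hom(N, K^o).

Let D_ract (f : D) (a : A) : D := (f \o ractr N (s a))%VF.

Let D_ractE f a x : D_ract f a x = f (ract x (s a)).
Proof. by rewrite lfE ractrE. Qed.

Let D_linearl a : linear (D_ract^~ a).
Proof. by move=> k f g; apply/lfunP => x; rewrite !(lfE, ractrE). Qed.

Let D_linearr f : linear (D_ract f).
Proof.
move=> k a b; apply/lfunP => x; rewrite !(lfE, ractrE) anti_linear ract_linearr.
by rewrite linearP.
Qed.

Let D_ractM f a b : D_ract f (a * b) = D_ract (D_ract f a) b.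
Proof. by apply/lfunP => x; rewrite !(lfE, ractrE) antiM ractM. Qed.

Let D_ract1 f : D_ract f 1 = f.
Proof. by apply/lfunP => x; rewrite !(lfE, ractrE) anti1 ract1. Qed.

Let D_rmod : rmod A := @RMod K A D D_ract D_linearl D_linearr D_ractM D_ract1.

Let D_pr_linear i : linear (fun f : D_rmod => (f : D) \o gpr N (- i))%VF.
Proof. by move=> k f g; apply/lfunP => x; rewrite !lfE. Qed.

Let D_pr i : 'End(D_rmod) := lmap (@D_pr_linear i).

Let D_prE i f x : (D_pr i f : D) x = (f : D) (gpr N (- i) x).
Proof. by rewrite lmapE lfE. Qed.

Let D_supp := [seq - i | i <- gm_supp N].

Let D_uniq : uniq D_supp.
Proof. by rewrite map_inj_uniq ?gm_uniq //; apply: oppr_inj. Qed.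

Let D_pr_out i f : i \notin D_supp -> D_pr i f = 0.
Proof.
move=> iD; apply/(lfunP (D_pr i f : D)) => x; rewrite D_prE gpr_out ?linear0 ?lfE //.
by apply: contra iD => iN; apply/mapP; exists (- i) => //; rewrite opprK.
Qed.

Let D_pr_sum f : \sum_(i <- D_supp) D_pr i f = f.
Proof.
apply/(lfunP (_ : D)) => x; rewrite sum_lfunE big_map.
rewrite -[x in RHS]gpr_sum linear_sum; apply: eq_bigr => i _.
by rewrite D_prE opprK.
Qed.

Let D_prK i j f : D_pr i (D_pr j f) = if i == j then D_pr j f else 0.
Proof.
apply/(lfunP (_ : D)) => x; rewrite !D_prE gprK eqr_opp eq_sym.
by case: eqP => [->|_]; rewrite ?linear0 ?lfE // D_prE.
Qed.

Let D_pr_act i j (f : D_rmod) a : a \in galg_deg A j ->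
  D_pr (i + j%:Z) (ract f a) = ract (D_pr i f) a.
Proof.
move=> aj; apply/(lfunP (_ : D)) => x; rewrite D_prE.
rewrite [LHS]D_ractE [RHS]D_ractE D_prE -(gpr_act _ _ (anti_deg s aj)).
by congr ((f : D) (gpr _ _ _)); lia.
Qed.

Definition gdual : gmod A :=
  gmod_of_pr D_uniq D_pr_out D_pr_sum D_prK D_pr_act.

(** An element of the dual as a linear form; the carrier of [gdual] hides that
    it is one. *)
Definition dev (f : gdual) (x : N) : K := (f : 'Hom(N, K^o)) x.

Lemma dev_linear f : scalar (dev f).
Proof. exact: (linearP (f : 'Hom(N, K^o))). Qed.

Lemma dev_linearl x : scalar (dev^~ x).
Proof. by move=> k f g; rewrite /dev lfE lfE. Qed.

Lemma dev_ext f g : dev f =1 dev g -> f = g.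
Proof. by move=> fg; apply/(lfunP (f : 'Hom(N, K^o))). Qed.

Lemma dev0 x : dev 0 x = 0.
Proof. by rewrite /dev lfE. Qed.

Lemma dev0r f : dev f 0 = 0.
Proof. by rewrite /dev linear0. Qed.

Lemma dev_ract f a x : dev (ract f a) x = dev f (ract x (s a)).
Proof. exact: D_ractE. Qed.

Lemma dev_gpr i f x : dev (gpr gdual i f) x = dev f (gpr N (- i) x).
Proof. by rewrite /gdual gmod_of_prE; apply: D_prE. Qed.

Definition dfun (h : N -> K^o) (lh : linear h) : gdual := lmap lh.

Lemma dfunE (h : N -> K^o) (lh : linear h) x : dev (dfun lh) x = h x.
Proof. exact: (lmapE lh). Qed.

Lemma dev_sep x : (forall f, dev f x = 0) -> x = 0.
Proof.
move=> x0; rewrite (coord_vbasis (memvf x)); apply: big1 => i _.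
have lh : linear (fun y : N => (coord (vbasis fullv) i y : K^o)).
  by move=> k y z; rewrite linearP.
by have := x0 (dfun lh); rewrite dfunE => ->; rewrite scale0r.
Qed.

Lemma gdual_deg i : gm_deg N (- i) = 0%VS -> gm_deg gdual i = 0%VS.
Proof.
move=> N0; apply/vspaceP => f; rewrite memv0 mem_gpr; apply/eqP/eqP => [<-|->].
  apply: dev_ext => x; rewrite dev_gpr dev0.
  by have := gpr_in (- i) x; rewrite N0 memv0 => /eqP->; rewrite dev0r.
by rewrite linear0.
Qed.

Lemma dim_gdual : \dim {:gdual} = \dim {:N}.
Proof. by rewrite !dimvf; apply: muln1. Qed.

End DualModule.

Lemma dual_map_linear (N N' : gmod B) (g : 'Hom(N, N')) :
  linear (fun f : gdual N' => ((f : 'Hom(N', K^o)) \o g)%VF : gdual N).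
Proof. by move=> k f f'; apply/(lfunP (_ : 'Hom(N, K^o))) => x; rewrite !lfE. Qed.

Definition dual_map (N N' : gmod B) (g : 'Hom(N, N')) : 'Hom(gdual N', gdual N) :=
  lmap (dual_map_linear g).

Lemma dual_mapE (N N' : gmod B) (g : 'Hom(N, N')) f x : dev (dual_map g f) x = dev f (g x).
Proof. by rewrite /dual_map lmapE /dev lfE. Qed.

Lemma dual_map_ghom (N N' : gmod B) (g : 'Hom(N, N')) : ghom g -> ghom (dual_map g).
Proof.
move=> gg; apply: ghomP => [f a|i f]; apply: dev_ext => x.
  by rewrite dual_mapE !dev_ract dual_mapE (ghom_rhom gg).
by rewrite dual_mapE !dev_gpr dual_mapE (ghom_gpr _ _ gg).
Qed.

Lemma ses_dual (X Y Z : gmod B) (f : 'Hom(X, Y)) (g : 'Hom(Y, Z)) :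
  ses f g -> ses (dual_map g) (dual_map f).
Proof.
move=> sf; have [gf gg fi fg gs] := sf; split.
- exact: dual_map_ghom.
- exact: dual_map_ghom.
- move=> u v uv; apply: dev_ext => z; have [y <-] := gs z.
  by rewrite -!dual_mapE uv.
- move=> u; split=> [u0|[v ->]]; last first.
    by apply: dev_ext => x; rewrite !dual_mapE (ses_comp0 _ sf) dev0r dev0.
  exists ((u : 'Hom(Y, K^o)) \o g^-1)%VF.
  have E := @surj_inv_comp K Y Z _ g (u : 'Hom(Y, K^o)).
  apply: dev_ext => y; rewrite dual_mapE /dev -comp_lfunE E // => x /fg[w ->].
  by rewrite -[LHS]/(dev u (f w)) -dual_mapE u0 dev0.
move=> u; exists ((u : 'Hom(X, K^o)) \o f^-1)%VF.
apply: dev_ext => x; rewrite dual_mapE /dev lfE lker0_lfunK //.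
exact/lker0P.
Qed.

End Dual.

Section Flip.
Variables (K : fieldType) (A B : graded_alg K).
Variables (s : anti_morphism A B) (t : anti_morphism B A).
Hypothesis st : forall b, s (t b) = b.

(** A map into a dual is a bilinear form, which can be read from either side:
    duality is self-adjoint. *)
Lemma flip (M : gmod A) (N : gmod B) (f : 'Hom(M, gdual s N)) : ghom f ->
  exists g : 'Hom(N, gdual t M), ghom g /\ forall n m, dev (g n) m = dev (f m) n.
Proof.
move=> gf.
have l1 n : linear (fun m : M => dev (f m) n : K^o).
  by move=> k x y; rewrite linearP dev_linearl.
have l2 : linear (fun n : N => dfun t (l1 n)).
  move=> k x y; apply: dev_ext => m; rewrite dev_linearl.
  by rewrite !dfunE dev_linear.
exists (lmap l2); split; last by move=> n m; rewrite lmapE dfunE.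
apply: ghomP => [n b|i n]; apply: dev_ext => m.
  by rewrite dev_ract !lmapE !dfunE (ghom_rhom gf) dev_ract st.
by rewrite dev_gpr !lmapE !dfunE (ghom_gpr _ _ gf) dev_gpr opprK.
Qed.

End Flip.

Section Biduality.
Variables (K : fieldType) (A B : graded_alg K).
Variables (s : anti_morphism A B) (t : anti_morphism B A).
Hypothesis ts : forall a, t (s a) = a.
Hypothesis st : forall b, s (t b) = b.

(** By adjunction, extending a map into the dual of [F] is lifting a map from
    [F]. *)
Lemma gdual_ginj (F : gmod B) : gprojective F -> ginjective (gdual s F).
Proof.
move=> pF M N g f gg /lker0_injP ig gf.
have [f' [gf' fE]] := flip st gf.
have /limg_surjP sg : forall u, exists v, dual_map t g v = u.
  have [Z [p sgp]] := ses_of_inj gg ig.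
  exact: ses_surj (ses_dual t sgp).
have [k [gk kE]] := pF _ _ _ _ (dual_map_ghom t gg) sg gf'.
have [h [gh hE]] := flip ts gk.
exists h; split=> //; apply/lfunP => m; apply: dev_ext => x.
by rewrite lfE hE -dual_mapE -comp_lfunE kE fE.
Qed.

(** Evaluation is injective because linear forms separate points, and bijective
    by dimension. *)
Lemma biduality (M : gmod A) :
  exists (e : 'Hom(M, gdual s (gdual t M))) (e' : 'Hom(gdual s (gdual t M), M)),
    [/\ ghom e, ghom e', (forall m u, dev (e m) u = dev u m),
        (forall m, e' (e m) = m) & (forall w, e (e' w) = w)].
Proof.
have [e [ge eE]] := flip ts (ghom1 (gdual t M)).
have {}eE m u : dev (e m) u = dev u m by rewrite eE lfE.
have ie : injective e.
  move=> m m' mm'; apply/eqP; rewrite -subr_eq0; apply/eqP.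
  apply: (dev_sep (s := t)) => u.
  by rewrite -eE linearB /= mm' subrr dev0.
have se w : exists m, e m = w.
  suff /mem_limgP[m ->] : w \in limg e by exists m.
  suff -> : limg e = fullv by rewrite memvf.
  apply/eqP; rewrite eqEdim subvf andTb (dim_gdual s) (dim_gdual t) limg_dim_eq //.
  by move/lker0_injP: ie => ->; rewrite capv0.
have [e' [ge' e'e ee']] := ghom_inv ge ie se.
exists e, e'; split=> // x.
  by move/lfunP/(_ x): e'e; rewrite !lfE.
by move/lfunP/(_ x): ee'; rewrite !lfE.
Qed.

End Biduality.

Section DualInjective.
Variables (K : fieldType) (A B : graded_alg K).
Variables (s : anti_morphism A B) (t : anti_morphism B A).
Hypothesis ts : forall a, t (s a) = a.
Hypothesis st : forall b, s (t b) = b.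

(** The dual problem is an extension problem into the bidual of [J], which is
    [J]; biduality also brings the solution back to [M]. *)
Lemma gdual_gproj (J : gmod B) : ginjective J -> gprojective (gdual s J).
Proof.
move=> iJ M N g f gg /limg_surjP sg gf.
have [eM [eM' [geM geM' eME eMK eMK']]] := biduality ts M.
have [eJ [eJ' [geJ geJ' eJE eJK eJK']]] := biduality st J.
have [X [p sp]] := ses_of_surj gg sg.
have sd := ses_dual t sp.
have /lker0_injP kd := ses_inj sd.
have [k [gk kE]] := iJ _ _ _ _ (ses_in sd) kd (ghom_comp geJ' (dual_map_ghom t gf)).
exists (eM' \o dual_map s k)%VF; split.
  exact: ghom_comp geM' (dual_map_ghom s gk).
apply/lfunP => u; apply/eqP; rewrite -subr_eq0; apply/eqP.
apply: (dev_sep (s := t)) => v.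
rewrite /dev linearB /= -!/(dev _ _) lfE -dual_mapE lfE -eME eMK' dual_mapE.
by rewrite -comp_lfunE kE lfE -eJE eJK' dual_mapE subrr.
Qed.

Lemma free_ginj_ses D (F : gmod B) : ginjdim_le 1 (regular_gmod B) -> gfree D F ->
  exists (J0 J1 : gmod B) (a : 'Hom(F, J0)) (b : 'Hom(J0, J1)),
    [/\ ginjective J0, ginjective J1 & ses a b].
Proof.
move=> /ginjdim1_ses[I0 [I1 [a [b [inj0 inj1 sa]]]]].
elim=> [|i _|X Y _ [X0 [X1 [a1 [b1 [iX0 iX1 s1]]]]] _ [Y0 [Y1 [a2 [b2 [iY0 iY1 s2]]]]]].
- have i0 : ginjective (gzero B).
    move=> M N g f gg kg gf; exists 0; split; first exact: ghom0.
    by apply/lfunP => x; rewrite !lfE [RHS]gzero_eq0.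
  exists (gzero B), (gzero B), \1%VF, 0; split=> //; split.
  - exact: ghom1.
  - exact: ghom0.
  - by move=> x y _; rewrite [x]gzero_eq0 [y]gzero_eq0.
  - by move=> y; split=> [_|_]; [exists y; rewrite lfE | rewrite lfE].
  by move=> z; exists 0; rewrite [RHS]gzero_eq0 linear0.
- exists (gshift I0 (- i)), (gshift I1 (- i)), a, b.
  split; [exact: ginj_shift|exact: ginj_shift|exact: ses_shift].
exists (gdsum X0 Y0), (gdsum X1 Y1), (dmap a1 a2), (dmap b1 b2).
have idsum P Q : ginjective P -> ginjective Q -> ginjective (gdsum P Q).
  move=> iP iQ M N g f gg kg gf.
  have [h1 [gh1 e1]] := iP _ _ _ _ gg kg (ghom_comp (dpr1_ghom P Q) gf).
  have [h2 [gh2 e2]] := iQ _ _ _ _ gg kg (ghom_comp (dpr2_ghom P Q) gf).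
  exists (dpair h1 h2); split; first exact: dpair_ghom.
  apply/lfunP => x; rewrite lfE dpairE -!comp_lfunE e1 e2 !lfE dpr1E dpr2E.
  by rewrite -surjective_pairing.
split; [exact: idsum|exact: idsum|exact: ses_dsum].
Qed.

(** Dualize a free cover of the dual of [M]. The resulting injective has
    projective dimension at most one because a free module over [B] has
    injective dimension at most one, and a cover generated in degrees at least
    [- b] gives an injective in degrees at most [b]. *)
Lemma enough_ginj_dual (M : gmod A) (b : int) :
  ginjdim_le 1 (regular_gmod B) -> (forall j, b < j -> gm_deg M j = 0%VS) ->
  exists (I P1 P0 : gmod A) (i : 'Hom(M, I)) (f : 'Hom(P1, P0)) (g : 'Hom(P0, I)),
    [/\ ginjective I /\ (forall j, b < j -> gm_deg I j = 0%VS),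
        ghom i, injective i, gprojective P1 /\ gprojective P0 & ses f g].
Proof.
move=> idB Mb.
pose D : pred int := fun j => - b <= j.
have [j Dj|F [c [fF gc sc]]] := @free_cover K B D (gdual t M).
  by apply: gdual_deg; apply: Mb; move: Dj; rewrite /D; lia.
have [i [gi iE]] := flip ts gc.
have [J0 [J1 [f [g [iJ0 iJ1 sfg]]]]] := free_ginj_ses idB fF.
exists (gdual s F), (gdual s J1), (gdual s J0), i, (dual_map s g), (dual_map s f).
split=> //.
- split; first exact: (gdual_ginj ts st (gfree_gproj fF)).
  move=> j bj; apply: gdual_deg; apply: (gfree_deg fF) (_ : _ < - b); last by lia.
  by [].
- move=> m m' mm'; apply/eqP; rewrite -subr_eq0; apply/eqP.
  apply: (dev_sep (s := t)) => u; have [x <-] := sc u.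
  by rewrite -iE linearB /= mm' subrr dev0.
- by split; apply: gdual_gproj.
exact: ses_dual.
Qed.

End DualInjective.

Section EnoughInjectives.
Variables (K : fieldType) (A : graded_alg K).

Let to_opp (a : A) : opp_galg A := (a : opp_alg A).
Let of_opp (a : opp_galg A) : A := (a : opp_alg A).

Let s : anti_morphism A (opp_galg A).
Proof. by apply: (@AntiMorphism K A (opp_galg A) to_opp). Defined.

Let t : anti_morphism (opp_galg A) A.
Proof. by apply: (@AntiMorphism K (opp_galg A) A of_opp). Defined.

Lemma enough_ginj (M : gmod A) (b : int) :
  ginjdim_le 1 (regular_gmod (opp_galg A)) ->
  (forall j, b < j -> gm_deg M j = 0%VS) ->
  exists (I P1 P0 : gmod A) (i : 'Hom(M, I)) (f : 'Hom(P1, P0)) (g : 'Hom(P0, I)),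
    [/\ ginjective I /\ (forall j, b < j -> gm_deg I j = 0%VS),
        ghom i, injective i, gprojective P1 /\ gprojective P0 & ses f g].
Proof. exact: (@enough_ginj_dual K A (opp_galg A) s t). Qed.

End EnoughInjectives.

(** * The Frobenius structure on Cohen-Macaulay modules *)

Section Degrees.
Variables (K : fieldType) (A : graded_alg K).
Implicit Types M N P Q X Y Z I J L : gmod A.

Lemma gm_bounded M : exists n : nat,
  forall j : int, (n%:Z <= j) || (j < - n%:Z) -> gm_deg M j = 0%VS.
Proof.
(* Any bound exceeding all absolute values in the support works; the sum of
   the |i| + 1 is one. *)
exists (\sum_(i <- gm_supp M) `|i|.+1)%N => j hj; apply: gm_out.
apply/negP => jM; move: hj; rewrite (bigD1_seq j) ?gm_uniq //=.
by move: (\sum_(i <- _ | _) _)%N => m; lia.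
Qed.

Lemma deg0_inj X Y (j : 'Hom(X, Y)) i :
  ghom j -> injective j -> gm_deg Y i = 0%VS -> gm_deg X i = 0%VS.
Proof.
move=> gj ij Y0; apply/vspaceP => x; rewrite memv0; apply/idP/eqP => [xi|->].
  by apply: ij; rewrite linear0; apply/eqP; rewrite -memv0 -Y0; apply: (proj2 gj).
exact: mem0v.
Qed.

Lemma deg0_surj X Y (p : 'Hom(X, Y)) i :
  ghom p -> (forall y, exists x, p x = y) -> gm_deg X i = 0%VS -> gm_deg Y i = 0%VS.
Proof.
move=> gp sp X0; apply/vspaceP => y; rewrite memv0; apply/idP/eqP => [yi|->].
  have [x xi <-] := surj_homog gp sp yi.
  by move: xi; rewrite X0 memv0 => /eqP->; rewrite linear0.
exact: mem0v.
Qed.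

Lemma deg0_eq0 M i (x : M) : gm_deg M i = 0%VS -> x \in gm_deg M i -> x = 0.
Proof. by move=> ->; rewrite memv0 => /eqP. Qed.

Lemma mem_trunc X n (x : X) :
  x \in trunc_vs X n <-> forall i, i < n -> gpr X i x = 0.
Proof.
split=> [xt i lt_in|x0].
  suff /subvP/(_ _ xt) : (trunc_vs X n <= lker (gpr X i))%VS.
    by rewrite memv_ker => /eqP.
  apply: subv_sum_seq => j _ nj; apply/subvP => y yj.
  rewrite memv_ker (gpr_deg _ yj) ifN //.
  by apply: contraTneq lt_in => ->; rewrite -leNgt.
rewrite -[x]gpr_sum; apply: memv_suml => i _.
case: (leP n i) => [ni|/x0->]; last exact: mem0v.
exact: (subvP (deg_sub_trunc X ni)) (gpr_in i x).
Qed.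

Definition trunc_in X n : 'Hom(gtrunc X n, X) := linfun (vsval : subvs_of (trunc_vs X n) -> X).

Lemma trunc_in_ghom X n : ghom (trunc_in X n).
Proof.
split=> [x a|i x]; first by rewrite !lfunE.
by rewrite /= mem_trunc_deg lfunE.
Qed.

Lemma trunc_in_inj X n : injective (trunc_in X n).
Proof. by move=> x y; rewrite !lfunE => /val_inj. Qed.

Lemma trunc_in_img X n (x : X) :
  (forall i, i < n -> gpr X i x = 0) -> exists y, x = trunc_in X n y.
Proof. by move=> /mem_trunc xt; exists (Subvs xt); rewrite lfunE. Qed.

Lemma trunc_in_img_deg X n i (x : X) : n <= i -> x \in gm_deg X i ->
  exists y, x = trunc_in X n y.
Proof.
move=> ni xi; apply: trunc_in_img => j jn; rewrite (gpr_deg _ xi).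
by case: eqP => // ji; move: ni jn; rewrite ji; lia.
Qed.

Lemma trunc_deg_lt X n i : i < n -> gm_deg (gtrunc X n) i = 0%VS.
Proof.
move=> lt_in; apply/vspaceP => x; rewrite memv0; apply/idP/eqP => [xi|->].
  apply: (@trunc_in_inj X n); rewrite linear0.
  have /mem_trunc/(_ i lt_in) := subvsP (x : subvs_of (trunc_vs X n)).
  by rewrite lfunE gpr_id //; move: xi; rewrite /= mem_trunc_deg.
exact: mem0v.
Qed.

Lemma trunc_deg0 X n i : gm_deg X i = 0%VS -> gm_deg (gtrunc X n) i = 0%VS.
Proof. exact: deg0_inj (@trunc_in_ghom X n) (@trunc_in_inj X n). Qed.

(** The quotient [Z] is [X_{< n}]. *)
Lemma trunc_ses X n : exists Z (p : 'Hom(X, Z)), ses (trunc_in X n) p /\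
  forall i, n <= i \/ gm_deg X i = 0%VS -> gm_deg Z i = 0%VS.
Proof.
have [Z [p sp]] := ses_of_inj (@trunc_in_ghom X n) (@trunc_in_inj X n).
exists Z, p; split=> // i [ni|]; last exact: deg0_surj (ses_out sp) (ses_surj sp).
apply/vspaceP => z; rewrite memv0; apply/idP/eqP => [zi|->]; last exact: mem0v.
have [x xi <-] := surj_homog (ses_out sp) (ses_surj sp) zi.
by apply/(ses_ex sp); apply: trunc_in_img_deg xi.
Qed.

End Degrees.

Section Gorenstein.
Variables (K : fieldType) (A : graded_alg K).
Hypothesis hA : iwanaga_gorenstein 1 A.
Implicit Types M N P Q X Y Z I J L : gmod A.

Lemma torsionless_CM M : torsionless M -> CM M.
Proof.
have ext X : torsionless X -> ext1_zero X by apply: torsionless_ext1_zero (proj1 hA).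
by move=> tM; apply: CM_of_ext1_zero => //; apply: ext.
Qed.

(** Embed [M] into an injective that has projective dimension at most one. The
    embedding lifts to the projective cover because Ext^1(M, A) = 0, and the
    lift is again injective. *)
Lemma CM_torsionless M : CM M -> torsionless M.
Proof.
move=> cM; have [n Mn] := gm_bounded M.
have [|I [P1 [P0 [i [f [g [[_ _] gi ii [pP1 pP0] sfg]]]]]]] :=
    @enough_ginj K A M n%:Z (proj2 hA).
  by move=> j nj; apply: Mn; rewrite ltW.
have [h [gh hE]] := ext1_zero_lift (CM_ext1_zero cM) pP1 sfg gi.
exists P0, h; split=> // x y xy; apply: ii.
by rewrite -hE !lfE xy.
Qed.

Lemma CM_sub M N (f : 'Hom(M, N)) : ghom f -> injective f -> CM N -> CM M.
Proof.
move=> gf fi /CM_torsionless[P [i [pP gi ii]]]; apply: torsionless_CM.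
exists P, (i \o f)%VF; split=> //; first exact: ghom_comp.
by move=> x y; rewrite !lfE => /ii/fi.
Qed.

Lemma gproj_CM P : gprojective P -> CM P.
Proof.
move=> pP; apply: torsionless_CM; exists P, \1%VF; split=> //; first exact: ghom1.
by move=> x y; rewrite !lfE.
Qed.

Lemma CM_dsum M N : CM M -> CM N -> CM (gdsum M N).
Proof.
move=> /CM_torsionless[P [i [pP gi ii]]] /CM_torsionless[Q [j [pQ gj ij]]].
apply: torsionless_CM; exists (gdsum P Q), (dmap i j).
split; [exact: gdsum_gproj|exact: dmap_ghom|].
by move=> [x y] [x' y']; rewrite !dmapE => -[/ii-> /ij->].
Qed.

(** The left approximation [h] is injective because [X] embeds in some
    projective, through which it factors. Its cokernel has no Ext^1 into [A],
    as that group measures the maps into [A] that do not extend along [h]. *)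
Lemma CM_suspension X : CM X -> inhabited (suspension X).
Proof.
move=> /CM_torsionless[Q [i [pQ gi ii]]].
have [P [h [pP gh eh]]] := left_approximation X.
have [g [gg gE]] := extends_gproj gh eh pQ gi.
have ih : injective h by move=> x y xy; apply: ii; rewrite -gE !lfE xy.
have [C [c sc]] := ses_of_inj gh ih.
constructor; apply: (@Suspension K A X P C h c) => //; last exact/sesP.
apply: CM_of_ext1_zero => [M|]; first exact: torsionless_ext1_zero (proj1 hA).
apply: (@ext1_zero_presentation K A C P X c h).
- exact: gproj_rproj.
- exact: ghom_rhom (ses_out sc).
- exact: ses_surj sc.
- exact: ghom_rhom.
- exact: ses_ex sc.
by move=> f hf _; have [u [hu uE]] := eh f hf; exists u.
Qed.

Lemma CM_extends M X Y Q (j : 'Hom(X, Y)) (p : 'Hom(Y, M)) (f : 'Hom(X, Q)) :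
  CM M -> ses j p -> gprojective Q -> ghom f ->
  exists g : 'Hom(Y, Q), ghom g /\ (g \o j)%VF = f.
Proof.
move=> /CM_ext1_zero eM s pQ gf.
exact: extends_gproj (ses_in s) (eM _ _ _ _ s) pQ gf.
Qed.

(** * The module V is presilting *)

(** The cokernel of such an embedding is concentrated in negative degrees, as
    the module U is for V; hence there are no maps to it from modules
    concentrated in nonnegative degrees. The cokernel itself need not be
    formed. *)
Definition nonneg_embedding M : Prop := exists (F : gmod A) (i : 'Hom(M, F)),
  [/\ gprojective F, ghom i, injective i,
      forall d x, 0 <= d -> x \in gm_deg F d -> exists v, x = i v
    & forall d, d < 0 -> gm_deg M d = 0%VS].

Lemma nonneg_embedding_dsum M N :
  nonneg_embedding M -> nonneg_embedding N -> nonneg_embedding (gdsum M N).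
Proof.
move=> [F [i [pF gi ii Fi M0]]] [G [j [pG gj ij Gj N0]]].
exists (gdsum F G), (dmap i j); split.
- exact: gdsum_gproj.
- exact: dmap_ghom.
- by move=> [x y] [x' y']; rewrite !dmapE => -[/ii-> /ij->].
- move=> d [x y] d0; rewrite mem_dsum_deg => /andP[/(Fi _ _ d0)[u ux] /(Gj _ _ d0)[v vy]].
  by exists (u, v); rewrite dmapE; congr (_, _).
by move=> d d0; apply: gdsum_deg0; [apply: M0|apply: N0].
Qed.

(** [Vmod A] is [Vsum] of [1, .., galg_top A]; inductions need all lists. *)
Definition Vsum (l : seq nat) : gmod A :=
  foldr (@gdsum K A) (gzero A) [seq gtrunc (Ash A i%:Z) 0 | i <- l].

Lemma Vsum_embedding l : nonneg_embedding (Vsum l).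
Proof.
elim: l => [|n s IH].
  exists (gzero A), 0; split=> //; [exact: gzero_gproj|exact: ghom0| |].
    by move=> x y _; rewrite [x]gzero_eq0 [y]gzero_eq0.
  by move=> d x _ _; exists 0; rewrite [x]gzero_eq0 linear0.
apply: nonneg_embedding_dsum IH.
exists (Ash A n%:Z), (trunc_in (Ash A n%:Z) 0); split.
- exact: Ash_gproj.
- exact: trunc_in_ghom.
- exact: trunc_in_inj.
- by move=> d x d0 xd; apply: trunc_in_img_deg xd.
exact: trunc_deg_lt.
Qed.

Lemma Vmod_embedding : nonneg_embedding (Vmod A).
Proof. exact: Vsum_embedding. Qed.

Lemma Vsum_CM l : CM (Vsum l).
Proof.
have [F [i [pF gi ii _ _]]] := Vsum_embedding l.
by apply: torsionless_CM; exists F, i.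
Qed.

Lemma Vmod_CM : CM (Vmod A).
Proof. exact: Vsum_CM. Qed.

Lemma iterated_shift0 X n Y : iterated_shift X n Y -> n = 0%N -> Y = X.
Proof. by case. Qed.

Lemma iterated_shift_CM X n : CM X -> exists Y, iterated_shift X n Y /\ CM Y.
Proof.
move=> cX; elim: n => [|n [Y [sY cY]]]; first by exists X; split=> //; constructor.
have [s] := CM_suspension cY.
by exists (susp_obj s); split; [constructor|apply: susp_CM].
Qed.

(** With F / V in negative degrees, extend V -> F to a map [t] from the
    projective of the suspension. The induced map from V[1] to F / V kills the
    image of [f], for lack of maps from [X] to F / V. The kernel of this induced
    map is the image of the kernel of [t], which embeds in V[1] because it meets
    V trivially; so [f] factors through it, and thus through the projective. *)
Lemma stably_zero_V1 (s : suspension (Vmod A)) X (f : 'Hom(X, susp_obj s)) :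
  (forall d, d < 0 -> gm_deg X d = 0%VS) -> ghom f -> stably_zero f.
Proof.
move=> X0 gf; have [F [i [pF gi ii Fi _]]] := Vmod_embedding.
have /sesP ss := susp_exact s.
have [t [gt tE]] := CM_extends (susp_CM s) ss pF gi.
have tiE v : t (susp_in s v) = i v by rewrite -comp_lfunE tE.
have [N [k [gk ik ek]]] := gkernel gt.
have gk' : ghom (susp_out s \o k)%VF by apply: ghom_comp => //; apply: ses_out ss.
have ik' : injective (susp_out s \o k)%VF.
  apply/lker0_injP/eqP; rewrite -subv0; apply/subvP => z.
  rewrite memv_ker memv0 lfE => /eqP/(ses_ex ss)[v kv].
  have : t (k z) = 0 by apply/ek; exists z.
  rewrite kv tiE -[X in _ = X](linear0 i) => /ii v0.
  by apply/eqP; apply: ik; rewrite kv v0 !linear0.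
have [|h [gh hE]] := factor_inj gk' ik' gf.
  move=> x; apply/mem_limgP; rewrite -[x]gpr_sum linear_sum; apply: memv_suml => d _ /=.
  case: (leP 0 d) => [d0|/X0 Xd]; last first.
    by rewrite (deg0_eq0 Xd (gpr_in d x)) linear0 mem0v.
  have [p pd pE] := surj_homog (ses_out ss) (ses_surj ss) (proj2 gf _ _ (gpr_in d x)).
  have [v vE] := Fi _ _ d0 (proj2 gt _ _ pd).
  have [z zE] : exists z, p - susp_in s v = k z.
    by apply/ek; rewrite linearB /= tiE vE subrr.
  apply/mem_limgP; exists z.
  by rewrite lfE -zE linearB /= (ses_comp0 _ ss) subr0 pE.
exists (susp_proj s), (k \o h)%VF, (susp_out s).
split; [exact: susp_projP|exact: ghom_comp|exact: ses_out ss|].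
by rewrite comp_lfunA.
Qed.

(** Stably, maps from [X] to [Y[1]] are maps from the syzygy of [X] to [Y]. A
    module in nonnegative degrees has a free cover generated in nonnegative
    degrees, so its syzygy satisfies the same assumptions as [X]. *)
Lemma stably_zero_Vn n Y : iterated_shift (Vmod A) n Y -> (0 < n)%N ->
  forall X (f : 'Hom(X, Y)), CM X -> (forall d, d < 0 -> gm_deg X d = 0%VS) ->
  ghom f -> stably_zero f.
Proof.
elim=> [//|{n Y} n Y s sY IH] _ X f cX X0 gf.
case: (posnP n) => [n0|n_gt0].
  move: (iterated_shift0 sY n0) => YV; move: s f gf; rewrite YV => s f gf.
  exact: stably_zero_V1.
pose D : pred int := fun d => 0 <= d.
have [d|F [p [fF gp sp]]] := @free_cover K A D X.
  by rewrite /D -ltNge; apply: X0.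
have [Z [i si]] := ses_of_surj gp sp.
have pF := gfree_gproj fF.
have cZ : CM Z by apply: CM_sub (ses_in si) (ses_inj si) (gproj_CM pF).
have Z0 d : d < 0 -> gm_deg Z d = 0%VS.
  move=> d0; apply: deg0_inj (ses_in si) (ses_inj si) _.
  exact: gfree_deg fF _ d0.
have /sesP ss := susp_exact s.
have /limg_surjP so := ses_surj ss.
have [u [gu uE]] := pF _ _ _ _ (ses_out ss) so (ghom_comp gf gp).
have [|h [gh hE]] := lift_step si ss gf gu uE.
  move=> r gr; have [Q [a [b [pQ ga gb rE]]]] := IH n_gt0 Z r cZ Z0 gr.
  have [e [ge eE]] := CM_extends cX si pQ ga.
  exists (b \o e)%VF; split; first exact: ghom_comp.
  by rewrite -comp_lfunA eE.
exists (susp_proj s), h, (susp_out s); split=> //; [exact: susp_projP|exact: ses_out ss].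
Qed.

Lemma Vmod_presilting : presilting (Vmod A).
Proof.
split=> [|n n_gt0]; first exact: Vmod_CM.
split=> [|Y sY f gf].
  by have [Y [sY _]] := iterated_shift_CM n Vmod_CM; exists Y.
apply: (stably_zero_Vn sY n_gt0 Vmod_CM _ gf).
by have [F [i [_ _ _ _ V0]]] := Vmod_embedding.
Qed.

End Gorenstein.

(** * Thick subcategories and syzygies *)

Section Thick.
Variables (K : fieldType) (A : graded_alg K).
Hypothesis hA : iwanaga_gorenstein 1 A.
Implicit Types M N P Q X Y Z I J L : gmod A.

Lemma stably_zero0 M N : stably_zero (0 : 'Hom(M, N)).
Proof.
exists (gzero A), 0, 0; split; [exact: gzero_gproj|exact: ghom0|exact: ghom0|].
by rewrite comp_lfun0l.
Qed.

Lemma stably_eq_refl M N (f : 'Hom(M, N)) : stably_eq f f.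
Proof. by rewrite /stably_eq subrr; apply: stably_zero0. Qed.

Lemma stable_iso_id M : stable_iso (\1%VF : 'Hom(M, M)).
Proof.
split; first exact: ghom1.
by exists \1%VF; split; [exact: ghom1| |]; rewrite comp_lfun1l; apply: stably_eq_refl.
Qed.

Lemma ses_split X Y : ses (din1 X Y) (dpr2 X Y).
Proof.
split; [exact: din1_ghom|exact: dpr2_ghom| | |].
- by move=> x x'; rewrite !din1E => -[].
- move=> [x y]; rewrite dpr2E; split=> [/= y0|[z]]; last by rewrite din1E => ->.
  by exists x; rewrite din1E y0.
by move=> y; exists (0, y); rewrite dpr2E.
Qed.

Lemma zero_gproj M : (forall i, gm_deg M i = 0%VS) -> gprojective M.
Proof.
move=> M0; have x0 (x : M) : x = 0.
  rewrite -[x]gpr_sum big1 // => i _; exact: deg0_eq0 (M0 i) (gpr_in i x).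
move=> X Y g f gg sg gf; exists 0; split; first exact: ghom0.
by apply/lfunP => x; rewrite [x]x0 !linear0.
Qed.

(** The comparison of presentations over a map, as in Schanuel's lemma. *)
Lemma lift_ses M M' X P X' P' (j : 'Hom(X, P)) (p : 'Hom(P, M))
    (j' : 'Hom(X', P')) (p' : 'Hom(P', M')) (f : 'Hom(M, M')) :
  gprojective P -> ses j p -> ses j' p' -> ghom f ->
  exists (u : 'Hom(P, P')) (r : 'Hom(X, X')),
    [/\ ghom u, ghom r, (p' \o u)%VF = (f \o p)%VF & (j' \o r)%VF = (u \o j)%VF].
Proof.
move=> pP s s' gf; have /limg_surjP sp' := ses_surj s'.
have [u [gu uE]] := pP _ _ _ _ (ses_out s') sp' (ghom_comp gf (ses_out s)).
have [|r [gr rE]] := factor_inj (ses_in s') (ses_inj s') (ghom_comp gu (ses_in s)).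
  move=> x; apply/(ses_ex s').
  by rewrite lfE -(comp_lfunE p') uE lfE (ses_comp0 _ s) linear0.
by exists u, r.
Qed.

Section Class.
Variable C : gmod A -> Prop.
Hypothesis tC : thick C.
Hypothesis CV : C (Vmod A).

(** Projectives are zero objects, hence summands of V. *)
Lemma C_gproj Q : gprojective Q -> C Q.
Proof.
move=> pQ; apply: (thick_summand tC (gproj_CM hA pQ) (Vmod_CM hA) _ CV).
exists (dpr2 Q (Vmod A)); split; first exact: dpr2_ghom.
exists (din2 Q (Vmod A)); split; first exact: din2_ghom.
  exists Q, (dpr1 Q (Vmod A)), (- din1 Q (Vmod A)).
  split=> //; [exact: dpr1_ghom|exact: ghomN (din1_ghom _ _)|].
  apply/lfunP => z; rewrite !lfE dpr1E dpr2E [X in _ - X = _](dsumE z).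
  by rewrite opprD addrCA subrr addr0.
suff -> : (dpr2 Q (Vmod A) \o din2 Q (Vmod A))%VF = \1%VF by exact: stably_eq_refl.
by apply/lfunP => x; rewrite !lfE din2E dpr2E.
Qed.

Lemma C_summandl X Y : CM X -> CM Y -> C (gdsum X Y) -> C X.
Proof.
move=> cX cY; apply: (thick_summand tC cX cY).
by exists \1%VF; exact: stable_iso_id.
Qed.

Lemma C_summandr X Y : CM X -> CM Y -> C (gdsum X Y) -> C Y.
Proof.
move=> cX cY; apply: (thick_summand tC cY cX).
have sw U W : ghom (dpair (dpr2 U W) (dpr1 U W) : 'Hom(gdsum U W, gdsum W U)).
  by apply: dpair_ghom; [exact: dpr2_ghom|exact: dpr1_ghom].
have swE U W : (dpair (dpr2 W U) (dpr1 W U) \o dpair (dpr2 U W) (dpr1 U W))%VF = \1%VF.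
  by apply/lfunP => -[x y]; rewrite !lfE !dpairE dpr1E dpr2E dpr1E dpr2E.
exists (dpair (dpr2 Y X) (dpr1 Y X)); split; first exact: sw.
exists (dpair (dpr2 X Y) (dpr1 X Y)); split; first exact: sw.
  by rewrite swE; exact: stably_eq_refl.
by rewrite swE; exact: stably_eq_refl.
Qed.

(** A short exact sequence of Cohen-Macaulay modules is a triangle: pushing it
    out along the embedding of [X] into a projective gives a standard triangle
    whose third term [W] is an extension of [Z] by a projective. This extension
    splits because [Z] is Cohen-Macaulay, so [W] and [Z] are stably
    isomorphic. *)
Lemma C_ses X Y Z (a : 'Hom(X, Y)) (b : 'Hom(Y, Z)) :
  CM X -> CM Y -> CM Z -> ses a b ->
  [/\ C X -> C Y -> C Z, C Y -> C Z -> C X & C X -> C Z -> C Y].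
Proof.
move=> cX cY cZ sab; have [s] := CM_suspension hA cX.
have [ga gb] := (ses_in sab, ses_out sab).
have /sesP ss := susp_exact s; have pI := @susp_projP K A X s.
have [gi go] := (ses_in ss, ses_out ss).
(* W is the pushout, with projection q to Z; f splits q. *)
have gd := dpair_ghom ga (ghomN gi).
have [W [c [gc sc kc]]] := gcokernel gd.
have c0 x : c (a x, - susp_in s x) = 0.
  by apply/kc; exists x; rewrite dpairE !lfE.
have [v' [t [gv' gt cE]]] : exists (v' : 'Hom(Y, W)) (t : 'Hom(susp_proj s, W)),
    [/\ ghom v', ghom t & forall y p, c (y, p) = v' y + t p].
  exists (c \o din1 _ _)%VF, (c \o din2 _ _)%VF; split.
  - exact: ghom_comp gc (din1_ghom _ _).
  - exact: ghom_comp gc (din2_ghom _ _).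
  by move=> y p; rewrite !lfE -linearD [in LHS](dsumE (y, p)).
have vt x : v' (a x) = t (susp_in s x).
  by apply/eqP; rewrite -subr_eq0 -linearN -cE c0.
have [|w' [gw' w'E]] := factor_surj gc sc (dcopair_ghom (ghom0 Y (susp_obj s)) go).
  move=> y /kc[x ->]; rewrite dpairE dcopairE !lfE add0r linearN.
  by rewrite /= (ses_comp0 _ ss) oppr0.
have {}w'E y p : w' (v' y + t p) = susp_out s p.
  by rewrite -cE -comp_lfunE w'E dcopairE !lfE add0r.
have [|q [gq qE]] := factor_surj gc sc (dcopair_ghom gb (ghom0 (susp_proj s) Z)).
  by move=> y /kc[x ->]; rewrite dpairE dcopairE !lfE (ses_comp0 _ sab) addr0.
have {}qE y p : q (v' y + t p) = b y.
  by rewrite -cE -comp_lfunE qE dcopairE !lfE addr0.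
have qv y : q (v' y) = b y by rewrite -[v' y]addr0 -[X in _ + X](linear0 t) qE.
have qt p : q (t p) = 0 by rewrite -[t p]add0r -[X in X + _](linear0 v') qE linear0.
have wv y : w' (v' y) = 0.
  by rewrite -[v' y]addr0 -[X in _ + X](linear0 t) w'E linear0.
have wt p : w' (t p) = susp_out s p.
  by rewrite -[t p]add0r -[X in X + _](linear0 v') w'E.
have ex w : exists y p, w = v' y + t p.
  by have [[y p] <-] := sc w; exists y, p; rewrite cE.
have vtx y p : v' y = t p -> exists x, y = a x /\ p = susp_in s x.
  move=> /eqP; rewrite -subr_eq0 -linearN -cE => /eqP/kc[x].
  rewrite dpairE !lfE => -[-> e]; exists x; split=> //.
  by apply: oppr_inj.
have stq : ses t q.
  split=> //.
  - apply/lker0_injP/eqP; rewrite -subv0; apply/subvP => p.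
    rewrite memv_ker memv0 => /eqP tp.
    have [|x [x0 ->]] := @vtx 0 p; first by rewrite tp linear0.
    have -> : x = 0 by apply: (ses_inj sab); rewrite -x0 linear0.
    by rewrite linear0.
  - move=> w; split=> [qw|[p ->] //].
    have [y [p wE]] := ex w; move: qw; rewrite wE qE => /(ses_ex sab)[x ->].
    by exists (susp_in s x + p); rewrite linearD /= vt.
  by move=> z; have [y <-] := ses_surj sab z; exists (v' y).
have [r [gr rE]] := CM_extends cZ stq pI (ghom1 _).
have rt p : r (t p) = p by rewrite -comp_lfunE rE lfE.
have [|f [gf fE]] := factor_surj gq (ses_surj stq) (ghomB (ghom1 W) (ghom_comp gt gr)).
  by move=> w /(ses_ex stq)[p ->]; rewrite !lfE rt subrr.
have fq w : f (q w) = w - t (r w) by rewrite -comp_lfunE fE !lfE.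
have qf z : q (f z) = z.
  by have [w <-] := ses_surj stq z; rewrite fq linearB /= qt subr0.
have cW : CM W.
  apply: CM_sub (dpair_ghom gq gr) _ (CM_dsum hA cZ (gproj_CM hA pI)) => //.
  move=> w w'' ; rewrite !dpairE => -[qq rr].
  have := fq w; rewrite qq fq rr => /eqP.
  by rewrite (inj_eq (addIr _)) => /eqP.
have tsz M (g : 'Hom(M, W)) : ghom g -> stably_zero (t \o (r \o g))%VF.
  move=> gg; exists (susp_proj s), (r \o g)%VF, t.
  by split=> //; exact: ghom_comp.
suff dist : distinguished a b (w' \o f)%VF by exact: (thick_triangle tC cX cY cZ dist).
split; first by split=> //; exact: ghom_comp.
exists X, Y, W, s, a, v', w', \1%VF, \1%VF, f, \1%VF; split.
- split=> //; split=> //; exists t; split=> //.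
  + by apply/lfunP => x; rewrite lfE vt lfE.
  + by split; apply/lfunP => x; rewrite lfE ?wv ?wt ?lfE.
- split; [exact: stable_iso_id|exact: stable_iso_id| |].
    split=> //; exists q; split=> //.
      suff -> : (q \o f)%VF = \1%VF by exact: stably_eq_refl.
      by apply/lfunP => z; rewrite !lfE qf.
    rewrite /stably_eq; have := tsz _ _ (ghomN (ghom1 W)).
    congr stably_zero; apply/lfunP => w; rewrite !lfE fq !linearN /=.
    by rewrite addrAC subrr add0r.
  split; first exact: ghom1.
  exists \1%VF; split; first exact: ghom1.
    by rewrite comp_lfun1l comp_lfun1r.
  by rewrite comp_lfun1l comp_lfun1r.
- by rewrite comp_lfun1l comp_lfun1r; exact: stably_eq_refl.
- rewrite comp_lfun1r /stably_eq; have := tsz _ _ gv'.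
  congr stably_zero; apply/lfunP => y.
  by rewrite !lfE -qv fq opprB addrC subrK.
by rewrite comp_lfun1l; exact: stably_eq_refl.
Qed.

(** The preimage of [C] in the category of all graded modules, under the functor
    to the stable category (the singularity category) that sends a module to
    its first syzygy, shifted back. Syzygies over a 1-Iwanaga-Gorenstein algebra
    are Cohen-Macaulay, so one step suffices; replacing [C] with this class
    allows arguments with truncations, which leave Cohen-Macaulay modules. *)
Definition syz_in M : Prop :=
  forall X P (j : 'Hom(X, P)) (p : 'Hom(P, M)), gprojective P -> ses j p -> C X.

Lemma syz_CM X P M (j : 'Hom(X, P)) (p : 'Hom(P, M)) :
  gprojective P -> ses j p -> CM X.
Proof. by move=> pP s; apply: (CM_sub hA (ses_in s) (ses_inj s)); apply: gproj_CM. Qed.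

(** Schanuel's lemma: comparison maps between two presentations compose, on
    syzygies, to the identity up to a map through a projective. *)
Lemma syz_in_of M X P (j : 'Hom(X, P)) (p : 'Hom(P, M)) :
  gprojective P -> ses j p -> C X -> syz_in M.
Proof.
move=> pP s CX X' P' j' p' pP' s'.
have half Y Q (k : 'Hom(Y, Q)) (q : 'Hom(Q, M)) Y' Q' (k' : 'Hom(Y', Q')) (q' : 'Hom(Q', M))
    (u : 'Hom(Q, Q')) (r : 'Hom(Y, Y')) (u' : 'Hom(Q', Q)) (r' : 'Hom(Y', Y)) :
    gprojective Q -> ses k q -> ses k' q' -> ghom u -> ghom u' ->
    (q' \o u)%VF = (\1 \o q)%VF -> (q \o u')%VF = (\1 \o q')%VF ->
    (k' \o r)%VF = (u \o k)%VF -> (k \o r')%VF = (u' \o k')%VF ->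
    stably_eq (r' \o r)%VF \1%VF.
  move=> pQ sk sk' gu gu' uE u'E rE r'E.
  have guu := ghomB (ghom_comp gu' gu) (ghom1 Q).
  have [|w [gw wE]] := factor_inj (ses_in sk) (ses_inj sk) guu.
    move=> x; apply/(ses_ex sk); rewrite !lfE linearB /= -(comp_lfunE q) u'E !lfE.
    by rewrite -(comp_lfunE q') uE !lfE subrr.
  exists Q, k, w; split=> //; first exact: ses_in sk.
  apply/lfunP => y; apply: (ses_inj sk).
  rewrite (comp_lfunE w) -(comp_lfunE k w) wE !lfE linearB /= -(comp_lfunE k) r'E lfE.
  by rewrite -(comp_lfunE k') rE lfE.
have [u [r [gu gr uE rE]]] := lift_ses pP s s' (ghom1 M).
have [u' [r' [gu' gr' u'E r'E]]] := lift_ses pP' s' s (ghom1 M).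
apply: (thick_iso tC (syz_CM pP' s') _ CX).
exists r; split=> //; exists r'; split=> //.
  exact: (half _ _ j p _ _ j' p' u r u' r').
exact: (half _ _ j' p' _ _ j p u' r' u r).
Qed.

Lemma syz_presentation M :
  exists X P (j : 'Hom(X, P)) (p : 'Hom(P, M)), gprojective P /\ ses j p.
Proof.
have [P X j p fP s] := free_presentation_exists M.
by exists X, P, j, p; split=> //; apply: gfree_gproj fP.
Qed.

(** A Cohen-Macaulay module is the suspension of its first syzygy. *)
Lemma syz_in_CM M : CM M -> (syz_in M <-> C M).
Proof.
move=> cM; have [X [P [j [p [pP s]]]]] := syz_presentation M.
have /sesP sh := s.
have := thick_shift tC (Suspension pP cM sh) (syz_CM pP s) => /= e.
split=> [hM|/e CX]; last exact: (syz_in_of pP s CX).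
by apply/e; apply: hM s.
Qed.

Lemma syz_in_gproj Q : gprojective Q -> syz_in Q.
Proof. by move=> pQ; apply/syz_in_CM; [exact: gproj_CM|exact: C_gproj]. Qed.

Lemma syz_in_pd1 P1 P0 M (f : 'Hom(P1, P0)) (g : 'Hom(P0, M)) :
  gprojective P1 -> gprojective P0 -> ses f g -> syz_in M.
Proof. by move=> pP1 pP0 s; apply: (syz_in_of pP0 s); apply: C_gproj. Qed.

(** The sum of presentations of [M] and of its complement presents [N]. *)
Lemma syz_in_retract M N : retract M N -> syz_in N -> syz_in M.
Proof.
move=> [i [r [gi gr ri]]] hN.
have ii : injective i by move=> x y xy; rewrite -[x]ri xy ri.
have [M' [c sc]] := ses_of_inj gi ii.
have gh := dpair_ghom gr (ses_out sc).
have dpi : injective (dpair r c).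
  apply/lker0_injP/eqP; rewrite -subv0; apply/subvP => x.
  rewrite memv_ker memv0 dpairE => /eqP[rx /(ses_ex sc)[m xm]].
  by move: rx; rewrite xm ri => ->; rewrite linear0.
have [|h [ghh _ hE]] := ghom_inv gh dpi.
  move=> [m z]; have [n nz] := ses_surj sc z.
  exists (n + i (m - r n)).
  rewrite dpairE (linearD r) (linearD c) /= ri (ses_comp0 _ sc) addr0 nz.
  by rewrite addrC subrK.
have hK z : dpair r c (h z) = z by rewrite -comp_lfunE hE lfE.
have ih : injective h by move=> x y xy; rewrite -[x]hK xy hK.
have [X [P [j [p [pP s]]]]] := syz_presentation M.
have [X' [P' [j' [p' [pP' s']]]]] := syz_presentation M'.
have sd := ses_dsum s s'.
suff : C (gdsum X X').
  move/C_summandl => hX; apply: (syz_in_of pP s).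
  by apply: hX; [exact: syz_CM s|exact: syz_CM s'].
apply: (hN _ _ (dmap j j') (h \o dmap p p')%VF); first exact: gdsum_gproj.
split.
- exact: ses_in sd.
- exact: ghom_comp ghh (ses_out sd).
- exact: ses_inj sd.
- move=> y; rewrite -(ses_ex sd) lfE; split=> [|->]; last by rewrite linear0.
  by rewrite -[X in _ = X](linear0 h) => /ih.
move=> n; have [y yE] := ses_surj sd (dpair r c n).
by exists y; apply: dpi; rewrite lfE yE hK.
Qed.

(** By the horseshoe lemma, syzygies of the terms of a short exact sequence form
    a short exact sequence of Cohen-Macaulay modules, that is, a triangle. *)
Lemma syz_in_ses M N L (f : 'Hom(M, N)) (g : 'Hom(N, L)) : ses f g ->
  [/\ syz_in M -> syz_in N -> syz_in L, syz_in N -> syz_in L -> syz_in M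
    & syz_in M -> syz_in L -> syz_in N].
Proof.
move=> sfg.
have [X [P [j [p [pP sj]]]]] := syz_presentation M.
have [Z [Q [k [q [pQ sk]]]]] := syz_presentation L.
have [gf gg] := (ses_in sfg, ses_out sfg); have [gp gq] := (ses_out sj, ses_out sk).
have /limg_surjP sg := ses_surj sfg.
have [t [gt tE]] := pQ _ _ _ _ gg sg gq.
have {}tE x : g (t x) = q x by rewrite -comp_lfunE tE.
pose r := dcopair (f \o p)%VF t.
have rE x y : r (x, y) = f (p x) + t y by rewrite /r dcopairE !lfE.
have gr : ghom r by apply: dcopair_ghom gt; apply: ghom_comp.
have sr n : exists z, r z = n.
  have [y ye] := ses_surj sk (g n).
  have [m me] : exists m, n - t y = f m.
    by apply/(ses_ex sfg); rewrite linearB /= tE ye subrr.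
  by have [x xe] := ses_surj sj m; exists (x, y); rewrite rE xe -me subrK.
have [Y [l sl]] := ses_of_surj gr sr.
have pPQ : gprojective (gdsum P Q) by exact: gdsum_gproj.
have [|a [ga aE]] := factor_inj (ses_in sl) (ses_inj sl)
    (ghom_comp (din1_ghom P Q) (ses_in sj)).
  move=> x; apply/(ses_ex sl); rewrite lfE din1E rE (ses_comp0 _ sj) !linear0.
  by rewrite addr0.
have {}aE x : l (a x) = (j x, 0) by rewrite -comp_lfunE aE lfE din1E.
have rg z : g (r z) = q z.2.
  by case: z => x y; rewrite rE linearD /= (ses_comp0 _ sfg) add0r tE.
have [|b [gb bE]] := factor_inj (ses_in sk) (ses_inj sk)
    (ghom_comp (dpr2_ghom P Q) (ses_in sl)).
  by move=> y; apply/(ses_ex sk); rewrite lfE dpr2E -rg (ses_comp0 _ sl) linear0.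
have {}bE y : k (b y) = (l y).2 by rewrite -comp_lfunE bE lfE dpr2E.
have sab : ses a b.
  split=> //.
  - move=> x x' xx; apply: (ses_inj sj).
    by have := aE x; rewrite xx aE => -[].
  - move=> y; split=> [by0|[x ->]]; last first.
      by apply: (ses_inj sk); rewrite bE aE linear0.
    have ly2 : (l y).2 = 0 by rewrite -bE by0 linear0.
    have lyE : l y = ((l y).1, 0) by rewrite -ly2 -surjective_pairing.
    have : r (l y) = 0 by exact: ses_comp0 sl.
    rewrite lyE rE linear0 addr0 -[X in _ = X](linear0 f) => /(ses_inj sfg).
    move=> /(ses_ex sj)[x xe]; exists x; apply: (ses_inj sl).
    by rewrite aE lyE xe.
  move=> z; have [m me] : exists m, t (k z) = f m.
    by apply/(ses_ex sfg); rewrite tE (ses_comp0 _ sk).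
  have [x xe] := ses_surj sj m.
  have [y ye] : exists y, (- x, k z) = l y.
    by apply/(ses_ex sl); rewrite rE !linearN /= xe me addNr.
  by exists y; apply: (ses_inj sk); rewrite bE -ye.
have [h1 h2 h3] := C_ses (syz_CM pP sj) (syz_CM pPQ sl) (syz_CM pQ sk) sab.
split=> [hM hN|hN hL|hM hL].
- by apply: (syz_in_of pQ sk); apply: h1; [apply: hM sj|apply: hN sl].
- by apply: (syz_in_of pP sj); apply: h2; [apply: hN sl|apply: hL sk].
by apply: (syz_in_of pPQ sl); apply: h3; [apply: hM sj|apply: hL sk].
Qed.

(** Up to the top degree of [A], these modules are the summands of V; beyond
    it, they are zero. *)
Lemma syz_in_trunc n : (0 < n)%N -> syz_in (gtrunc (Ash A n%:Z) 0).
Proof.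
move=> n0; case: (leqP n (galg_top A)) => [n_top|top_n]; last first.
  apply: syz_in_gproj; apply: zero_gproj => i.
  case: (leP 0 i) => [|/trunc_deg_lt //]; case: i => // i _.
  apply: trunc_deg0; rewrite -[LHS]/(regular_deg A (i%:Z + n%:Z)) -PoszD.
  by apply: galg_out; apply: leq_trans top_n _; rewrite leq_addl.
have cT : CM (gtrunc (Ash A n%:Z) 0).
  apply: torsionless_CM => //; exists (Ash A n%:Z), (trunc_in _ 0).
  split; [exact: Ash_gproj|exact: trunc_in_ghom|exact: trunc_in_inj].
apply/syz_in_CM => //.
have : n \in iota 1 (galg_top A) by rewrite mem_iota n0.
have : C (Vsum A (iota 1 (galg_top A))) by exact: CV.
elim: (iota _ _) => // m l IH Cl.
have cT' : CM (gtrunc (Ash A m%:Z) 0).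
  apply: torsionless_CM => //; exists (Ash A m%:Z), (trunc_in _ 0).
  split; [exact: Ash_gproj|exact: trunc_in_ghom|exact: trunc_in_inj].
rewrite inE => /orP[/eqP->|nl]; first exact: C_summandl cT' (Vsum_CM hA l) Cl.
by apply: IH nl; exact: C_summandr cT' (Vsum_CM hA l) Cl.
Qed.

End Class.

End Thick.

(** * Modules concentrated in one degree *)

Section Concentrated.
Variables (K : fieldType) (A : graded_alg K).
Implicit Types M N P Q X Y Z I J L : gmod A.

Definition concentrated (b : int) M : Prop := forall j, j != b -> gm_deg M j = 0%VS.

Lemma conc_gpr b M (x : M) : concentrated b M -> gpr M b x = x.
Proof.
move=> cM; apply: gpr_eq => j; rewrite gprK; case: eqP => [->//|/eqP jb].
by rewrite (deg0_eq0 (cM j jb) (gpr_in j x)).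
Qed.

Lemma conc_mem b M (x : M) : concentrated b M -> x \in gm_deg M b.
Proof. by move=> cM; rewrite mem_gpr conc_gpr. Qed.

Lemma conc_inj b X Y (j : 'Hom(X, Y)) :
  ghom j -> injective j -> concentrated b Y -> concentrated b X.
Proof. by move=> gj ij cY i ib; apply: deg0_inj gj ij (cY i ib). Qed.

Lemma conc_surj b X Y (p : 'Hom(X, Y)) :
  ghom p -> (forall y, exists x, p x = y) -> concentrated b X -> concentrated b Y.
Proof. by move=> gp sp cX i ib; apply: deg0_surj gp sp (cX i ib). Qed.

Lemma conc_kill b X Q (f : 'Hom(X, Q)) x :
  ghom f -> concentrated b Q -> gpr X b x = 0 -> f x = 0.
Proof. by move=> gf cQ x0; rewrite -[f x](conc_gpr _ cQ) -(ghom_gpr _ _ gf) x0 linear0. Qed.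

Lemma conc_act b M (x : M) j (a : A) :
  concentrated b M -> (0 < j)%N -> a \in galg_deg A j -> ract x a = 0.
Proof.
move=> cM j0 aj; have := gm_act (conc_mem x cM) aj.
by move/deg0_eq0; apply; apply: cM; lia.
Qed.

Definition deg0_proj (a : A) : galg0 A :=
  vsproj (ASpace (galg_deg0_aspace A)) (gpr (regular_gmod A) 0 a).

Lemma deg0_projE a : vsval (deg0_proj a) = gpr (regular_gmod A) 0 a.
Proof. by rewrite vsprojK // (gpr_in (X := regular_gmod A)). Qed.

Lemma deg0_proj_linear : linear deg0_proj.
Proof. by move=> k x y; rewrite /deg0_proj !linearP. Qed.

Lemma deg0_projK (x : galg0 A) : deg0_proj (vsval x) = x.
Proof.
apply: subvs_inj; rewrite deg0_projE gpr_id //.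
exact: (subvsP x).
Qed.

Lemma deg0_proj_pos j a : (0 < j)%N -> a \in galg_deg A j -> deg0_proj a = 0.
Proof.
move=> j0 aj; apply: subvs_inj; rewrite deg0_projE.
rewrite (@gpr_deg K A (regular_gmod A) 0 j%:Z) //.
by case: j j0 {aj}.
Qed.

Lemma deg0_proj0 a : a \in galg_deg A 0 -> vsval (deg0_proj a) = a.
Proof. by move=> a0; rewrite deg0_projE gpr_id. Qed.

Lemma deg0_proj1 : deg0_proj 1 = 1.
Proof.
apply: subvs_inj; rewrite deg0_proj0 ?galg_1 //.
apply/esym/eqP; rewrite -[vsval 1]/(algid (ASpace (galg_deg0_aspace A))).
by rewrite algid_eq1 galg_1.
Qed.

(** Degrees are nonnegative, so a product has degree zero only through the
    degree zero parts: the projection is a morphism of algebras. *)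
Lemma deg0_projM a b : deg0_proj (a * b) = deg0_proj a * deg0_proj b.
Proof.
elim/galg_ind: b => [|b c|j b bj].
- rewrite mulr0 (_ : deg0_proj 0 = 0) ?mulr0 //.
  by apply: subvs_inj; rewrite deg0_projE linear0.
- have D x y : deg0_proj (x + y) = deg0_proj x + deg0_proj y.
    by have := deg0_proj_linear 1 x y; rewrite !scale1r.
  by move=> e1 e2; rewrite mulrDr !D e1 e2 mulrDr.
apply: subvs_inj; rewrite deg0_projE.
have [j0|j0] := posnP j; last first.
  rewrite (deg0_proj_pos j0 bj) mulr0.
  have := gpr_act (X := regular_gmod A) (- j%:Z) a bj; rewrite addNr => ->.
  rewrite gpr_out ?ract0l //; apply/negP => /mapP[n _].
  by case: j j0 {bj}.
have b0 : b \in galg_deg A 0 by rewrite -j0.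
have := gpr_act (X := regular_gmod A) 0 a b0; rewrite addr0 => ->.
by rewrite /= deg0_projE deg0_proj0.
Qed.

Section Restrict.
Variable M : gmod A.

Let R_ract (m : M) (x : galg0 A) : M := ract m (vsval x).
Let R_linearl x : linear (R_ract^~ x).
Proof. exact: ract_linearl. Qed.
Let R_linearr m : linear (R_ract m).
Proof. by move=> k x y; rewrite /R_ract linearP ract_linearr. Qed.
Let R_ractM m x y : R_ract m (x * y) = R_ract (R_ract m x) y.
Proof. by rewrite /R_ract -ractM. Qed.
Let R_ract1 m : R_ract m 1 = m.
Proof.
rewrite /R_ract (_ : vsval (1 : galg0 A) = 1) ?ract1 //.
by rewrite -deg0_proj1 deg0_proj0 // galg_1.
Qed.

Definition restrict : rmod (galg0 A) :=
  @RMod K (galg0 A) M R_ract R_linearl R_linearr R_ractM R_ract1.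

Lemma restrictE (m : M) (x : galg0 A) :
  ract (m : restrict) x = ract m (vsval x).
Proof. by []. Qed.

End Restrict.

Section Inflate.
Variables (L : rmod (galg0 A)) (b : int).

Let F_ract (m : L) (a : A) : L := ract m (deg0_proj a).
Let F_linearl a : linear (F_ract^~ a).
Proof. exact: ract_linearl. Qed.
Let F_linearr m : linear (F_ract m).
Proof. by move=> k x y; rewrite /F_ract deg0_proj_linear ract_linearr. Qed.
Let F_ractM m x y : F_ract m (x * y) = F_ract (F_ract m x) y.
Proof. by rewrite /F_ract deg0_projM ractM. Qed.
Let F_ract1 m : F_ract m 1 = m.
Proof. by rewrite /F_ract deg0_proj1 ract1. Qed.

Let F_rmod : rmod A := @RMod K A L F_ract F_linearl F_linearr F_ractM F_ract1.

Let F_pr (i : int) : 'End(F_rmod) := if i == b then \1%VF else 0.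
Let F_prE i x : F_pr i x = if i == b then x else 0.
Proof. by rewrite /F_pr; case: eqP => _; rewrite lfE. Qed.
Let F_pr_out i x : i \notin [:: b] -> F_pr i x = 0.
Proof. by rewrite inE F_prE => /negPf->. Qed.
Let F_pr_sum x : \sum_(i <- [:: b]) F_pr i x = x.
Proof. by rewrite big_seq1 F_prE eqxx. Qed.
Let F_prK i j x : F_pr i (F_pr j x) = if i == j then F_pr j x else 0.
Proof.
rewrite !F_prE; case: (eqVneq j b) => [->|jb]; first by [].
by rewrite !if_same.
Qed.
Let F_pr_act i j (x : F_rmod) a : a \in galg_deg A j ->
  F_pr (i + j%:Z) (ract x a) = ract (F_pr i x) a.
Proof.
move=> aj; have [j0|j0] := posnP j.
  rewrite j0 addr0 !F_prE; case: eqP => // _; by rewrite ract0l.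
rewrite !F_prE -![ract _ a]/(F_ract _ a) /F_ract (deg0_proj_pos j0 aj) !ract0r.
by rewrite if_same.
Qed.

Definition inflate : gmod A :=
  gmod_of_pr (s := [:: b]) isT F_pr_out F_pr_sum F_prK F_pr_act.

Lemma inflate_conc : concentrated b inflate.
Proof. by move=> j jb; apply: gm_out; rewrite inE. Qed.

Lemma inflateE (m : L) (a : A) :
  ract (m : inflate) a = ract m (deg0_proj a).
Proof. by []. Qed.

End Inflate.

Lemma conc_ghom b M N (f : 'Hom(M, N)) :
  concentrated b M -> concentrated b N -> rhom f -> ghom f.
Proof.
move=> cM cN hf; split=> // i m mi; case: (eqVneq i b) => [->|ib].
  exact: conc_mem.
by rewrite (deg0_eq0 (cM i ib) mi) linear0 mem0v.
Qed.

Lemma inflate_ghom b (L L' : rmod (galg0 A)) (f : 'Hom(L, L')) :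
  rhom f -> @ghom K A (inflate L b) (inflate L' b) f.
Proof.
move=> hf; apply: (conc_ghom (b := b)); [exact: inflate_conc|exact: inflate_conc|].
by move=> m a; rewrite !inflateE hf.
Qed.

Lemma inflate_restrict_ghom b (L : rmod (galg0 A)) M (f : 'Hom(L, restrict M)) :
  concentrated b M -> rhom f -> @ghom K A (inflate L b) M f.
Proof.
move=> cM hf; apply: (conc_ghom (b := b)) => //; first exact: inflate_conc.
move=> m a; rewrite inflateE hf restrictE.
elim/galg_ind: a => [|a c|j a aj].
- rewrite ract0r (_ : deg0_proj 0 = 0) ?ract0r //.
  by apply: subvs_inj; rewrite deg0_projE linear0.
- have D x y : deg0_proj (x + y) = deg0_proj x + deg0_proj y.
    by have := deg0_proj_linear 1 x y; rewrite !scale1r.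
  by move=> e1 e2; rewrite D linearD !ractDr e1 e2.
have [j0|j0] := posnP j; last first.
  by rewrite (deg0_proj_pos j0 aj) (conc_act _ cM j0 aj) linear0 ract0r.
by rewrite deg0_proj0 // -j0.
Qed.

(** Projectives, injectives and projective dimension in the category of modules
    concentrated in degree [b], which is equivalent to the category of modules
    over [A_0]. *)
Definition eproj b P : Prop := concentrated b P /\
  forall M N (g : 'Hom(M, N)) (f : 'Hom(P, N)), concentrated b M -> concentrated b N ->
    ghom g -> (forall y, exists x, g x = y) -> ghom f ->
    exists h : 'Hom(P, M), ghom h /\ (g \o h)%VF = f.

Definition einj b I : Prop := concentrated b I /\
  forall M N (g : 'Hom(M, N)) (f : 'Hom(M, I)), concentrated b M -> concentrated b N ->
    ghom g -> injective g -> ghom f ->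
    exists h : 'Hom(N, I), ghom h /\ (h \o g)%VF = f.

Inductive epd b : nat -> gmod A -> Prop :=
  | epd0 P : eproj b P -> epd b 0 P
  | epdS n Z P M (j : 'Hom(Z, P)) (p : 'Hom(P, M)) :
      concentrated b M -> eproj b P -> ses j p -> epd b n Z -> epd b n.+1 M.

Lemma eproj_inflate b (P : rmod (galg0 A)) : rprojective P -> eproj b (inflate P b).
Proof.
move=> pP; split=> [|M N g f cM cN gg sg gf]; first exact: inflate_conc.
have hg : @rhom K (galg0 A) (restrict M) (restrict N) g.
  by move=> m x; rewrite !restrictE (ghom_rhom gg).
have hf : @rhom K (galg0 A) P (restrict N) f.
  move=> m x; rewrite restrictE -(ghom_rhom gf m (vsval x)).
  by rewrite inflateE deg0_projK.
have /limg_surjP sg' := sg.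
have [h [hh hE]] := pP _ _ _ _ hg sg' hf.
by exists h; split=> //; apply: inflate_restrict_ghom.
Qed.

Lemma eproj_retract b P Q : retract P Q -> eproj b Q -> eproj b P.
Proof.
move=> [i [r [gi gr ri]]] [cQ pQ].
have ii : injective i by move=> x y xy; rewrite -[x]ri xy ri.
split=> [|M N g f cM cN gg sg gf]; first exact: conc_inj gi ii cQ.
have [h [gh hE]] := pQ _ _ _ _ cM cN gg sg (ghom_comp gf gr).
exists (h \o i)%VF; split; first exact: ghom_comp.
by apply/lfunP => x; rewrite lfE lfE -comp_lfunE hE lfE ri.
Qed.

(** Place in degree [b] an [A_0]-projective resolution of bounded length. *)
Lemma finite_epd : finite_gldim (galg0 A) ->
  exists n, forall b M, concentrated b M -> epd b n M.
Proof.
move=> [n fin]; exists n => b M cM.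
have [P P0] := fin (restrict M).
have E k := eproj_inflate b (@res_proj K (galg0 A) _ P k).
have gd k := inflate_ghom b (@res_dhom K (galg0 A) _ P k).
(* Z is the image of the differential below P k, and m bounds the length of
   the rest of the resolution. *)
have claim m k Z (e : 'Hom(inflate (P k) b, Z)) : concentrated b Z -> ghom e ->
    (forall z, exists x, e x = z) -> (forall x, e x = 0 <-> exists y, x = res_d P k y) ->
    (forall j, (k + m < j)%N -> \dim {:P j} = 0%N) -> epd b m Z.
  elim: m k Z e => [|m IH] k Z e cZ ge se ee dP.
    apply: epd0; apply: eproj_retract (E k).
    have ie : injective e.
      apply/lker0_injP/eqP; rewrite -subv0; apply/subvP => x.
      rewrite memv_ker memv0 => /eqP/ee[y ->].
      have := dP k.+1; rewrite addn0 ltnS leqnn => /(_ isT)/eqP.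
      rewrite dimv_eq0 => /eqP Pk; have := memvf y; rewrite Pk memv0 => /eqP->.
      by rewrite linear0.
    have [h [gh he eh]] := ghom_inv ge ie se.
    exists h, e; split=> // z.
    by move/lfunP/(_ z): eh; rewrite !lfE.
  have [X [i si]] := ses_of_surj ge se.
  apply: (epdS cZ (E k) si).
  have [|e' [ge' e'E]] := factor_inj (ses_in si) (ses_inj si) (gd k).
    by move=> x; apply/(ses_ex si)/ee; exists x.
  have {}e'E x : i (e' x) = res_d P k x by rewrite -comp_lfunE e'E.
  apply: (IH k.+1 X e') => //.
  - exact: conc_inj (ses_in si) (ses_inj si) (@inflate_conc (P k) b).
  - move=> x; have [y ye] : exists y, i x = res_d P k y.
      by apply/ee; exact: ses_comp0 si.
    by exists y; apply: (ses_inj si); rewrite e'E ye.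
  - have /limg_lkerP ex := res_exactS P k.
    move=> x; rewrite -ex -e'E; split=> [->|]; first exact: linear0.
    by rewrite -[X in _ = X](linear0 i) => /(ses_inj si).
  by move=> j; rewrite addSnnS; apply: dP.
apply: (claim n 0%N M (res_aug P)) => //.
- exact: inflate_restrict_ghom cM (@res_aughom K (galg0 A) _ P).
- exact/limg_surjP/(res_surj P).
- exact/limg_lkerP/(res_exact0 P).
Qed.

End Concentrated.

(** * Generation by V *)

Section Generation.
Variables (K : fieldType) (A : graded_alg K).
Hypothesis hA : iwanaga_gorenstein 1 A.
Hypothesis fin : finite_gldim (galg0 A).
Implicit Types M N P Q X Y Z I J L : gmod A.

(** [D] is the class of modules sent into a given thick subcategory, known
    through its closure properties. Two dissections by degree show that [D]
    contains every module: the parts in negative degrees come from the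
    truncations of the A(n), and the others from injectives, which have finite
    projective dimension. *)
Variable D : gmod A -> Prop.
Hypothesis D_gproj : forall P, gprojective P -> D P.
Hypothesis D_pd1 : forall P1 P0 M (f : 'Hom(P1, P0)) (g : 'Hom(P0, M)),
  gprojective P1 -> gprojective P0 -> ses f g -> D M.
Hypothesis D_retract : forall M N, retract M N -> D N -> D M.
Hypothesis D_ses : forall M N L (f : 'Hom(M, N)) (g : 'Hom(N, L)), ses f g ->
  [/\ D M -> D N -> D L, D N -> D L -> D M & D M -> D L -> D N].
Hypothesis D_trunc : forall n, (0 < n)%N -> D (gtrunc (Ash A n%:Z) 0).

Definition within (a b : int) M : Prop :=
  forall j, (j < a) || (b <= j) -> gm_deg M j = 0%VS.

Lemma trunc_conc b M : (forall j, b < j -> gm_deg M j = 0%VS) -> concentrated b (gtrunc M b).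
Proof.
move=> M0 j jb; case: (ltP j b) => [|bj]; first exact: trunc_deg_lt.
by apply/trunc_deg0/M0; rewrite lt_neqAle eq_sym jb.
Qed.

(** The quotient [T'] = A(i + 1)_{< 0} of a projective by a truncation is in [D].
    It lives in the degrees from [a] to [-1], so that removing the part
    above degree [a], which is in [D] by assumption, leaves its part [T] in
    degree [a], a copy of [A_0]. Sums of copies of [T] cover the modules
    concentrated in degree [a]. *)
Lemma D_eproj_neg (i : nat) Q :
  (forall M, within (- i%:Z) 0 M -> D M) -> eproj (- (i.+1)%:Z) Q -> D Q.
Proof.
move=> Di [cQ pQ]; set a : int := - (i.+1)%:Z in cQ pQ *.
have aE : a + 1 = - i%:Z by rewrite /a; lia.
set X := Ash A (i.+1)%:Z.
have X0 j : j < a -> gm_deg X j = 0%VS.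
  rewrite /X /= /gshift_deg /a => ja.
  by case e: (j + _) => [n|n] //; lia.
have [T' [p' [sp' T'0]]] := trunc_ses X 0.
have DT' : D T'.
  have [h _ _] := D_ses sp'.
  by apply: h; [exact: D_trunc|apply/D_gproj/Ash_gproj].
have [T [p [sp T0]]] := trunc_ses T' (a + 1).
have DT : D T.
  have [h _ _] := D_ses sp; apply: h => //.
  apply: Di => j; rewrite -aE => /orP[/trunc_deg_lt //|j0].
  by apply: trunc_deg0; apply: T'0; left.
have cT : concentrated a T.
  move=> j ja; apply: T0; case: (leP (a + 1) j) => [|j1]; [by left|right].
  by apply: T'0; right; apply: X0; lia.
have DD M N : D M -> D N -> D (gdsum M N).
  by move=> DM DN; have [_ _ h] := D_ses (ses_split M N); apply: h.
have [||j x xj|G [f [[DG cG] gf sf]]] := @cover_by K A (fun G => D G /\ concentrated a G) Q.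
- by split=> //; apply/D_gproj/gzero_gproj.
- move=> M N [DM cM] [DN cN]; split; first exact: DD.
  by move=> j ja; apply: gdsum_deg0; [apply: cM|apply: cN].
- case: (eqVneq j a) => [ja|ja]; last first.
    exists (gzero A), 0; split; [split=> //; apply/D_gproj/gzero_gproj|exact: ghom0|].
    by exists 0; rewrite linear0 (deg0_eq0 (cQ _ ja) xj).
  have gx : @ghom K A X Q (ractl x) by have := ractl_ghom xj; rewrite ja /a opprK.
  pose h1 : 'Hom(T', Q) := (ractl x \o p'^-1)%VF.
  have [e1 gh1] : (h1 \o p')%VF = ractl x /\ ghom h1.
    have k1 y : p' y = 0 -> (ractl x : 'Hom(X, Q)) y = 0.
      move=> /(ses_ex sp')[z ->]; apply: (conc_kill gx cQ).
      have /mem_trunc := subvsP (z : subvs_of (trunc_vs X 0)).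
      by rewrite lfunE; apply; rewrite /a; lia.
    split; first exact: surj_inv_comp.
    have [h [gh hE]] := factor_surj (ses_out sp') (ses_surj sp') gx k1.
    suff -> : h1 = h by [].
    apply/lfunP => t; have [y <-] := ses_surj sp' t.
    by rewrite -!comp_lfunE hE surj_inv_comp.
  pose h2 : 'Hom(T, Q) := (h1 \o p^-1)%VF.
  have [e2 gh2] : (h2 \o p)%VF = h1 /\ ghom h2.
    have k1 y : p y = 0 -> h1 y = 0.
      move=> /(ses_ex sp)[z ->]; apply: (conc_kill gh1 cQ).
      have /mem_trunc := subvsP (z : subvs_of (trunc_vs T' (a + 1))).
      by rewrite lfunE; apply; lia.
    split; first exact: surj_inv_comp.
    have [h [gh hE]] := factor_surj (ses_out sp) (ses_surj sp) gh1 k1.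
    suff -> : h2 = h by [].
    apply/lfunP => t; have [y <-] := ses_surj sp t.
    by rewrite -!comp_lfunE hE surj_inv_comp.
  exists T, h2; split=> //; exists (p (p' (1 : A))).
  by rewrite -(comp_lfunE h2) e2 -(comp_lfunE h1) e1 ractlE ract1.
have [h [gh hE]] := pQ _ _ _ _ cG cQ gf sf (ghom1 Q).
apply: D_retract DG; exists h, f; split=> // x.
by rewrite -comp_lfunE hE lfE.
Qed.

Lemma D_epd b n M : (forall Q, eproj b Q -> D Q) -> epd b n M -> D M.
Proof.
move=> Db; elim=> [P /Db //|{n M} n Z P M j p _ /Db DP s _ DZ].
by have [h _ _] := D_ses s; apply: h.
Qed.

(** Split off the lowest degree, where finite projective dimension over [A_0]
    reduces everything to projectives over [A_0]. *)
Lemma D_within_neg (i : nat) M : within (- i%:Z) 0 M -> D M.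
Proof.
elim: i M => [|i IH] M wM.
  by apply/D_gproj/zero_gproj => j; apply: wM; lia.
set a : int := - (i.+1)%:Z.
have [Z [p [sp Z0]]] := trunc_ses M (a + 1).
have [_ _ h] := D_ses sp; apply: h.
  apply: IH => j /orP[ja|j0]; first by apply: trunc_deg_lt; rewrite /a; lia.
  by apply: trunc_deg0; apply: wM; rewrite j0 orbT.
have [n epdn] := finite_epd fin.
apply: D_epd (epdn a Z _); first by move=> Q; apply: D_eproj_neg.
move=> j ja; apply: Z0; case: (leP (a + 1) j) => [|j1]; [by left|right].
by apply: wM; rewrite /a in ja j1 *; lia.
Qed.

Lemma D_neg M : (forall j, 0 <= j -> gm_deg M j = 0%VS) -> D M.
Proof.
move=> M0; have [n Mn] := gm_bounded M; apply: (@D_within_neg n).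
by move=> j /orP[jn|/M0 //]; apply: Mn; rewrite jn orbT.
Qed.

Inductive cosyzygy b L : nat -> gmod A -> Prop :=
  | cosyzygy0 : cosyzygy b L 0 L
  | cosyzygyS n L' I L'' (i : 'Hom(L', I)) (p : 'Hom(I, L'')) :
      cosyzygy b L n L' -> ses i p -> einj b I -> D I -> cosyzygy b L n.+1 L''.

Lemma cosyzygy_D b L n L' : cosyzygy b L n L' -> D L' -> D L.
Proof.
elim=> [//|{n L'} n L' I L'' i p _ IH s _ DI DL''].
by apply: IH; have [_ h _] := D_ses s; apply: h.
Qed.

Lemma cosyzygy_inv b L n L' : cosyzygy b L n.+1 L' ->
  exists L0 I (i : 'Hom(L0, I)) (p : 'Hom(I, L')),
    [/\ cosyzygy b L n L0, ses i p & einj b I].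
Proof.
move En: n.+1 => m c; case: c En => // k L0 I L'' i p c s iI _ [->].
by exists L0, I, i, p.
Qed.

(** The obstruction is in Ext^1(X, L'), where [L'] is an [n]-th cosyzygy of
    [L]; this is Ext^(n + 1)(X, L) over [A_0]. The induction shifts the
    dimension of [X] down while going back along the cosyzygies. *)
Lemma cosyzygy_lift b L n X : epd b n X ->
  forall L' I L'' (i : 'Hom(L', I)) (p : 'Hom(I, L'')) (f : 'Hom(X, L'')),
  cosyzygy b L n L' -> ses i p -> einj b I -> ghom f ->
  exists h : 'Hom(X, I), ghom h /\ (p \o h)%VF = f.
Proof.
elim=> [P [cP pP]|{n X} n Z P X j q cX [cP pP] sj _ IH] L' I L'' i p f cL' s [cI iI] gf.
  apply: pP gf => //; [|exact: ses_out s|exact: ses_surj s].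
  exact: conc_surj (ses_out s) (ses_surj s) cI.
have cL'' : concentrated b L'' := conc_surj (ses_out s) (ses_surj s) cI.
have [u [gu uE]] := pP _ _ _ _ cI cL'' (ses_out s) (ses_surj s) (ghom_comp gf (ses_out sj)).
apply: (lift_step sj s gf gu uE) => r gr.
have [L0 [I' [i' [p' [cL0 s' eI']]]]] := cosyzygy_inv cL'.
have [r' [gr' r'E]] := IH _ _ _ _ _ _ cL0 s' eI' gr.
have cZ : concentrated b Z := conc_inj (ses_in sj) (ses_inj sj) cP.
have [e [ge eE]] := (proj2 eI') _ _ _ _ cZ cP (ses_in sj) (ses_inj sj) gr'.
exists (p' \o e)%VF; split; first exact: ghom_comp (ses_out s') ge.
by rewrite -comp_lfunA eE.
Qed.

(** The part in degree [b] of an injective module vanishing above [b] is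
    injective among the modules concentrated in degree [b]. *)
Lemma enough_einj b L : (forall M, (forall j, b <= j -> gm_deg M j = 0%VS) -> D M) ->
  concentrated b L -> exists I (i : 'Hom(L, I)), [/\ einj b I, D I, ghom i & injective i].
Proof.
move=> Db cL.
have [|I [P1 [P0 [i [f [g [[iI I0] gi ii [pP1 pP0] sfg]]]]]]] :=
    @enough_ginj K A L b (proj2 hA).
  by move=> j bj; apply: cL; rewrite gt_eqF.
have land M (u : 'Hom(M, I)) : concentrated b M -> ghom u ->
    exists v : 'Hom(M, gtrunc I b), ghom v /\ (trunc_in I b \o v)%VF = u.
  move=> cM gu; apply: (factor_inj (@trunc_in_ghom K A I b) (@trunc_in_inj K A I b) gu).
  move=> x; apply: (trunc_in_img_deg (lexx b)).
  by apply: (proj2 gu); apply: conc_mem.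
have [v [gv vE]] := land _ _ cL gi.
have [Z [p [sp Z0]]] := trunc_ses I b.
exists (gtrunc I b), v; split=> //.
- split=> [|M N w u cM cN gw iw gu]; first exact: trunc_conc.
  have /lker0_injP kw := iw.
  have [h [gh hE]] := iI _ _ _ _ gw kw (ghom_comp (@trunc_in_ghom K A I b) gu).
  have [h' [gh' h'E]] := land _ _ cN gh; exists h'; split=> //.
  apply/lfunP => x; apply: (@trunc_in_inj K A I b).
  by rewrite lfE -(comp_lfunE (trunc_in I b)) h'E -comp_lfunE hE lfE.
- have [_ h _] := D_ses sp; apply: h; first exact: (D_pd1 pP1 pP0 sfg).
  by apply: Db => j bj; apply: Z0; left.
by move=> x y xy; apply: ii; rewrite -vE !lfE xy.
Qed.

(** Take cosyzygies in injectives of [D] until finite projective dimension makes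
    the last sequence split; then its end term is in [D], and so are the
    earlier cosyzygies, back to [L]. *)
Lemma D_conc b L : (forall M, (forall j, b <= j -> gm_deg M j = 0%VS) -> D M) ->
  concentrated b L -> D L.
Proof.
move=> Db cL; have [n epdn] := finite_epd fin.
have next m : exists L', cosyzygy b L m L' /\ concentrated b L'.
  elim: m => [|m [L' [cL' cL'']]]; first by exists L; split=> //; constructor.
  have [I [i [eI DI gi ii]]] := enough_einj Db cL''.
  have [L'' [p s]] := ses_of_inj gi ii.
  exists L''; split; first exact: cosyzygyS cL' s eI DI.
  exact: conc_surj (ses_out s) (ses_surj s) (proj1 eI).
have [L' [cL' conL']] := next n.
have [I [i [eI DI gi ii]]] := enough_einj Db conL'.
have [L'' [p s]] := ses_of_inj gi ii.
have conL'' : concentrated b L'' := conc_surj (ses_out s) (ses_surj s) (proj1 eI).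
have [h [gh hE]] := cosyzygy_lift (epdn b L'' conL'') cL' s eI (ghom1 L'').
apply: (cosyzygy_D (cosyzygyS cL' s eI DI)); apply: D_retract DI.
exists h, p; split=> //; first exact: ses_out s.
by move=> x; rewrite -comp_lfunE hE lfE.
Qed.

(** Split off the highest degree. *)
Lemma D_below (b : nat) M : (forall j : int, b%:Z <= j -> gm_deg M j = 0%VS) -> D M.
Proof.
elim: b M => [|b IH] M M0; first exact: D_neg.
have [Z [p [sp Z0]]] := trunc_ses M b%:Z.
have [_ _ h] := D_ses sp; apply: h.
  by apply: (D_conc IH); apply: trunc_conc => j bj; apply: M0; lia.
by apply: IH => j bj; apply: Z0; left.
Qed.

Lemma D_all M : D M.
Proof.
have [n Mn] := gm_bounded M; apply: (@D_below n) => j nj.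
by apply: Mn; rewrite nj.
Qed.

End Generation.

Theorem theorem1p4 (K : fieldType) (A : graded_alg K)
    (hA : iwanaga_gorenstein 1 A) :
  presilting (Vmod A) /\
  (finite_gldim (galg0 A) -> silting (Vmod A)).
Proof.
split=> [|fin]; first exact: Vmod_presilting.
split=> [|C tC CV X cX]; first exact: Vmod_presilting.
apply/(syz_in_CM hA tC cX); apply: (@D_all K A hA fin (syz_in C)).
- by move=> P; apply: syz_in_gproj.
- by move=> P1 P0 M f g; apply: syz_in_pd1.
- by move=> M N; apply: syz_in_retract.
- by move=> M N L f g; apply: syz_in_ses.
by move=> n; apply: syz_in_trunc.
Qed.
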